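(* Let $G$ be an infinite sofic group with Property (T). Then the group von Neumann algebra $L(G)$, equipped with its canonical trace $\tau(x)=\langle x\delta_e,\delta_e\rangle$, is strongly $1$-bounded.
   Context: Groups are countable and discrete; Property (T) is Kazhdan's Property (T). **Group von Neumann algebra.** $\lambda:G\to\mathcal U(\ell^2(G))$ is the left regular representation, $L(G)$ is the strong-operator closure of $\mathrm{span}\{\lambda(g):g\in G\}$, and $\tau(x)=\langle x\delta_e,\delta_e\rangle$ is its canonical faithful normal tracial state. **Sofic.** $G$ is sofic if for every finite $F\subseteq G$ and $\epsilon>0$ there are $n\in\mathbb N$ and a map $\sigma:G\to \mathrm{Sym}(n)$ such that, with $d_n(\alpha,\beta)=\frac1n|\{k:\alpha(k)\ne\beta(k)\}|$, one has $d_n(\sigma(g)\sigma(h),\sigma(gh))<\epsilon$ for all $g,h\in F$ and $d_n(\sigma(g),\mathrm{id})>1-\epsilon$ for all $g\in F\setminus\{e\}$. **Norms and laws.** For a tracial von Neumann algebra $(M,\tau)$ (a von Neumann algebra with faithful normal tracial state), $M_{\mathrm{sa}}$ is the set of self-adjoint elements; for $x=(x_1,\dots,x_d)\in M^d$ put $\|x\|_p=(\sum_j\tau(|x_j|^p))^{1/p}$ for $1\le p<\infty$ and $\|x\|_\infty=\max_j\|x_j\|$ (operator norm). On the $n\times n$ matrices $\mathbb M_n(\mathbb C)$ use the normalized trace $\mathrm{tr}_n$. $\mathbb C\langle t_1,\dots,t_d\rangle$ is the $*$-algebra of non-commutative polynomials in self-adjoint variables $t_j$. The law of $x\in M_{\mathrm{sa}}^d$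 is the linear functional $\ell_x(f)=\tau(f(x))$ on $\mathbb C\langle t_1,\dots,t_d\rangle$. $\Sigma_{d,R}$ is the set of all laws $\ell_x$ of self-adjoint $d$-tuples $x$ in tracial von Neumann algebras with $\|x\|_\infty\le R$, with the weak$^*$ topology (pointwise convergence on polynomials). **Strong $1$-boundedness.** Let $x\in M_{\mathrm{sa}}^d$ generate $M$ as a von Neumann algebra and $\|x\|_\infty\le R$. For $\mathcal O\subseteq\Sigma_{d,R}$ open let $\Gamma_R^{(n)}(\mathcal O)=\{X\in\mathbb M_n(\mathbb C)_{\mathrm{sa}}^d:\ell_X\in\mathcal O\}$ (in particular $\|X\|_\infty\le R$). For $\Omega\subseteq\mathbb M_n(\mathbb C)^d$, $K^{\mathrm{orb}}_\varepsilon(\Omega)$ is the minimal cardinality of a set $\Xi\subseteq\mathbb M_n(\mathbb C)^d$ such that for every $A\in\Omega$ there are $B\in\Xi$ and a unitary $V\in\mathbb M_n(\mathbb C)$ with $\|A-VBV^*\|_2<\varepsilon$. Put $$h_{R,\varepsilon}(\mathcal O)=\limsup_{n\to\infty}\tfrac1{n^2}\log K^{\mathrm{orb}}_\varepsilon(\Gamma^{(n)}_R(\mathcal O)),\quad h_{R,\varepsilon}(x)=\inf_{\mathcal O\ni\ell_x}h_{R,\varepsilon}(\mathcal O),\quad h(M)=h_R(x)=\sup_{\varepsilon>0}h_{R,\varepsilon}(x)$$ ($\log 0=-\infty$). It is known that this does not depend on $R$ or on the generating tuple $x$. A finitely generated $M$ is called strongly $1$-bounded if $h(M)<\infty$ (this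 is equivalent to Jung's original definition). (Property (T) groups are finitely generated, so $L(G)$ is finitely generated.) *)

(* Defs.v *)
From HB Require Import structures.
From mathcomp Require Import all_boot all_order all_fingroup all_algebra.
From mathcomp Require Import all_classical all_reals all_analysis.
From mathcomp Require Import complex finmap.
From mathcomp Require Import ring lra.
From mathcomp Require monalg.
Import(canonicals,coercions) monalg.

Set Implicit Arguments.
Unset Strict Implicit.
Unset Printing Implicit Defensive.

Import Order.TTheory GRing.Theory Num.Theory.
Import Num.Def.
Import numFieldNormedType.Exports.
Import ComplexField.Normc.

Local Open Scope classical_set_scope.
Local Open Scope ring_scope.
Local Open Scope sesquilinear_scope.

Local Notation Re := complex.Re.
Local Notation Im := complex.Im.

Section complex_facts.
Variable R : realType.
Implicit Types z w : R[i].

Lemma normc_sqr z : normc z ^+ 2 = Re z ^+ 2 + Im z ^+ 2.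
Proof. by case: z => a b; rewrite /normc sqr_sqrtr// addr_ge0// sqr_ge0. Qed.

Lemma normc_ge0 z : 0 <= normc z.
Proof. by case: z => a b; exact: sqrtr_ge0. Qed.

Lemma conjCE z : z^* = (Re z -i* Im z)%C.
Proof. by case: z. Qed.

Lemma ReD z w : Re (z + w) = Re z + Re w.
Proof. by case: z w => a b [c d]. Qed.
Lemma ImD z w : Im (z + w) = Im z + Im w.
Proof. by case: z w => a b [c d]. Qed.
Lemma ReM z w : Re (z * w) = Re z * Re w - Im z * Im w.
Proof. by case: z w => a b [c d]. Qed.
Lemma ImM z w : Im (z * w) = Re z * Im w + Im z * Re w.
Proof. by case: z w => a b [c d]. Qed.
Lemma ReJ z : Re z^* = Re z. Proof. by case: z. Qed.
Lemma ImJ z : Im z^* = - Im z. Proof. by case: z. Qed.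
Lemma complexP z w : Re z = Re w -> Im z = Im w -> z = w.
Proof. by case: z w => a b [c d] /= -> ->. Qed.
End complex_facts.

Section summation.
Variables (R : realType) (T : choiceType).
Implicit Types (a b p q : T -> R) (z w : T -> R[i]).

Let esT (a : T -> R) : \bar R := (\esum_(t in [set: T]) (a t)%:E)%E.

(* The sum of the family [a]; meaningful only if it is absolutely summable. *)
Definition rsum a : R :=
  fine (\esum_(t in [set: T]) (Num.max (a t) 0)%:E)
  - fine (\esum_(t in [set: T]) (Num.max (- a t) 0)%:E).

Definition csum z : R[i] := (rsum (fun t => Re (z t)) +i* rsum (fun t => Im (z t)))%C.

Let ges p : (forall t, 0 <= p t) -> (0 <= esT p)%E.
Proof. by move=> p0; apply: esum_ge0 => t _; rewrite lee_fin. Qed.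

Let esfin p : (forall t, 0 <= p t) -> (esT p < +oo)%E -> esT p \is a fin_num.
Proof. by move=> p0 pfin; rewrite ge0_fin_numE//; exact: ges. Qed.

Let esD p q : (forall t, 0 <= p t) -> (forall t, 0 <= q t) ->
  (esT (fun t => p t + q t)%R = esT p + esT q)%E.
Proof.
by move=> p0 q0; rewrite /esT -esumD//= => t _; rewrite lee_fin.
Qed.

Let esle p q : (forall t, p t <= q t) -> (esT p <= esT q)%E.
Proof. by move=> pq; apply: le_esum => t _; rewrite lee_fin. Qed.

Let esZ c p : 0 <= c -> (forall t, 0 <= p t) ->
  (esT (fun t => c * p t)%R = c%:E * esT p)%E.
Proof.
have H d r : 0 <= d -> (forall t, 0 <= r t) ->
    (esT (fun t => d * r t)%R <= d%:E * esT r)%E.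
  move=> d0 r0; apply: ge_ereal_sup => _ [X [finX _] <-].
  have -> : (\sum_(t \in X) (d * r t)%:E = d%:E * \sum_(t \in X) (r t)%:E)%E.
    by rewrite ge0_mule_fsumr// => t; rewrite lee_fin.
  rewrite lee_wpmul2l ?lee_fin//; apply: ereal_sup_ubound.
  by exists X => //; split.
move=> c0 p0; have [->|cn0] := eqVneq c 0.
  rewrite mul0e; apply: esum1 => t _; by rewrite mul0r.
have cp : 0 < c by rewrite lt_def cn0.
apply/eqP; rewrite eq_le H//=.
rewrite -[leRHS]mul1e -(divff cn0) EFinM -muleA lee_wpmul2l ?lee_fin//.
have cp0 t : 0 <= c * p t by exact: mulr_ge0.
have ic0 : 0 <= c^-1 by rewrite invr_ge0.
apply: le_trans (H _ _ ic0 cp0).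
by apply: esle => t; rewrite mulrA mulVf// mul1r.
Qed.

Let asum a := (esT (fun t => `|a t|%R) < +oo)%E.

Let rsumB a p q : (forall t, 0 <= p t) -> (forall t, 0 <= q t) ->
  (esT p < +oo)%E -> (esT q < +oo)%E -> (forall t, a t = p t - q t) ->
  rsum a = fine (esT p) - fine (esT q).
Proof.
move=> p0 q0 pf qf apq.
have mf r s : (forall t, 0 <= r t) -> (esT s < +oo)%E ->
  (forall t, r t <= s t) -> esT r \is a fin_num.
  by move=> r0 sf rs; apply: esfin => //; apply: le_lt_trans sf; exact: esle.
set P := fun t => Num.max (a t) 0; set N := fun t => Num.max (- a t) 0.
have P0 t : 0 <= P t by rewrite /P le_max lexx orbT.
have N0 t : 0 <= N t by rewrite /N le_max lexx orbT.
have Pf : esT P \is a fin_num.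
  apply: (mf _ p) => // t; rewrite /P ge_max p0 andbT apq; have := q0 t; lra.
have Nf : esT N \is a fin_num.
  apply: (mf _ q) => // t; rewrite /N ge_max q0 andbT apq; have := p0 t; lra.
have : (esT P + esT q = esT N + esT p)%E.
  rewrite -!esD//; congr esum; apply/funext => t; congr EFin.
  rewrite /P /N; have := apq t; case: (lerP (a t) 0) => h1; case: (lerP (- a t) 0) => h2; lra.
rewrite /rsum -/(esT P) -/(esT N).
rewrite -(fineK Pf) -(fineK Nf) -(fineK (esfin p0 pf)) -(fineK (esfin q0 qf)).
by rewrite -!EFinD => -[] /=; lra.
Qed.

Lemma rsumD a b : asum a -> asum b ->
  rsum (fun t => a t + b t) = rsum a + rsum b.
Proof.
move=> af bf.
pose P a (t : T) := Num.max (a t) 0; pose N a (t : T) := Num.max (- a t) 0.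
have P0 c t : 0 <= P c t by rewrite /P le_max lexx orbT.
have N0 c t : 0 <= N c t by rewrite /N le_max lexx orbT.
have Pf c : asum c -> (esT (P c) < +oo)%E.
  apply: le_lt_trans; apply: esle => t; rewrite /P ge_max normr_ge0 andbT.
  exact: ler_norm.
have Nf c : asum c -> (esT (N c) < +oo)%E.
  apply: le_lt_trans; apply: esle => t; rewrite /N ge_max normr_ge0 andbT.
  by rewrite -normrN ler_norm.
rewrite (@rsumB _ (fun t => P a t + P b t) (fun t => N a t + N b t)).
- rewrite !esD// !fineD ?esfin//; try by [exact: Pf|exact: Nf].
  rewrite /rsum -/(esT (P a)) -/(esT (P b)) -/(esT (N a)) -/(esT (N b)); lra.
- by move=> t; rewrite addr_ge0.
- by move=> t; rewrite addr_ge0.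
- by rewrite esD// lte_add_pinfty//; exact: Pf.
- by rewrite esD// lte_add_pinfty//; exact: Nf.
- move=> t; rewrite /P /N.
  case: (lerP (a t) 0) => h1; case: (lerP (- a t) 0) => h2;
    case: (lerP (b t) 0) => h3; case: (lerP (- b t) 0) => h4; lra.
Qed.

Lemma rsumZ (c : R) a : asum a -> rsum (fun t => c * a t) = c * rsum a.
Proof.
move=> af.
pose P (t : T) := Num.max (a t) 0; pose N (t : T) := Num.max (- a t) 0.
have P0 t : 0 <= P t by rewrite /P le_max lexx orbT.
have N0 t : 0 <= N t by rewrite /N le_max lexx orbT.
have Pf : esT P \is a fin_num.
  apply: esfin => //; apply: le_lt_trans af; apply: esle => t.
  by rewrite /P ge_max normr_ge0 andbT ler_norm.
have Nf : esT N \is a fin_num.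
  apply: esfin => //; apply: le_lt_trans af; apply: esle => t.
  by rewrite /N ge_max normr_ge0 andbT -normrN ler_norm.
have aPN t : a t = P t - N t.
  by rewrite /P /N; case: (lerP (a t) 0) => h1; case: (lerP (- a t) 0) => h2; lra.
have fl d (r : T -> R) : 0 <= d -> (forall t, 0 <= r t) -> esT r \is a fin_num ->
    (esT (fun t => d * r t)%R < +oo)%E.
  by move=> d0 r0 rf; rewrite esZ// -(fineK rf) -EFinM ltry.
rewrite [X in _ * X]/rsum -/(esT P) -/(esT N).
have [c0|c0] := leP 0 c.
  rewrite (@rsumB _ (fun t => c * P t) (fun t => c * N t)).
  - by rewrite !esZ// !fineM//=; lra.
  - by move=> t; rewrite mulr_ge0.
  - by move=> t; rewrite mulr_ge0.
  - exact: fl.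
  - exact: fl.
  - by move=> t; rewrite aPN; lra.
have c0' : 0 <= - c by lra.
rewrite (@rsumB _ (fun t => (- c) * N t) (fun t => (- c) * P t)).
- by rewrite !esZ// !fineM//=; lra.
- by move=> t; rewrite mulr_ge0.
- by move=> t; rewrite mulr_ge0.
- exact: fl.
- exact: fl.
- by move=> t; rewrite aPN; lra.
Qed.

Lemma rsum_ge0E p : (forall t, 0 <= p t) -> rsum p = fine (esT p).
Proof.
move=> p0; rewrite /rsum [X in _ - fine X]esum1 ?subr0 => [|t _].
  by congr fine; congr esum; apply/funext => t; congr EFin; apply/max_idPl.
by congr EFin; apply/max_idPr; rewrite oppr_le0.
Qed.

Definition csummable z := (\esum_(t in [set: T]) (normc (z t))%:E < +oo)%E.

Let normRe (u : R[i]) : `|Re u| <= normc u.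
Proof.
by case: u => x y /=; rewrite -sqrtr_sqr ler_wsqrtr ?lerDl ?sqr_ge0.
Qed.
Let normIm (u : R[i]) : `|Im u| <= normc u.
Proof.
by case: u => x y /=; rewrite -sqrtr_sqr ler_wsqrtr ?lerDr ?sqr_ge0.
Qed.

Let sumRe z : csummable z -> asum (fun t => Re (z t)).
Proof. by apply: le_lt_trans; apply: esle => t /=; exact: normRe. Qed.
Let sumIm z : csummable z -> asum (fun t => Im (z t)).
Proof. by apply: le_lt_trans; apply: esle => t /=; exact: normIm. Qed.

Lemma csumD z w : csummable z -> csummable w ->
  csum (fun t => z t + w t) = csum z + csum w.
Proof.
move=> zf wf; apply: complexP; rewrite /csum /=.
  by rewrite -rsumD ?sumRe//; congr rsum; apply/funext => t /=; rewrite ReD.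
by rewrite -rsumD ?sumIm//; congr rsum; apply/funext => t /=; rewrite ImD.
Qed.

Let asumZ c a : asum a -> asum (fun t => c * a t).
Proof.
move=> af; rewrite /asum; have -> : (fun t => `|c * a t|) = (fun t => `|c| * `|a t|).
  by apply/funext => t; rewrite normrM.
by rewrite esZ// -(fineK (esfin _ af))// -EFinM ltry.
Qed.

Lemma csumZ (c : R[i]) z : csummable z -> csum (fun t => c * z t) = c * csum z.
Proof.
move=> zf; have rf := sumRe zf; have jf := sumIm zf.
apply: complexP; rewrite ?ReM ?ImM /csum /=.
  rewrite -mulNr -!rsumZ// -rsumD; try exact: asumZ.
  by congr rsum; apply/funext => t /=; rewrite ReM mulNr.
rewrite -!rsumZ// -rsumD; try exact: asumZ.
by congr rsum; apply/funext => t /=; rewrite ImM.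
Qed.

Lemma csumJ z : csummable z -> csum (fun t => (z t)^*) = (csum z)^*.
Proof.
move=> zf; apply: complexP; rewrite ?ReJ ?ImJ /csum /=.
  by congr rsum; apply/funext => t /=; rewrite ReJ.
rewrite -mulN1r -rsumZ ?sumIm//.
by congr rsum; apply/funext => t /=; rewrite ImJ mulN1r.
Qed.

Lemma csummableZ (c : R[i]) z : csummable z -> csummable (fun t => c * z t).
Proof.
rewrite /csummable => zf.
under eq_esum do rewrite normcM.
by rewrite -/(esT _) esZ ?lte_mul_pinfty ?lee_fin// => *; exact: normc_ge0.
Qed.

Lemma esumZ c p : 0 <= c -> (forall t, 0 <= p t) ->
  (esT (fun t => c * p t)%R = c%:E * esT p)%E.
Proof. exact: esZ. Qed.

End summation.

Section ell2.
Variables (R : realType) (T : choiceType).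

Definition sq_summable (f : T -> R[i]) :=
  (\esum_(t in [set: T]) (normc (f t) ^+ 2)%:E < +oo)%E.

Definition sq_summable_pred : {pred T -> R[i]} := fun f => `[< sq_summable f >].

Lemma normc_sqrD (z w : R[i]) :
  normc (z + w) ^+ 2 <= 2 * normc z ^+ 2 + 2 * normc w ^+ 2.
Proof.
rewrite !normc_sqr ReD ImD.
have := sqr_ge0 (Re z - Re w); have := sqr_ge0 (Im z - Im w).
by rewrite !sqrrD !sqrrN !mulrN; lra.
Qed.

Lemma sq_summable_le (f : T -> R[i]) (g : T -> R) :
  (forall t, normc (f t) ^+ 2 <= g t) ->
  (\esum_(t in [set: T]) (g t)%:E < +oo)%E -> sq_summable f.
Proof.
by move=> fg; apply: le_lt_trans; apply: le_esum => t _; rewrite lee_fin.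
Qed.

Lemma esum_lt_pinftyZ (c : R) (g : T -> R) : (forall t, 0 <= g t) -> 0 <= c ->
  (\esum_(t in [set: T]) (g t)%:E < +oo)%E ->
  (\esum_(t in [set: T]) (c * g t)%:E < +oo)%E.
Proof. by move=> g0 c0 gf; rewrite esumZ// lte_mul_pinfty// lee_fin. Qed.

Lemma sq_summableD f g : sq_summable f -> sq_summable g -> sq_summable (f + g).
Proof.
move=> ff gf; apply: (sq_summable_le (fun t => normc_sqrD (f t) (g t))).
under eq_esum do rewrite EFinD.
rewrite esumD//=; try by move=> t _; rewrite lee_fin mulr_ge0// sqr_ge0.
by apply: lte_add_pinfty; apply: esum_lt_pinftyZ => //; move=> t; exact: sqr_ge0.
Qed.

Lemma sq_summableZ c f : sq_summable f -> sq_summable (c *: f).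
Proof.
move=> ff; apply: (@sq_summable_le _ (fun t => normc c ^+ 2 * normc (f t) ^+ 2)).
  by move=> t; rewrite -exprMn -normcM.
by apply: esum_lt_pinftyZ => //; move=> *; exact: sqr_ge0.
Qed.

Lemma sq_summable_submod : submod_closed sq_summable_pred.
Proof.
split=> [|c f g /asboolP ff /asboolP gf]; apply/asboolP.
  by rewrite /sq_summable esum1// => t _; rewrite (_ : normc _ = 0) ?expr0n//; exact: normc0.
by apply: sq_summableD => //; exact: sq_summableZ.
Qed.

HB.instance Definition _ := GRing.isSubmodClosed.Build R[i] (T -> R[i])
  sq_summable_pred sq_summable_submod.

Record ell2 := Ell2 {ell2_fun :> T -> R[i]; ell2P : ell2_fun \in sq_summable_pred}.

HB.instance Definition _ := [isSub for ell2_fun].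
HB.instance Definition _ := [Choice of ell2 by <:].
HB.instance Definition _ := [SubChoice_isSubLmodule of ell2 by <:].

Implicit Types u v w : ell2.

Lemma ell2_sum u : sq_summable u. Proof. by have /asboolP := ell2P u. Qed.

Definition ell2_dot u v : R[i] := csum (fun t => u t * (v t)^*).

Lemma ell2_csummable u v : csummable (fun t => u t * (v t)^*).
Proof.
apply: (@le_lt_trans _ _ (\esum_(t in [set: T])
    ((normc (u t) ^+ 2)%:E + (normc (v t) ^+ 2)%:E))%E).
  apply: le_esum => t _; rewrite -EFinD lee_fin normcM.
  have -> : normc (v t)^* = normc (v t).
    by rewrite conjCE; case: (v t) => a b /=; rewrite sqrrN.
  have := sqr_ge0 (normc (u t) - normc (v t)).
  have := sqr_ge0 (normc (u t)); have := sqr_ge0 (normc (v t)).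
  by rewrite !sqrrD !sqrrN !mulrN; lra.
rewrite esumD//= => [|t _|t _]; rewrite ?lee_fin ?sqr_ge0//.
by apply: lte_add_pinfty; exact: ell2_sum.
Qed.

Lemma ell2_dotC u v : ell2_dot u v = (ell2_dot v u)^*.
Proof.
rewrite /ell2_dot -csumJ; last exact: ell2_csummable.
by congr csum; apply/funext => t; rewrite rmorphM/= conjCK mulrC.
Qed.

Lemma ell2_dotl w : linear_for *%R (ell2_dot ^~ w).
Proof.
move=> c u v; rewrite /ell2_dot -csumZ; last exact: ell2_csummable.
rewrite -csumD; [|apply: csummableZ|]; try exact: ell2_csummable.
by congr csum; apply/funext => t; rewrite mulrDl mulrA.
Qed.

Lemma ell2_dotr w : linear_for (conjC \; *%R) (ell2_dot w).
Proof.
move=> c u v; rewrite ell2_dotC ell2_dotl rmorphD rmorphM /=.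
by rewrite -!ell2_dotC.
Qed.

Lemma ell2_dotE u :
  ell2_dot u u = (fine (\esum_(t in [set: T]) (normc (u t) ^+ 2)%:E))%:C%C.
Proof.
have E t : u t * (u t)^* = (normc (u t) ^+ 2)%:C%C.
  rewrite normc_sqr conjCE; case: (u t) => a b /=; apply: complexP => /=; lra.
apply: complexP => /=; rewrite /ell2_dot /csum /=.
  rewrite rsum_ge0E => [|t]; last by rewrite E /= sqr_ge0.
  by congr fine; apply: eq_esum => t _; rewrite E.
rewrite rsum_ge0E => [|t]; last by rewrite E.
by rewrite esum1// => t _; rewrite E.
Qed.

Lemma normc_le_dot u t : normc (u t) ^+ 2 <= Re (ell2_dot u u).
Proof.
rewrite ell2_dotE /= -lee_fin fineK; last first.
  rewrite ge0_fin_numE ?ell2_sum//; first exact: ell2_sum.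
  by apply: esum_ge0 => s _; rewrite lee_fin sqr_ge0.
apply: esum_ge; exists [set t]; first by split.
by rewrite fsbig_set1.
Qed.

Lemma ell2_dot_gt0 u : u != 0 -> 0 < ell2_dot u u.
Proof.
move=> u0; rewrite lt_def; apply/andP; split; last first.
  by rewrite ell2_dotE ler0c fine_ge0// esum_ge0// => t _; rewrite lee_fin sqr_ge0.
apply: contra_neq u0 => uu0; apply/val_inj/funext => t /=.
have := normc_le_dot u t; rewrite uu0 /= => h.
apply/eq0_normc/eqP; rewrite -sqrf_eq0; apply/eqP/le_anti.
by rewrite h sqr_ge0.
Qed.

HB.instance Definition _ := bilinear_isBilinear.Build R[i] ell2 ell2 R[i]
  *%R (conjC \; *%R) ell2_dot (ell2_dotl, ell2_dotr).

End ell2.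

Section dot_norm.
Variables (C : numClosedFieldType) (U : lmodType C) (form : {dot U for conjC}).
Local Notation "''[' u , v ]" := (form u%R v%R) : ring_scope.
Local Notation "''[' u ]" := '[u, u]%R : ring_scope.

Lemma dot_CauchySchwarz u v : `|'[u, v]| ^+ 2 <= '[u] * '[v].
Proof.
have [->|v0] := eqVneq v 0.
  by rewrite linear0r normr0 expr0n mulr_ge0 ?dnorm_ge0.
pose a := '[u, v] / '[v]; pose w := u - a *: v.
have wv : '[w, v] = 0.
  by rewrite /w linearBl/= linearZl_LR/= divfK ?dnorm_eq0 ?subrr.
have -> : u = w + a *: v by rewrite subrK.
rewrite linearDl/= wv add0r linearZl_LR/= normrM (ger0_norm (dnorm_ge0 _ _)).
rewrite hnormDd/=; last by rewrite linearZr_LR/= wv mulr0.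
by rewrite exprMn mulrDl dnormZ expr2 !mulrA lerDr mulr_ge0.
Qed.

Lemma dot_triangle u v : sqrtC '[u + v] <= sqrtC '[u] + sqrtC '[v].
Proof.
rewrite -ler_sqr ?nnegrE ?addr_ge0 ?sqrtC_ge0//.
rewrite sqrrD !sqrtCK addrAC dnormD lerD2l/=.
apply: (@le_trans _ _ (`|'[u, v]| *+ 2)).
  apply: le_trans (real_ler_norm _) _; first by rewrite CrealE rmorphD/= conjCK addrC.
  by apply: le_trans (ler_normD _ _) _; rewrite norm_conjC mulr2n.
rewrite lerMn2r/= -ler_sqr ?nnegrE ?mulr_ge0 ?sqrtC_ge0//.
by rewrite exprMn !sqrtCK dot_CauchySchwarz.
Qed.

End dot_norm.

Section ell2_hilbert.
Variables (R : realType) (T : choiceType).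
Local Notation ell2 := (ell2 R T).
Implicit Types u v w : ell2.

Lemma ell2_dot_herm u v : ell2_dot u v = (-1) ^+ false * (ell2_dot v u)^*.
Proof. by rewrite mul1r -ell2_dotC. Qed.

HB.instance Definition _ := isHermitianSesquilinear.Build R[i] ell2 false conjC
  (@ell2_dot R T) ell2_dot_herm.
HB.instance Definition _ := isDotProduct.Build R[i] ell2 (@ell2_dot R T)
  (@ell2_dot_gt0 R T).

Definition ell2_norm u : R[i] := sqrtC (ell2_dot u u).

Lemma ell2_normD u v : ell2_norm (u + v) <= ell2_norm u + ell2_norm v.
Proof. exact: dot_triangle. Qed.

Lemma ell2_normZ c u : ell2_norm (c *: u) = `|c| * ell2_norm u.
Proof.
by rewrite /ell2_norm dnormZ sqrtCM ?nnegrE ?exprn_ge0 ?dnorm_ge0// sqrCK.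
Qed.

Lemma ell2_norm0_eq0 u : ell2_norm u = 0 -> u = 0.
Proof. by move/eqP; rewrite sqrtC_eq0 dnorm_eq0 => /eqP. Qed.

HB.instance Definition _ := Lmodule_isNormed.Build R[i] ell2
  ell2_normD ell2_normZ ell2_norm0_eq0.

Lemma ell2_dot_norm u : ell2_dot u u = `|u| ^+ 2.
Proof. by rewrite sqrtCK. Qed.

Lemma normc_le_norm u t : (normc (u t))%:C%C <= `|u|.
Proof.
rewrite -ler_sqr ?nnegrE ?ler0c ?normc_ge0// -ell2_dot_norm -rmorphXn/=.
by have := normc_le_dot u t; rewrite ell2_dotE lecR.
Qed.

Lemma sum_le_norm u (X : {fset T}) (e : R) : 0 <= e -> `|u| <= e%:C%C ->
  \sum_(t <- X) normc (u t) ^+ 2 <= e ^+ 2.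
Proof.
move=> e0 ue; have : `|u| ^+ 2 <= (e ^+ 2)%:C%C.
  by rewrite rmorphXn lerXn2r ?nnegrE ?ler0c.
rewrite -ell2_dot_norm ell2_dotE lecR; apply: le_trans.
rewrite -lee_fin fineK; last first.
  rewrite ge0_fin_numE; first exact: ell2_sum.
  by apply: esum_ge0 => s _; rewrite lee_fin sqr_ge0.
apply: esum_ge; exists [set` X]; first by split.
by rewrite fsbig_finite//= set_fsetK sumEFin.
Qed.

Lemma ell2_complete (F : set_system ell2) : ProperFilter F -> cauchy F -> cvg F.
Proof.
move=> FF /cauchyP Fc.
have Fc' (e : R) : 0 < e -> exists u, F [set v | `|u - v| < e%:C%C].
  move=> e0; have [|u] := Fc e%:C%C; first by rewrite ltcR.
  by rewrite -ball_normE => Fu; exists u.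
have normRe (z : R[i]) : `|Re z| <= normc z.
  by case: z => a b /=; rewrite -sqrtr_sqr ler_wsqrtr ?lerDl ?sqr_ge0.
have normIm (z : R[i]) : `|Im z| <= normc z.
  by case: z => a b /=; rewrite -sqrtr_sqr ler_wsqrtr ?lerDr ?sqr_ge0.
have lt_pt u v t (e : R) : `|u - v| < e%:C%C -> normc (u t - v t) < e.
  by move=> uv; rewrite -ltcR; apply: le_lt_trans uv; exact: (normc_le_norm (u - v)).
have cvgRe t : cvg ((fun u : ell2 => Re (u t) : R^o) @ F).
  apply: cauchy_cvg; apply/cauchyP => e e0; have [u Fu] := Fc' e e0.
  exists (Re (u t)); rewrite /nbhs/=; apply: filterS Fu => v /lt_pt - /(_ t).
  rewrite -ball_normE /ball_/=; apply: le_lt_trans.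
  by apply: le_trans (normRe _); rewrite raddfB.
have cvgIm t : cvg ((fun u : ell2 => Im (u t) : R^o) @ F).
  apply: cauchy_cvg; apply/cauchyP => e e0; have [u Fu] := Fc' e e0.
  exists (Im (u t)); rewrite /nbhs/=; apply: filterS Fu => v /lt_pt - /(_ t).
  rewrite -ball_normE /ball_/=; apply: le_lt_trans.
  by apply: le_trans (normIm _); rewrite raddfB.
pose f t : R[i] := (lim ((fun u : ell2 => Re (u t) : R^o) @ F) +i*
                    lim ((fun u : ell2 => Im (u t) : R^o) @ F))%C.
have Ff t (e : R) : 0 < e -> F [set v | normc (f t - v t) ^+ 2 <= e].
  move=> e0; pose d := Num.sqrt (e / 2).
  have d0 : 0 < d by rewrite sqrtr_gt0 divr_gt0.
  have d2 : d ^+ 2 = e / 2 by rewrite sqr_sqrtr// divr_ge0// ltW.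
  have le2 (x : R) : `|x| < d -> x ^+ 2 <= e / 2.
    by move=> xd; rewrite -d2 -real_normK ?num_real// lerXn2r ?nnegrE// ltW.
  have /cvgrPdist_lt/(_ _ d0) FR := cvgRe t.
  have /cvgrPdist_lt/(_ _ d0) FI := cvgIm t.
  apply: filterS2 FR FI => v vR vI.
  rewrite /= normc_sqr !ReD !ImD !raddfN/=.
  by have := le2 _ vR; have := le2 _ vI; lra.
have key (e : R) u0 v : 0 < e -> F [set w | `|u0 - w| < e%:C%C] ->
    `|u0 - v| < e%:C%C -> forall X : {fset T},
  \sum_(t <- X) normc (f t - v t) ^+ 2 <= 10 * e ^+ 2.
  move=> e0 Fu uv X; pose d := e ^+ 2 / (#|` X|%:R + 1).
  have n1 : 0 < (#|` X|%:R + 1 : R) by rewrite ltr_wpDl.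
  have d0 : 0 < d by rewrite divr_gt0// exprn_gt0.
  have dX : d *+ size X <= e ^+ 2.
    rewrite -mulr_natr /d mulrAC -mulrA ler_piMr ?sqr_ge0//.
    by rewrite ler_pdivrMr// mul1r lerDl.
  clearbody d.
  have FX : F (\bigcap_(t in [set` X]) [set w : ell2 | normc (f t - w t) ^+ 2 <= d]).
    by apply: filter_bigI => t _; exact: Ff.
  have [w [wX uw]] := filter_ex (filterI FX Fu).
  have wv : `|w - v| <= (2 * e)%:C%C.
    rewrite -(subrKA u0) (le_trans (ler_normD _ _))// distrC.
    by rewrite mulr_natl mulr2n rmorphD/= lerD// ltW.
  have e20 : 0 <= 2 * e by rewrite mulr_ge0// ltW.
  have Swv := sum_le_norm X e20 wv.
  apply: (@le_trans _ _ (\sum_(t <- X) (2 * d + 2 * normc ((w - v) t) ^+ 2))).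
    rewrite big_seq [leRHS]big_seq; apply: ler_sum => t tX.
    have -> : f t - v t = (f t - w t) + (w - v) t.
      by rewrite [(w - v) t]/(w t - v t) subrKA.
    apply: le_trans (normc_sqrD _ _) _; rewrite lerD2r ler_pM2l//.
    exact: (wX t).
  rewrite big_split/= -!mulr_sumr big_const_seq count_predT iter_addr_0.
  by move: Swv; rewrite exprMn; lra.
have key2 (e : R) u0 v : 0 < e -> F [set w | `|u0 - w| < e%:C%C] ->
    `|u0 - v| < e%:C%C ->
  (\esum_(t in [set: T]) (normc (f t - v t) ^+ 2)%:E <= (10 * e ^+ 2)%:E)%E.
  move=> e0 Fu uv; apply: ge_ereal_sup => _ [X [finX _] <-].
  rewrite fsbig_finite//= sumEFin lee_fin; exact: key Fu uv _.
have f2 : f \in @sq_summable_pred R T.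
  have [u0 Fu] := Fc' 1 ltr01; have [v uv] := filter_ex Fu.
  apply/asboolP; have -> : f = (f - v) + v by rewrite subrK.
  apply: sq_summableD (ell2_sum v).
  exact: le_lt_trans (key2 _ _ _ ltr01 Fu uv) (ltry _).
apply/cvg_ex; exists (Ell2 f2); apply/fcvgrPdist_lt => -[e e'].
rewrite ltcE/= => /andP[/eqP-> e0].
have [|u0 Fu] := Fc' (e / 4); first by rewrite divr_gt0.
rewrite near_simpl; apply: filterS (Fu) => v uv.
have e4 : 0 < e / 4 by rewrite divr_gt0.
have ec0 : 0 <= e%:C%C by rewrite ler0c ltW.
change (`|Ell2 f2 - v| < e%:C%C).
rewrite -ltr_sqr ?nnegrE// -ell2_dot_norm ell2_dotE -rmorphXn ltcR.
have h := key2 _ _ _ e4 Fu uv.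
rewrite -lte_fin fineK; last first.
  by rewrite ge0_fin_numE; [exact: ell2_sum|apply: esum_ge0 => s _; rewrite lee_fin sqr_ge0].
apply: le_lt_trans h _; rewrite lte_fin.
have := exprn_gt0 2 e0; rewrite exprMn exprVn; lra.
Qed.

HB.instance Definition _ := Uniform_isComplete.Build ell2 ell2_complete.

End ell2_hilbert.

(* [hdot] is linear on the left and conjugate-linear on the right. *)
Structure hilbert (R : realType) := Hilbert {
  hilbert_sort :> completeNormedModType R[i];
  hdot : {dot hilbert_sort for conjC};
  hdot_norm : forall u, hdot u u = `|u| ^+ 2 }.

Definition ell2_hilbert (R : realType) (T : choiceType) : hilbert R :=
  @Hilbert R (ell2 R T) (@ell2_dot R T : {dot ell2 R T for conjC})
    (@ell2_dot_norm R T).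

Section operators.
Variables (R : realType) (H : hilbert R).
Implicit Types (x y : H -> H) (M : set (H -> H)).

Definition bounded_op : set (H -> H) := [set x | linear x /\ continuous x].

Definition opnorm x : \bar R :=
  ereal_sup [set (Re `|x v|)%:E | v in [set v : H | `|v| <= 1]].

Definition adjoint x y := forall u v, hdot H (x u) v = hdot H u (y v).

Definition self_adjoint x := adjoint x x.

Definition op_le x y := forall v, hdot H (x v) v <= hdot H (y v) v.

(* On bounded operators, the strong operator topology is the topology of
   pointwise convergence. *)
Definition sot_closure (S : set (H -> H)) : set (H -> H) :=
  bounded_op `&` closure (S : set {ptws H -> H}).

Definition vN_algebra M :=
  [/\ M `<=` bounded_op, M idfun,
      (forall (a : R[i]) x y, M x -> M y -> M (a *: x + y)),
      (forall x y, M x -> M y -> M (x \o y)) &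
      (forall x, M x -> exists2 y, M y & adjoint x y) /\
      sot_closure M `<=` M].

Definition directed (D : set (H -> H)) := D !=set0 /\
  forall x y, D x -> D y -> exists z, [/\ D z, op_le x z & op_le y z].

Definition op_lub M (D : set (H -> H)) x :=
  (forall y, D y -> op_le y x) /\
  forall z, M z -> self_adjoint z -> (forall y, D y -> op_le y z) -> op_le x z.

(* In the predicates below only the values of [tau] on [M] matter. Normality is
   preservation of least upper bounds of directed sets of self-adjoint
   elements; the order of R[i] makes any upper bound [c] of values
   [tau y] <= [c] comparable to them, so the last clause says that [tau x] is
   the least upper bound of [tau @` D]. *)
Definition normal_functional M (tau : (H -> H) -> R[i]) :=
  forall D x, D `<=` M `&` self_adjoint -> directed D ->
    M x -> self_adjoint x -> op_lub M D x ->
    forall c, (forall y, D y -> tau y <= c) -> tau x <= c.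

Definition tracial_state M (tau : (H -> H) -> R[i]) :=
  [/\ (forall (a : R[i]) x y, M x -> M y ->
         tau (a *: x + y) = a * tau x + tau y),
      tau idfun = 1,
      (forall x, M x -> op_le 0 x -> 0 <= tau x),
      (forall x y, M x -> M y -> tau (x \o y) = tau (y \o x)) &
      (forall x, M x -> op_le 0 x -> tau x = 0 -> x = 0) /\
      normal_functional M tau].

Definition tracial_vN_algebra M tau := vN_algebra M /\ tracial_state M tau.

Definition generates (I : Type) (x : I -> (H -> H)) M :=
  M = smallest vN_algebra (range x).

End operators.

Section laws.
Variables (R : realType) (d : nat).

(* C<t_1, ..., t_d>: the monoid algebra of the free monoid on d letters. *)
Definition ncpoly := monalg.malg (monalg.fmonom 'I_d) R[i].

Definition nceval (A : lmodType R[i]) (one : A) (mul : A -> A -> A)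
    (x : 'I_d -> A) (f : ncpoly) : A :=
  \sum_(m <- monalg.msupp f)
    monalg.mcoeff m f *: foldr (fun j a => mul (x j) a) one (m : seq 'I_d).

Definition functional := {ptws ncpoly -> R[i]^o}.

Definition law (H : hilbert R) (tau : (H -> H) -> R[i]) (x : 'I_d -> (H -> H)) :
    functional :=
  fun f => tau (nceval idfun (fun y z => y \o z) x f).

(* [law tau x] is a priori only a function on polynomials; [functional] carries
   the topology of pointwise convergence, that is the weak* topology. *)
Definition Sigma (r : R) : set functional :=
  [set l | exists (H : hilbert R) M (tau : (H -> H) -> R[i]) x,
     [/\ tracial_vN_algebra M tau,
         forall j, M (x j) /\ self_adjoint (x j),
         forall j, (opnorm (x j) <= r%:E)%E & l = law tau x]].

Definition open_in_Sigma (r : R) (O : set functional) :=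
  exists2 U : set functional, open U & O = Sigma r `&` U.

End laws.

Section matrices.
Variables (R : realType) (d n : nat).
Implicit Types X Y : 'I_d -> 'M[R[i]]_n.

Definition ntr (A : 'M[R[i]]_n) : R[i] := n%:R^-1 * \tr A.

Definition mxlaw X : functional R d := fun f => ntr (nceval 1%:M mulmx X f).

Definition microstates (O : set (functional R d)) : set ('I_d -> 'M[R[i]]_n) :=
  [set X | (forall j, X j \is hermsymmx) /\ O (mxlaw X)].

Definition norm2 X : R := Num.sqrt (Re (\sum_j ntr ((X j)^t* *m X j))).

Definition orbital_cover (e : R) (W Xi : set ('I_d -> 'M[R[i]]_n)) :=
  forall A, W A -> exists B (V : 'M[R[i]]_n),
    [/\ Xi B, V \is unitarymx & norm2 (fun j => A j - V *m B j *m V^t*) < e].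

(* +oo when there is no finite orbital cover. *)
Definition Korb (e : R) (W : set ('I_d -> 'M[R[i]]_n)) : \bar R :=
  ereal_inf [set k%:R%:E | k in
    [set k : nat | exists2 Xi : set _, (Xi #= `I_k)%card & orbital_cover e W Xi]].

End matrices.

Section one_bounded_entropy.
Variables (R : realType) (d : nat) (r : R).
Local Open Scope ereal_scope.

Definition h_open (e : R) (O : set (functional R d)) : \bar R :=
  limn_esup (fun n => ((n%:R ^+ 2)^-1)%:E * lne (Korb e (@microstates R d n O))).

Definition h_eps (e : R) (l : functional R d) : \bar R :=
  ereal_inf [set h_open e O | O in [set O | open_in_Sigma r O /\ O l]].

Definition h_law (l : functional R d) : \bar R :=
  ereal_sup [set h_eps e l | e in [set e : R | (0 < e)%R]].

End one_bounded_entropy.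

(* h(M) is [h_law r (law tau x)], where x is a finite self-adjoint generating
   tuple and r bounds its operator norms; the value does not depend on the
   choice of x and r. *)
Definition strongly_1_bounded (R : realType) (H : hilbert R)
    (M : set (H -> H)) (tau : (H -> H) -> R[i]) :=
  exists d (x : 'I_d -> (H -> H)) (r : R),
    [/\ generates x M, forall j, self_adjoint (x j),
        forall j, (opnorm (x j) <= r%:E)%E & (h_law r (law tau x) < +oo)%E].

Section groups.
Variables (R : realType) (G : groupType).

Lemma sq_summable_translate (g : G) (f : ell2 R G) :
  (fun k : G => f (g^-1 * k)%g) \in @sq_summable_pred R G.
Proof.
apply/asboolP; rewrite /sq_summable.
rewrite -(@reindex_esum R G G setT setT (fun k => (g^-1 * k)%g)
  (fun k => (normc (f k) ^+ 2)%:E)); first exact: ell2_sum.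
split=> [//|k l _ _ /mulgI //|k _]; exists (g * k)%g => //.
by rewrite mulKg.
Qed.

Definition lreg (g : G) (f : ell2_hilbert R G) : ell2_hilbert R G :=
  Ell2 (sq_summable_translate g f).

Lemma sq_summable_delta (g : G) :
  (fun k : G => (k == g)%:R : R[i]) \in @sq_summable_pred R G.
Proof.
apply/asboolP; rewrite /sq_summable.
rewrite (@esumID R G [set g]) => [|k _]; last by rewrite lee_fin sqr_ge0.
rewrite setTI esum_set1 ?lee_fin ?sqr_ge0// setTI esum1 ?adde0 ?ltry// => k kg.
have /negbTE -> : k != g by apply/eqP.
by rewrite (_ : normc _ = 0) ?expr0n//; exact: normc0.
Qed.

Definition delta (g : G) : ell2_hilbert R G := Ell2 (sq_summable_delta g).

Definition lreg_span : set (ell2_hilbert R G -> ell2_hilbert R G) :=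
  [set x | exists (s : seq G) (c : G -> R[i]),
     x = \sum_(g <- s) c g *: lreg g].

Definition group_vN_algebra := sot_closure lreg_span.

Definition group_trace (x : ell2_hilbert R G -> ell2_hilbert R G) : R[i] :=
  hdot (ell2_hilbert R G) (x (delta 1%g)) (delta 1%g).

Definition unitary_rep (H : hilbert R) (pi : G -> H -> H) :=
  [/\ forall g, linear (pi g),
      forall g u v, hdot H (pi g u) (pi g v) = hdot H u v,
      pi 1%g = idfun & forall g k, pi (g * k)%g = pi g \o pi k].

Definition property_T :=
  exists (F : set G) (e : R), [/\ finite_set F, 0 < e &
    forall (H : hilbert R) (pi : G -> H -> H), unitary_rep pi ->
      (exists2 u : H, u != 0 & forall g, F g -> `|pi g u - u| < e%:C%C * `|u|) ->
      exists2 u : H, u != 0 & forall g, pi g u = u].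

Definition hamming (n : nat) (s t : 'S_n) : R :=
  #|[pred k | s k != t k]|%:R / n%:R.

(* For permutations, [(s * t)%g] applies [s] first: the composite
   sigma(g) o sigma(k) is [(sigma k * sigma g)%g]. *)
Definition sofic :=
  forall (F : set G) (e : R), finite_set F -> 0 < e ->
    exists (n : nat) (sigma : G -> 'S_n), [/\ (0 < n)%N,
      forall g k, F g -> F k ->
        hamming (sigma k * sigma g)%g (sigma (g * k)%g) < e &
      forall g, F g -> g != 1%g -> hamming (sigma g) 1%g > 1 - e].

End groups.

(* Main.v *)
(* Property (T) gives generators s_1, ..., s_p of G whose lazy averaging operator h
   satisfies ||h (xi - h xi)|| <= q ||xi - h xi|| with the same q < 1 in every unitary
   representation. Let U and V be tuples of n x n unitaries which almost represent G
   and are within e of each other. By an ultralimit and the GNS construction, A |->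
   average of U_i A V_i^* almost has this gap, so iterating it on the identity gives W
   with ||W - 1||_2 = O(e) and W almost intertwining V and U. In the polar
   decomposition of W, the tuples U and V are almost conjugate except on the part of
   relative dimension O(e^2) where the singular values of W are small. Refining a
   cover of the almost representations up to conjugacy from scale e to e/2 thus
   involves only O(e^2 n^2) real parameters of bounded size, and multiplies the number
   of cells by exp(O(e^2 n^2)). Summed over dyadic scales, the exponent is at most
   C n^2 with C independent of the final scale. Microstates of the real and imaginary
   parts of the lambda(s_i) become almost representations of G after replacing each
   matrix by the unitary part of its polar decomposition. *)
Require Import Defs.
From HB Require Import structures.
From mathcomp Require Import all_boot all_order all_fingroup all_algebra.
From mathcomp Require Import all_classical all_reals all_analysis.
From mathcomp Require Import complex finmap.
From mathcomp Require Import ring lra zify.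
From mathcomp Require monalg.
Import(canonicals,coercions) monalg.

Set Implicit Arguments.
Unset Strict Implicit.
Unset Printing Implicit Defensive.

Import Order.TTheory GRing.Theory Num.Theory.
Import Num.Def.
Import numFieldNormedType.Exports.
Import ComplexField.Normc.
(* Re-imported last so that [ReM], [ImM], ... shadow the lemmas of [Num.Theory]. *)
Import Defs.

Local Open Scope classical_set_scope.
Local Open Scope ring_scope.
Local Open Scope sesquilinear_scope.

Local Notation Re := complex.Re.
Local Notation Im := complex.Im.

(** * Semi-inner products and lazy averages *)

(** The gap is stated for vectors [xi - h xi], not on the orthogonal complement of the invariant
    vectors, because this form only involves norms of combinations of words applied to one vector.
    It therefore survives the passage to almost representations, where nothing is exactly invariant
    and no projection is available. Such norms are determined by a coefficient function, so
    representations are compared through positive-definite functions and possibly degenerate forms,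
    without quotients or closed subspaces.

    The order of the quantifiers carries the bound. The constant [c] precedes the final scale
    [2 * 2^-1 ^+ k]; the word length and tolerance [N] depend on [k], and the dimension [n] comes
    last. Every refinement uses intertwiners with a tolerance proportional to the final scale, so
    one [N] serves all of them. A refinement must also name the set of small singular values, at the
    price of a factor [2 ^ n]. Over [k] refinements this adds [k * n] to the exponent, which is at
    most [n ^ 2] once [n] exceeds [k]. *)

Section complex_aux.
Variable R : realType.
Implicit Types z w : R[i].

Lemma Re_le_normc z : Re z <= normc z.
Proof.
apply: le_trans (ler_norm _) _; case: z => a b /=.
by rewrite -sqrtr_sqr ler_wsqrtr ?lerDl ?sqr_ge0.
Qed.

Lemma normc_conj z : normc z^* = normc z.
Proof. by rewrite conjCE; case: z => a b /=; rewrite sqrrN. Qed.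

Lemma normc_real (a : R) : normc a%:C%C = `|a|.
Proof. by rewrite /= expr0n addr0 sqrtr_sqr. Qed.

Lemma normc_def z : `|z| = (normc z)%:C%C. Proof. by []. Qed.

Lemma mul_conjE z : z * z^* = (normc z ^+ 2)%:C%C.
Proof. by rewrite normc_sqr conjCE; case: z => a b /=; apply: complexP => /=; lra. Qed.

Lemma ReN z : Re (- z) = - Re z. Proof. by case: z. Qed.
Lemma ReB z w : Re (z - w) = Re z - Re w. Proof. by rewrite ReD ReN. Qed.
Lemma Re_sum (I : Type) (s : seq I) (P : pred I) (F : I -> R[i]) :
  Re (\sum_(i <- s | P i) F i) = \sum_(i <- s | P i) Re (F i).
Proof. exact: raddf_sum. Qed.
Lemma ReZ (a : R) z : Re (a%:C%C * z) = a * Re z.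
Proof. by rewrite ReM /= mul0r subr0. Qed.
Lemma normcN z : normc (- z) = normc z.
Proof. by case: z => a b /=; rewrite !sqrrN. Qed.
Lemma normc_le_add z w : normc (z + w) <= normc z + normc w.
Proof. exact: le_normcD. Qed.
Lemma conj_realc (a : R) : (a%:C%C)^* = a%:C%C.
Proof. by rewrite conjCE /= oppr0. Qed.
End complex_aux.

Section linear_fun.
Variables (K : pzRingType) (U W : lmodType K) (f : U -> W).
Hypothesis f_lin : linear f.
Let F : {linear U -> W} := HB.pack f (GRing.isLinear.Build K U W *:%R f f_lin).

Lemma lin0 : f 0 = 0. Proof. exact: (linear0 F). Qed.
Lemma linD u v : f (u + v) = f u + f v. Proof. exact: (linearD F). Qed.
Lemma linB u v : f (u - v) = f u - f v. Proof. exact: (linearB F). Qed.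
Lemma linZ a u : f (a *: u) = a *: f u. Proof. exact: (linearZ_LR F). Qed.
Lemma lin_sum (I : Type) (s : seq I) (P : pred I) (E : I -> U) :
  f (\sum_(i <- s | P i) E i) = \sum_(i <- s | P i) f (E i).
Proof. exact: (linear_sum F). Qed.
End linear_fun.

Section semi_inner.
Variables (R : realType) (V : lmodType R[i]).

Record sip := Sip {
  sip_fun :> V -> V -> R[i];
  sipl : forall a u v w, sip_fun (a *: u + v) w = a * sip_fun u w + sip_fun v w;
  sipC : forall u v, sip_fun u v = (sip_fun v u)^*;
  sip_ge0 : forall u, 0 <= sip_fun u u }.

Variable B : sip.
Implicit Types u v w : V.

Definition sip_left w u := B u w.

Lemma sip_left_linear w : linear_for *%R (sip_left w).
Proof. by move=> a u v; exact: sipl. Qed.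

HB.instance Definition _ w :=
  GRing.isLinear.Build R[i] V R[i] *%R (sip_left w) (@sip_left_linear w).

Lemma sipDl u v w : B (u + v) w = B u w + B v w.
Proof. exact: (linearD (sip_left w)). Qed.
Lemma sipBl u v w : B (u - v) w = B u w - B v w.
Proof. exact: (linearB (sip_left w)). Qed.
Lemma sipNl u w : B (- u) w = - B u w.
Proof. exact: (linearN (sip_left w)). Qed.
Lemma sip0l w : B 0 w = 0.
Proof. exact: (linear0 (sip_left w)). Qed.
Lemma sipZl a u w : B (a *: u) w = a * B u w.
Proof. exact: (linearZ_LR (sip_left w)). Qed.
Lemma sip_suml (I : Type) (s : seq I) (P : pred I) (F : I -> V) w :
  B (\sum_(i <- s | P i) F i) w = \sum_(i <- s | P i) B (F i) w.
Proof. exact: (linear_sum (sip_left w)). Qed.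
Lemma sipDr u v w : B w (u + v) = B w u + B w v.
Proof. by rewrite sipC sipDl rmorphD /= -!sipC. Qed.
Lemma sipNr u w : B w (- u) = - B w u.
Proof. by rewrite sipC sipNl rmorphN /= -!sipC. Qed.
Lemma sipBr u v w : B w (u - v) = B w u - B w v.
Proof. by rewrite sipDr sipNr. Qed.
Lemma sip0r w : B w 0 = 0.
Proof. by rewrite sipC sip0l rmorph0. Qed.
Lemma sipZr a u w : B w (a *: u) = a^* * B w u.
Proof. by rewrite sipC sipZl rmorphM /= -!sipC. Qed.
Lemma sip_sumr (I : Type) (s : seq I) (P : pred I) (F : I -> V) w :
  B w (\sum_(i <- s | P i) F i) = \sum_(i <- s | P i) B w (F i).
Proof. by rewrite sipC sip_suml rmorph_sum /=; apply: eq_bigr => i _; rewrite -sipC. Qed.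

Definition nrm u : R := Num.sqrt (Re (B u u)).

Lemma nrm_ge0 u : 0 <= nrm u. Proof. exact: sqrtr_ge0. Qed.

Lemma Re_sip_ge0 u : 0 <= Re (B u u).
Proof. by have := sip_ge0 B u; rewrite lecE => /andP[]. Qed.

Lemma nrm_sqr u : nrm u ^+ 2 = Re (B u u).
Proof. by rewrite sqr_sqrtr ?Re_sip_ge0. Qed.

Lemma sipuu u : B u u = (nrm u ^+ 2)%:C%C.
Proof.
rewrite nrm_sqr; apply: complexP => //=.
by have := sip_ge0 B u; rewrite lecE => /andP[/eqP].
Qed.

Lemma Re_sipC u v : Re (B u v) = Re (B v u).
Proof. by rewrite sipC ReJ. Qed.

Lemma nrm_sqrD u v : nrm (u + v) ^+ 2 = nrm u ^+ 2 + nrm v ^+ 2 + 2 * Re (B u v).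
Proof. rewrite !nrm_sqr !sipDl !sipDr !ReD (Re_sipC v u); lra. Qed.

Lemma nrmN u : nrm (- u) = nrm u.
Proof. by rewrite /nrm sipNl sipNr opprK. Qed.

Lemma nrm_sqrB u v : nrm (u - v) ^+ 2 = nrm u ^+ 2 + nrm v ^+ 2 - 2 * Re (B u v).
Proof. rewrite nrm_sqrD nrmN sipNr ReN; lra. Qed.

Lemma nrmBC u v : nrm (u - v) = nrm (v - u).
Proof. by rewrite -nrmN opprB. Qed.

Lemma nrm0 : nrm 0 = 0.
Proof. by rewrite /nrm sip0l sqrtr0. Qed.

Lemma nrmZ a u : nrm (a *: u) = normc a * nrm u.
Proof.
rewrite /nrm sipZl sipZr mulrA mul_conjE ReZ sqrtrM ?sqr_ge0//.
by rewrite sqrtr_sqr ger0_norm ?normc_ge0.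
Qed.

Lemma parallelogram u v :
  nrm (u + v) ^+ 2 + nrm (u - v) ^+ 2 = 2 * nrm u ^+ 2 + 2 * nrm v ^+ 2.
Proof. by rewrite nrm_sqrD nrm_sqrB; lra. Qed.

(** The form may be degenerate, so the usual optimal coefficient is taken with [nrm v ^+ 2 + e] in
    the denominator, and [e] is then sent to 0. *)
Lemma sip_CS u v : normc (B u v) <= nrm u * nrm v.
Proof.
have key (e : R) : 0 < e -> normc (B u v) ^+ 2 <= nrm u ^+ 2 * (nrm v ^+ 2 + e).
  move=> e0; set c := nrm v ^+ 2 + e.
  have c0 : 0 < c by rewrite ltr_wpDl // sqr_ge0.
  have := sqr_ge0 (nrm (u - (c^-1)%:C%C *: (B u v *: v))).
  rewrite nrm_sqrB !nrmZ sipZr conj_realc ReZ normc_real ger0_norm ?invr_ge0 ?(ltW c0) //.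
  rewrite sipZr [_^* * _]mulrC mul_conjE /= => h.
  have h2 : nrm v ^+ 2 <= c by rewrite lerDl ltW.
  have N0 := sqr_ge0 (normc (B u v)).
  have h3 : (c^-1 * (normc (B u v) * nrm v)) ^+ 2 <= c^-1 * normc (B u v) ^+ 2.
    have -> : (c^-1 * (normc (B u v) * nrm v)) ^+ 2
        = c^-1 * normc (B u v) ^+ 2 * (nrm v ^+ 2 / c) by ring.
    apply: ler_piMr; first by rewrite mulr_ge0 ?invr_ge0 ?(ltW c0).
    by rewrite ler_pdivrMr // mul1r.
  suff : c^-1 * normc (B u v) ^+ 2 <= nrm u ^+ 2 by rewrite mulrC ler_pdivrMr.
  lra.
rewrite -ler_sqr ?nnegrE ?mulr_ge0 ?normc_ge0 ?nrm_ge0 // exprMn.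
apply/ler_addgt0Pr => e e0.
have d0 : 0 < e / (nrm u ^+ 2 + 1) by rewrite divr_gt0 // ltr_wpDl // sqr_ge0.
apply: le_trans (key _ d0) _; rewrite mulrDr lerD2l.
rewrite mulrCA; apply: ler_piMr; first exact: ltW.
by rewrite ler_pdivrMr ?mul1r ?lerDl // ltr_wpDl // sqr_ge0.
Qed.

Lemma Re_sip_CS u v : Re (B u v) <= nrm u * nrm v.
Proof. exact: le_trans (Re_le_normc _) (sip_CS _ _). Qed.

Lemma nrmD u v : nrm (u + v) <= nrm u + nrm v.
Proof.
rewrite -ler_sqr ?nnegrE ?addr_ge0 ?nrm_ge0 // nrm_sqrD sqrrD.
have := Re_sip_CS u v; lra.
Qed.

Lemma nrmB u v : nrm (u - v) <= nrm u + nrm v.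
Proof. by rewrite -[nrm v]nrmN nrmD. Qed.

Lemma nrm_dist w u v : nrm (u - v) <= nrm (u - w) + nrm (w - v).
Proof. by rewrite -(subrKA w) nrmD. Qed.

Lemma nrm_sum (I : Type) (s : seq I) (P : pred I) (F : I -> V) :
  nrm (\sum_(i <- s | P i) F i) <= \sum_(i <- s | P i) nrm (F i).
Proof.
elim/big_ind2 : _ => [|x1 x2 y1 y2 h1 h2|//]; first by rewrite nrm0.
by apply: le_trans (nrmD _ _) _; exact: lerD.
Qed.

(** With this, null vectors can be discarded inside the form, which replaces passing to the quotient
    by them. *)
Lemma sip_null u v : nrm u = 0 -> B u v = 0.
Proof.
by move=> u0; apply/eq0_normc/le_anti; rewrite normc_ge0 (le_trans (sip_CS _ _))// u0 mul0r.
Qed.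

Lemma nrm_eqD u v : nrm v = 0 -> nrm (u + v) = nrm u.
Proof.
move=> v0; apply: le_anti; apply/andP; split.
  by rewrite (le_trans (nrmD _ _))// v0 addr0.
by rewrite -{1}(addrK v u) (le_trans (nrmB _ _))// v0 addr0.
Qed.

End semi_inner.

(* [lazy] is half the identity plus half the average of the isometries
   [al s] and of their adjoints [be s]. *)
Section lazy_average.
Variables (R : realType) (V : lmodType R[i]) (B : sip V) (p : nat).
Variables (al be : 'I_p -> V -> V).
Hypothesis p_gt0 : (0 < p)%N.
Hypothesis al_lin : forall s, linear (al s).
Hypothesis be_lin : forall s, linear (be s).
Hypothesis al_iso : forall s u, nrm B (al s u) = nrm B u.
Hypothesis be_iso : forall s u, nrm B (be s u) = nrm B u.
Hypothesis adj : forall s u v, B (be s u) v = B u (al s v).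

Local Notation N := (nrm B).

Definition avg (u : V) : V := ((2 * p%:R)^-1 : R)%:C%C *: \sum_s (al s u + be s u).
Definition lazy (u : V) : V := (2^-1 : R)%:C%C *: (u + avg u).

Lemma avg_linear : linear avg.
Proof.
move=> a u v; rewrite /avg scalerA [a * _]mulrC -scalerA -scalerDr; congr (_ *: _).
rewrite scaler_sumr -big_split /=; apply: eq_bigr => s _.
by rewrite al_lin be_lin scalerDr addrACA.
Qed.

Lemma lazy_linear : linear lazy.
Proof.
move=> a u v; rewrite /lazy avg_linear addrACA -scalerDr [LHS]scalerDr.
by congr (_ + _); rewrite (scalerA _ a (u + avg u)) (scalerA a _ (u + avg u)) mulrC.
Qed.

Lemma lazyB u v : lazy (u - v) = lazy u - lazy v.
Proof. exact: linB lazy_linear _ _. Qed.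

Lemma nrm_avg u : N (avg u) <= N u.
Proof.
rewrite /avg nrmZ normc_real ger0_norm; last by rewrite invr_ge0 mulr_ge0.
have p0 : 0 < 2 * p%:R :> R by rewrite mulr_gt0 // ltr0n.
rewrite mulrC ler_pdivrMr //.
apply: le_trans (nrm_sum _ _ _ _) _.
apply: (@le_trans _ _ (\sum_(s < p) (2 * N u))).
  apply: ler_sum => s _; apply: le_trans (nrmD _ _ _) _.
  by rewrite al_iso be_iso mulrDl mul1r.
by rewrite sumr_const card_ord -mulr_natr; lra.
Qed.

Lemma lazy_complement u : u - lazy u = (2^-1 : R)%:C%C *: (u - avg u).
Proof.
rewrite /lazy -[X in X - _]scale1r; have -> : 1 = (2^-1 : R)%:C%C + (2^-1 : R)%:C%C :> R[i].
  by apply: complexP => /=; lra.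
by rewrite scalerDl scalerDr scalerBr opprD addrA addrK.
Qed.

(** This expresses that the lazy average has spectrum in [0, 1], where t^2 + (1 - t)^2 <= 1. Only
    the parallelogram law and the contraction property of [avg] are used; the identity half of
    [lazy] is what excludes negative spectrum. *)
Lemma lazy_sqr u : N (lazy u) ^+ 2 + N (u - lazy u) ^+ 2 <= N u ^+ 2.
Proof.
rewrite lazy_complement /lazy !nrmZ normc_real ger0_norm ?invr_ge0 // !exprMn -mulrDr.
rewrite parallelogram; have := nrm_avg u; have := nrm_ge0 B u; have := nrm_ge0 B (avg u).
move=> h1 h2 h3; have : N (avg u) ^+ 2 <= N u ^+ 2 by rewrite lerXn2r.
rewrite !expr2; lra.
Qed.

Lemma nrm_lazy u : N (lazy u) <= N u.
Proof.
rewrite -ler_sqr ?nnegrE ?nrm_ge0 //; apply: le_trans (lazy_sqr u).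
by rewrite lerDl sqr_ge0.
Qed.

(** The Dirichlet form of the average. By [adj], each adjoint contributes the same real part as its
    isometry, so the displacements under the [al s] account for both. *)
Lemma sum_displacement u :
  \sum_s N (al s u - u) ^+ 2 = 4 * p%:R * Re (B (u - lazy u) u).
Proof.
have p0 : p%:R != 0 :> R by rewrite pnatr_eq0 -lt0n.
rewrite lazy_complement sipZl ReZ sipBl ReB /avg sipZl ReZ sip_suml Re_sum.
under eq_bigr do rewrite nrm_sqrB al_iso.
under [in RHS]eq_bigr do rewrite sipDl ReD adj (Re_sipC B u).
rewrite !big_split /= sumrN !sumr_const card_ord -nrm_sqr -[in LHS]mulr_natr -mulr_sumr.
by field.
Qed.

Lemma displacement_sqr_le u s :
  N (al s u - u) ^+ 2 <= 4 * p%:R * N (u - lazy u) * N u.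
Proof.
apply: le_trans (_ : 4 * p%:R * Re (B (u - lazy u) u) <= _); last first.
  by rewrite -[leRHS]mulrA ler_wpM2l ?mulr_ge0 // Re_sip_CS.
rewrite -sum_displacement (bigD1 s) //= lerDl sumr_ge0 // => t _; exact: sqr_ge0.
Qed.

(** A displacement of relative size [e] forces [N (u - lazy u)] to be at least [e ^+ 2 / (4 * p%:R)]
    times [N u], and [lazy_sqr] turns this loss into a contraction. *)
Lemma lazy_gap (e : R) u s : 0 <= e -> e * N u <= N (al s u - u) ->
  N (lazy u) ^+ 2 <= (1 - (e ^+ 2 / (4 * p%:R)) ^+ 2) * N u ^+ 2.
Proof.
move=> e0 h; set d := e ^+ 2 / (4 * p%:R).
have p0 : 0 < 4 * p%:R :> R by rewrite mulr_gt0 // ltr0n.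
have d0 : 0 <= d by rewrite divr_ge0 ?sqr_ge0 ?ltW.
suff : d * N u <= N (u - lazy u).
  move=> h2; have : (d * N u) ^+ 2 <= N (u - lazy u) ^+ 2.
    by rewrite lerXn2r ?nnegrE ?mulr_ge0 ?nrm_ge0.
  have := lazy_sqr u; rewrite exprMn; lra.
have [->|u0] := eqVneq (N u) 0; first by rewrite mulr0 nrm_ge0.
have u1 : 0 < N u by rewrite lt_def u0 nrm_ge0.
have h2 : (e * N u) ^+ 2 <= N (al s u - u) ^+ 2.
  by rewrite lerXn2r ?nnegrE ?mulr_ge0 ?nrm_ge0.
have := le_trans h2 (displacement_sqr_le u s).
move=> h3; rewrite -(ler_pM2r u1) -(ler_pM2l p0).
have -> : 4 * p%:R * (d * N u * N u) = (e * N u) ^+ 2.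
  by rewrite /d; field; rewrite pnatr_eq0 -lt0n.
by rewrite mulrA.
Qed.

Lemma iter_lazyB m u : iter m lazy (u - lazy u) = iter m lazy u - iter m.+1 lazy u.
Proof.
elim: m => // m IH; by rewrite iterS IH lazyB -!iterS.
Qed.

(** By [lazy_sqr], the squared norms of the increments [iter j lazy (u - lazy u)] have partial sums
    at most [N u ^+ 2]. They decrease in [j], so [m] times the one of index [m] is at most the sum
    of the first [m]. *)
Lemma ergodic m u : m%:R * N (iter m lazy (u - lazy u)) ^+ 2 <= N u ^+ 2.
Proof.
pose a j := N (iter j lazy (u - lazy u)) ^+ 2.
have a_decr j k : (j <= k)%N -> a k <= a j.
  move=> /subnK <-; elim: (k - j)%N => // i IH; rewrite addSn; apply: le_trans IH.
  by rewrite /a iterS lerXn2r ?nnegrE ?nrm_ge0 ?nrm_lazy.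
have tel : \sum_(0 <= j < m) a j <= N u ^+ 2 - N (iter m lazy u) ^+ 2.
  elim: {+}m => [|k IH]; first by rewrite big_nil subrr.
  rewrite big_nat_recr //=; have := lazy_sqr (iter k lazy u).
  rewrite /a iter_lazyB -iterS; lra.
have : \sum_(0 <= j < m) a m <= \sum_(0 <= j < m) a j.
  by rewrite big_nat [leRHS]big_nat; apply: ler_sum => j /andP[_ /ltnW]; exact: a_decr.
rewrite sumr_const_nat subn0 -mulr_natl -/(a m); have := sqr_ge0 (N (iter m lazy u)); lra.
Qed.

End lazy_average.

Section hilbert_sip.
Variables (R : realType) (H : hilbert R).
Implicit Types u v w : H.

Lemma hdot_linl a u v w : hdot H (a *: u + v) w = a * hdot H u w + hdot H v w.
Proof. by rewrite linearDl/= linearZl_LR. Qed.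

Lemma hdotC u v : hdot H u v = (hdot H v u)^*.
Proof. by rewrite (hermC (hdot H)) /= mul1r. Qed.

Lemma hdot_ge0 u : 0 <= hdot H u u.
Proof. by rewrite hdot_norm exprn_ge0. Qed.

Definition hsip : sip H := Sip hdot_linl hdotC hdot_ge0.

Lemma hnormE u : `|u| = (nrm hsip u)%:C%C.
Proof.
apply/eqP; rewrite -(@eqrXn2 _ 2) ?normr_ge0 ?ler0c ?nrm_ge0 // -hdot_norm.
by rewrite -[hdot H u u]/(hsip u u) sipuu rmorphXn.
Qed.

Lemma hsipE u v : hdot H u v = hsip u v. Proof. by []. Qed.
Lemma hdot0r u : hdot H u 0 = 0. Proof. exact: (sip0r hsip). Qed.
Lemma hdotZr a u v : hdot H u (a *: v) = a^* * hdot H u v.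
Proof. exact: (sipZr hsip). Qed.
Lemma hdot_sumr (I : Type) (s : seq I) (P : pred I) (F : I -> H) u :
  hdot H u (\sum_(i <- s | P i) F i) = \sum_(i <- s | P i) hdot H u (F i).
Proof. exact: (sip_sumr hsip). Qed.

Lemma nrm_hsip_eq0 u : nrm hsip u = 0 -> u = 0.
Proof. by move=> u0; apply/normr0_eq0; rewrite hnormE u0. Qed.
End hilbert_sip.

Section bessel.
Variables (R : realType) (V : lmodType R[i]) (B : sip V).

Lemma bessel (I : choiceType) (e : I -> V) (s : seq I) (x : V) : uniq s ->
  (forall i j, B (e i) (e j) = (i == j)%:R) ->
  \sum_(i <- s) normc (B x (e i)) ^+ 2 <= nrm B x ^+ 2.
Proof.
move=> us orth; pose y := \sum_(i <- s) B x (e i) *: e i.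
have Bxy : B x y = (\sum_(i <- s) normc (B x (e i)) ^+ 2)%:C%C.
  rewrite sip_sumr rmorph_sum; apply: eq_bigr => i _ /=.
  by rewrite sipZr mulrC mul_conjE.
have Byy : B y y = B x y.
  rewrite [in LHS]/y sip_suml [RHS]sip_sumr big_seq [RHS]big_seq.
  apply: eq_bigr => i si; rewrite sipZl sipZr mulrC; congr (_ * _).
  rewrite sipC; congr conjC; rewrite sip_suml (bigD1_seq i) //= sipZl orth eqxx mulr1.
  by rewrite big1 ?addr0 // => j ji; rewrite sipZl orth (negPf ji) mulr0.
have := sqr_ge0 (nrm B (x - y)); rewrite nrm_sqrB [nrm B y ^+ 2]nrm_sqr Byy Bxy /=; lra.
Qed.
End bessel.

(** * Gram-Schmidt orthogonalization for a degenerate form *)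

Section gram_schmidt.
Variables (R : realType) (V : lmodType R[i]) (B : sip V) (v : nat -> V).

(* [normalize w] is [0] when [w] is a null vector. *)
Definition normalize (w : V) : V := ((nrm B w)^-1)%:C%C *: w.

Fixpoint gs_list n : seq V :=
  if n is m.+1 then
    rcons (gs_list m) (normalize (v m - \sum_(x <- gs_list m) B (v m) x *: x))
  else [::].

Definition gs_res n := v n - \sum_(x <- gs_list n) B (v n) x *: x.
Fact gs_key : unit. Proof. exact: tt. Qed.
Definition gs n := locked_with gs_key (normalize (gs_res n)).
Lemma gsE n : gs n = normalize (gs_res n). Proof. exact: unlock. Qed.

Lemma gs_listE n : gs_list n = [seq gs i | i <- iota 0 n].
Proof. by elim: n => // n IH; rewrite -addn1 iotaD map_cat /= -IH cats1 addn1 gsE. Qed.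

Lemma gs_resE n : gs_res n = v n - \sum_(i < n) B (v n) (gs i) *: gs i.
Proof.
rewrite /gs_res gs_listE big_map; congr (_ - _).
by rewrite -(big_mkord xpredT (fun i => B (v n) (gs i) *: gs i)) /index_iota subn0.
Qed.

Lemma nrm_normalize w : nrm B (normalize w) = (nrm B w != 0)%:R.
Proof.
rewrite nrmZ normc_real ger0_norm ?invr_ge0 ?nrm_ge0 //.
by case: eqVneq => [->|w0]; rewrite ?mulr0 // mulVf.
Qed.

Lemma nrm_gs n : nrm B (gs n) = 0 \/ nrm B (gs n) = 1.
Proof. by rewrite gsE nrm_normalize; case: eqP; [left|right]. Qed.

Lemma gs_orthl n i : (i < n)%N -> B (gs n) (gs i) = 0.
Proof.
elim/ltn_ind: n i => n IH i lt_in.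
rewrite [gs n]gsE sipZl; suff -> : B (gs_res n) (gs i) = 0 by rewrite mulr0.
rewrite gs_resE sipBl sip_suml (bigD1 (Ordinal lt_in)) //= big1 => [|j ji].
  rewrite addr0 sipZl sipuu; case: (nrm_gs i) => gi; last by rewrite gi expr1n mulr1 subrr.
  by rewrite sipC (sip_null _ gi) conjC0 mul0r subrr.
rewrite sipZl; have [lt_ij|lt_ji|eq_ij] := ltngtP i j.
- by rewrite IH ?mulr0 ?ltn_ord.
- by rewrite [B (gs j) _]sipC IH // conjC0 mulr0.
- by case/negP: ji; apply/eqP/val_inj.
Qed.

Lemma gs_orth i j : i != j -> B (gs i) (gs j) = 0.
Proof.
rewrite neq_ltn => /orP[] ij; last exact: gs_orthl.
by rewrite sipC gs_orthl // conjC0.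
Qed.

Definition gs_proj N x := \sum_(i < N) B x (gs i) *: gs i.
(** Membership in the span of the first [N] Gram-Schmidt vectors, up to a null vector. *)
Definition expands N x := nrm B (x - gs_proj N x) = 0.

Lemma expands_gt N x j : expands N x -> (N <= j)%N -> B x (gs j) = 0.
Proof.
move=> ex Nj; rewrite -(subrK (gs_proj N x) x) sipDl sip_null // add0r.
rewrite sip_suml big1 // => i _; rewrite sipZl gs_orth ?mulr0 //.
by rewrite neq_ltn (leq_trans (ltn_ord i)).
Qed.

Lemma expands_le N M x : (N <= M)%N -> expands N x -> expands M x.
Proof.
move=> /subnKC <- ex; rewrite /expands /gs_proj big_split_ord /= [X in _ - (_ + X)]big1 ?addr0 //.
by move=> i _; rewrite (expands_gt ex) ?scale0r ?leq_addr.
Qed.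

Lemma gs_proj_linear N : linear (gs_proj N).
Proof.
move=> a x y; rewrite /gs_proj scaler_sumr -big_split; apply: eq_bigr => i _ /=.
by rewrite sipDl sipZl scalerDl -scalerA.
Qed.

Lemma expands_lin a x y : (exists N, expands N x) -> (exists N, expands N y) ->
  exists N, expands N (a *: x + y).
Proof.
move=> [N ex] [M ey]; exists (maxn N M).
have ex' := expands_le (leq_maxl N M) ex; have ey' := expands_le (leq_maxr N M) ey.
rewrite /expands gs_proj_linear opprD addrACA -scalerBr nrm_eqD //.
by rewrite nrmZ ex' mulr0.
Qed.

Lemma expands0 : exists N, expands N 0.
Proof. by exists 0%N; rewrite /expands /gs_proj big_ord0 subr0 nrm0. Qed.

Lemma expands_gen n : expands n.+1 (v n).
Proof.
rewrite /expands /gs_proj big_ord_recr /= opprD addrA -gs_resE.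
have -> : B (v n) (gs n) = (nrm B (gs_res n))%:C%C.
  have -> : v n = gs_res n + gs_proj n (v n) by rewrite gs_resE subrK.
  rewrite sipDl [X in _ + X]sip_suml big1 => [|i _].
    rewrite addr0 gsE /normalize sipZr conj_realc sipuu -rmorphM /=; congr (_%:C%C).
    have [->|w0] := eqVneq (nrm B (gs_res n)) 0; first by rewrite expr0n mulr0.
    by rewrite expr2 mulKf.
  by rewrite sipZl [B (gs _) _]sipC gs_orthl ?ltn_ord // conjC0 mulr0.
rewrite gsE /normalize scalerA -rmorphM /=.
have [w0|w0] := eqVneq (nrm B (gs_res n)) 0; first by rewrite w0 mul0r scale0r subr0.
by rewrite divff // scale1r subrr nrm0.
Qed.

End gram_schmidt.

Section ell2_aux.
Variables (R : realType) (T : choiceType).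

Lemma sq_summable_bound (f : T -> R[i]) (M : R) :
  (forall X : {fset T}, \sum_(t <- X) normc (f t) ^+ 2 <= M) ->
  f \in @sq_summable_pred R T.
Proof.
move=> h; apply/asboolP; apply: (@le_lt_trans _ _ M%:E); last exact: ltry.
apply: ge_ereal_sup => _ [X [finX _] <-].
by rewrite fsbig_finite//= sumEFin lee_fin.
Qed.

Lemma csum_single (t : T) (z : T -> R[i]) : (forall s, s != t -> z s = 0) ->
  csum z = z t.
Proof.
move=> z0.
have rs (a : T -> R) : (forall s, s != t -> a s = 0) -> rsum a = a t.
  move=> a0; rewrite /rsum.
  have E (b : T -> R) : (forall s, 0 <= b s) -> (forall s, s != t -> b s = 0) ->
      (\esum_(s in [set: T]) (b s)%:E = (b t)%:E)%E.
    move=> bge b0; rewrite (@esumID R T [set t]) => [|k _]; last by rewrite lee_fin.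
    rewrite setTI esum_set1 ?lee_fin // setTI esum1 ?adde0 // => k kg.
    by rewrite b0 //; apply/eqP.
  rewrite !E /=; try by move=> s; rewrite le_max lexx orbT.
  - by case: (lerP (a t) 0) => h1; case: (lerP (- a t) 0) => h2; lra.
  - by move=> s st; rewrite a0 // oppr0 maxxx.
  - by move=> s st; rewrite a0 // maxxx.
by apply: complexP; rewrite /csum /= rs // => s st; rewrite z0.
Qed.

Lemma ell2_ext (u v : ell2 R T) : (forall t, u t = v t) -> u = v.
Proof. by move=> h; apply/val_inj/funext. Qed.

Lemma dot_coord (f g : ell2 R T) t : (forall s, g s = (s == t)%:R) ->
  hdot (ell2_hilbert R T) f g = f t.
Proof.
move=> gt; rewrite [LHS](@csum_single t) => [|s st].
  by rewrite gt eqxx rmorph1 mulr1.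
by rewrite gt (negPf st) conjC0 mulr0.
Qed.
End ell2_aux.

(** * The GNS construction *)

Section gns_abstract.
Variables (R : realType) (V : lmodType R[i]) (B : sip V) (v : nat -> V).
Hypothesis spanning : forall x, exists N, expands B v N x.
Variables (G : groupType) (act : G -> V -> V).
Hypothesis act_lin : forall g, linear (act g).
Hypothesis act_iso : forall g x y, B (act g x) (act g y) = B x y.
Hypothesis act1 : forall x, act 1%g x = x.
Hypothesis actM : forall g k x, act (g * k)%g x = act g (act k x).

Local Notation e := (gs B v).

(** The Gram-Schmidt vectors of norm 1 are orthonormal, so the square-summable functions on their
    indices model the completion of [V] modulo null vectors. Completeness is inherited from [ell2],
    and no quotient is formed. *)
Definition pivots := {n : nat | nrm B (e n) == 1}.
Local Notation H := (ell2_hilbert R pivots).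
Implicit Types (f : H) (t : pivots).

Lemma pivot_orth t t' : B (e (val t)) (e (val t')) = (t == t')%:R.
Proof.
have [->|tt'] := eqVneq t t'; first by rewrite sipuu (eqP (valP t')) expr1n.
by rewrite gs_orth.
Qed.

Lemma gns_vec_summable x : (fun t : pivots => B x (e (val t))) \in @sq_summable_pred R pivots.
Proof.
apply: (@sq_summable_bound _ _ _ (nrm B x ^+ 2)) => X.
exact: (@bessel _ _ B pivots (fun t => e (val t)) X x (fset_uniq X) pivot_orth).
Qed.

Definition gns_vec x : H := Ell2 (gns_vec_summable x).

Lemma gns_vecE x t : (gns_vec x : ell2 R pivots) t = B x (e (val t)).
Proof. by []. Qed.

Lemma gns_vec_linear : linear gns_vec.
Proof.
move=> a x y; apply: (@ell2_ext R pivots) => t.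
by rewrite [LHS]/= sipl.
Qed.

HB.instance Definition _ := GRing.isLinear.Build R[i] V H *:%R gns_vec gns_vec_linear.

Lemma gns_vecD x y : gns_vec (x + y) = gns_vec x + gns_vec y.
Proof. exact: linearD. Qed.
Lemma gns_vecZ a x : gns_vec (a *: x) = a *: gns_vec x.
Proof. exact: linearZ. Qed.
Lemma gns_vec_sum N (F : 'I_N -> V) : gns_vec (\sum_i F i) = \sum_i gns_vec (F i).
Proof. exact: linear_sum. Qed.

Lemma gns_vec_null x : nrm B x = 0 -> gns_vec x = 0.
Proof. by move=> x0; apply: (@ell2_ext R pivots) => t; rewrite [LHS]/= sip_null. Qed.

Lemma gns_coord f t : hdot H f (gns_vec (e (val t))) = (f : ell2 R pivots) t.
Proof.
apply: dot_coord => s; by rewrite gns_vecE pivot_orth eq_sym.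
Qed.

Lemma gns_dot_e x n : hdot H (gns_vec x) (gns_vec (e n)) = B x (e n).
Proof.
have [n0|n1] := nrm_gs B v n.
  by rewrite (gns_vec_null n0) hdot0r sipC (sip_null _ n0) conjC0.
have n1' : nrm B (e n) == 1 by rewrite n1.
exact: (gns_coord (gns_vec x) (exist _ n n1')).
Qed.

Lemma gns_dot x y : hdot H (gns_vec x) (gns_vec y) = B x y.
Proof.
have [N ex] := spanning y.
rewrite -[in RHS](subrK (gs_proj B v N y) y) sipDr [B x (y - _)]sipC sip_null // conjC0 add0r.
rewrite -[in LHS](subrK (gs_proj B v N y) y) gns_vecD (gns_vec_null ex) add0r.
rewrite gns_vec_sum hdot_sumr sip_sumr; apply: eq_bigr => i _.
by rewrite gns_vecZ hdotZr (sipZr B (B y (e i))) gns_dot_e.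
Qed.

Lemma act_orth g t t' :
  hsip H (gns_vec (act g (e (val t)))) (gns_vec (act g (e (val t')))) = (t == t')%:R.
Proof. by rewrite -hsipE gns_dot act_iso pivot_orth. Qed.

Lemma gns_rep_summable g f :
  (fun t : pivots => hdot H f (gns_vec (act g^-1%g (e (val t))))) \in @sq_summable_pred R pivots.
Proof.
apply: (@sq_summable_bound _ _ _ (nrm (hsip H) f ^+ 2)) => X.
exact: (@bessel _ _ (hsip H) pivots _ X f (fset_uniq X) (act_orth g^-1%g)).
Qed.

(** The coordinates are those dictated by unitarity, with [g] moved to the other side as [g^-1].
    They make sense for every [f], and Bessel's inequality makes them square-summable, so the
    operator needs no extension from a dense subspace. *)
Definition gns_rep g f : H := Ell2 (gns_rep_summable g f).

Lemma gns_rep_coord g f t : hdot H (gns_rep g f) (gns_vec (e (val t))) =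
  hdot H f (gns_vec (act g^-1%g (e (val t)))).
Proof. by rewrite gns_coord. Qed.

Lemma gns_rep_adj g f x :
  hdot H (gns_rep g f) (gns_vec x) = hdot H f (gns_vec (act g^-1%g x)).
Proof.
have [N ex] := spanning x.
pose P := gs_proj B v N x.
have agE : act g^-1%g x = act g^-1%g (x - P) + act g^-1%g P.
  by rewrite -[in LHS](subrK P x); exact: linD (act_lin _) _ _.
have gE : gns_vec x = gns_vec P.
  by rewrite -[in LHS](subrK P x) gns_vecD (gns_vec_null ex) add0r.
have r0 : nrm B (act g^-1%g (x - P)) = 0 by rewrite /nrm act_iso.
rewrite agE gE gns_vecD (gns_vec_null r0) add0r {gE agE r0 ex}/P /gs_proj.
rewrite (lin_sum (act_lin _)) !gns_vec_sum !hdot_sumr.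
apply: eq_bigr => i _; rewrite (linZ (act_lin _)) !gns_vecZ !hdotZr.
congr (_ * _); have [n0|n1] := nrm_gs B v i.
  have n0' : nrm B (act g^-1%g (e i)) = 0 by rewrite /nrm act_iso.
  by rewrite (gns_vec_null n0) (gns_vec_null n0') !hdot0r.
have n1' : nrm B (e i) == 1 by rewrite n1.
exact: (gns_rep_coord g f (exist _ (nat_of_ord i) n1')).
Qed.

Lemma gns_rep_linear g : linear (gns_rep g).
Proof.
by move=> a f f'; apply: (@ell2_ext R pivots) => t; rewrite [LHS](sipl (hsip H)).
Qed.

Lemma gns_rep1 : gns_rep 1%g = idfun.
Proof.
apply/funext => f; apply: (@ell2_ext R pivots) => t.
by rewrite -[LHS]gns_coord gns_rep_coord invg1 act1 gns_coord.
Qed.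

Lemma gns_repM g k : gns_rep (g * k)%g = gns_rep g \o gns_rep k.
Proof.
apply/funext => f; apply: (@ell2_ext R pivots) => t.
by rewrite -[LHS]gns_coord -[RHS]gns_coord !gns_rep_coord gns_rep_adj invMg actM.
Qed.

Lemma nrm_gns_rep_le g f : nrm (hsip H) (gns_rep g f) <= nrm (hsip H) f.
Proof.
rewrite -ler_sqr ?nnegrE ?nrm_ge0 // nrm_sqr -hsipE.
rewrite -[hdot _ _ _]/(ell2_dot (gns_rep g f) (gns_rep g f)) ell2_dotE -lee_fin fineK; last first.
  rewrite ge0_fin_numE ?ell2_sum//; first exact: ell2_sum.
  by apply: esum_ge0 => s _; rewrite lee_fin sqr_ge0.
apply: ge_ereal_sup => _ [X [finX _] <-]; rewrite fsbig_finite//= sumEFin lee_fin.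
exact: (@bessel _ _ (hsip H) pivots _ _ f (fset_uniq _) (act_orth g^-1%g)).
Qed.

(** Bessel's inequality makes [gns_rep g] a contraction for every [g]; the same bound for [g^-1]
    gives the converse inequality. *)
Lemma nrm_gns_rep g f : nrm (hsip H) (gns_rep g f) = nrm (hsip H) f.
Proof.
apply: le_anti; rewrite nrm_gns_rep_le /=.
have {1}-> : f = gns_rep g^-1%g (gns_rep g f).
  by rewrite -[RHS]/((gns_rep g^-1%g \o gns_rep g) f) -gns_repM mulVg gns_rep1.
exact: nrm_gns_rep_le.
Qed.

Lemma gns_rep_vec g x : gns_rep g (gns_vec x) = gns_vec (act g x).
Proof.
apply: (@ell2_ext R pivots) => t.
by rewrite -[LHS]gns_coord gns_rep_coord -[RHS]gns_coord !gns_dot -(act_iso g) -actM mulgV act1.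
Qed.

End gns_abstract.

Section polarization.
Variables (R : realType) (V : lmodType R[i]) (B : sip V) (f : V -> V).
Hypothesis f_lin : linear f.
Hypothesis f_iso : forall u, nrm B (f u) = nrm B u.

Lemma isometry_dot u v : B (f u) (f v) = B u v.
Proof.
have key a b : Re (B (f a) (f b)) = Re (B a b).
  have := f_iso (1 *: a + b); rewrite f_lin !scale1r => /(congr1 (fun x => x ^+ 2)).
  by rewrite !nrm_sqrD !f_iso; lra.
apply: complexP; first exact: key.
have := key ('i%C *: u) v; rewrite (linZ f_lin) !sipZl !ReM /=; lra.
Qed.
End polarization.

Section malg_ext.
Variables (R : realType) (G : choiceType) (W : lmodType R[i]) (F : G -> W).
Local Notation V := (monalg.malg G R[i]).

Definition malg_ext (x : V) : W := \sum_(g <- monalg.msupp x) monalg.mcoeff g x *: F g.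

Lemma malg_extw (d : {fset G}) x : (monalg.msupp x `<=` d)%fset ->
  malg_ext x = \sum_(g <- d) monalg.mcoeff g x *: F g.
Proof.
move=> sub; rewrite /malg_ext (big_fset_incl _ sub) // => g _ gx.
by rewrite monalg.mcoeff_outdom // scale0r.
Qed.

Lemma malg_ext_linear : linear malg_ext.
Proof.
move=> a x y; pose d := (monalg.msupp x `|` monalg.msupp y)%fset.
rewrite (@malg_extw d); last first.
  apply: fsubset_trans (monalg.msuppD_le _ _) _.
  by apply: fsetUSS => //; exact: monalg.msuppZ_le.
rewrite (@malg_extw d x) ?fsubsetUl // (@malg_extw d y) ?fsubsetUr //.
rewrite scaler_sumr -big_split; apply: eq_bigr => g _ /=.
by rewrite monalg.mcoeffD monalg.mcoeffZ scalerDl scalerA.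
Qed.

HB.instance Definition _ := GRing.isLinear.Build R[i] V W *:%R malg_ext malg_ext_linear.

Lemma malg_extU g : malg_ext (monalg.mkmalgU g 1) = F g.
Proof.
rewrite (@malg_extw [fset g]%fset) ?monalg.msuppU_le //.
by rewrite big_seq_fset1 monalg.mcoeffUU scale1r.
Qed.
End malg_ext.

Section malg_single.
Variables (R : realType) (K : choiceType).
Local Notation V := (monalg.malg K R[i]).
Local Notation single g := (monalg.mkmalgU g (1 : R[i]) : V).

Lemma malg_singleE (x : V) :
  x = \sum_(g <- monalg.msupp x) monalg.mcoeff g x *: single g.
Proof.
rewrite {1}[x]monalg.monalgE; apply: eq_bigr => g _; apply/monalg.malgP => k.
by rewrite monalg.mcoeffZ !monalg.mcoeffU mulrnAr mulr1.
Qed.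

Lemma malg_linear_eq (W : lmodType R[i]) (f h : V -> W) : linear f -> linear h ->
  (forall g, f (single g) = h (single g)) -> f =1 h.
Proof.
move=> fl hl fh x; rewrite (malg_singleE x) (lin_sum fl) (lin_sum hl).
by apply: eq_bigr => g _; rewrite (linZ fl) (linZ hl) fh.
Qed.

End malg_single.

Section group_gns.
Variables (R : realType) (G : groupType).
Implicit Types (phi : G -> R[i]).

Definition pos_def phi := (forall g, phi g^-1%g = (phi g)^*) /\
  forall (s : seq G) (c : G -> R[i]),
    0 <= \sum_(g <- s) \sum_(k <- s) c g * (c k)^* * phi (k^-1 * g)%g.

Local Notation V := (monalg.malg G R[i]).
Local Notation single g := (monalg.mkmalgU g (1 : R[i]) : V).

(** [malg_ext] provides linear extensions only; conjugating both inside and outside makes the form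
    conjugate-linear in [y]. *)
Definition gns_form_left phi (y : V) (g : G) : R[i]^o :=
  (malg_ext (fun k => (phi (k^-1 * g)%g)^* : R[i]^o) y)^*.
Definition gns_form phi (x y : V) : R[i] := malg_ext (gns_form_left phi y) x.

Lemma gns_formE phi x y : gns_form phi x y =
  \sum_(g <- monalg.msupp x) \sum_(k <- monalg.msupp y)
     monalg.mcoeff g x * (monalg.mcoeff k y)^* * phi (k^-1 * g)%g.
Proof.
apply: eq_bigr => g _; rewrite /gns_form_left /malg_ext rmorph_sum scaler_sumr.
by apply: eq_bigr => k _; rewrite /= rmorphM /= conjCK [LHS]mulrA.
Qed.

Lemma gns_forml phi a x y z :
  gns_form phi (a *: x + y) z = a * gns_form phi x z + gns_form phi y z.
Proof. exact: malg_ext_linear. Qed.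

Lemma gns_formC phi : pos_def phi -> forall x y, gns_form phi x y = (gns_form phi y x)^*.
Proof.
move=> [phiV _] x y; rewrite !gns_formE rmorph_sum /= exchange_big /=.
apply: eq_bigr => k _; rewrite rmorph_sum /=; apply: eq_bigr => g _.
by rewrite !rmorphM /= conjCK -phiV invMg invgK [in RHS]mulrAC [in LHS]mulrAC; ring.
Qed.

Lemma gns_form_ge0 phi : pos_def phi -> forall x, 0 <= gns_form phi x x.
Proof. by move=> [_ phi0] x; rewrite gns_formE. Qed.

Definition gns_sip phi (hphi : pos_def phi) : sip V :=
  Sip (gns_forml phi) (gns_formC hphi) (gns_form_ge0 hphi).

Lemma gns_form_single phi g k : gns_form phi (single g) (single k) = phi (k^-1 * g)%g.
Proof. by rewrite /gns_form malg_extU /gns_form_left malg_extU conjCK. Qed.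

Definition malg_translate (g : G) : V -> V := malg_ext (fun k => single (g * k)%g).

Lemma malg_translateU g k : malg_translate g (single k) = single (g * k)%g.
Proof. exact: malg_extU. Qed.

Lemma malg_translate_lin g : linear (malg_translate g).
Proof. exact: malg_ext_linear. Qed.

Lemma malg_translate1 x : malg_translate 1%g x = x.
Proof.
apply: (malg_linear_eq (malg_translate_lin _) (h := id)) => // g.
by rewrite malg_translateU mul1g.
Qed.

Lemma malg_translateM g k x :
  malg_translate (g * k)%g x = malg_translate g (malg_translate k x).
Proof.
apply: (malg_linear_eq (malg_translate_lin _) (h := malg_translate g \o malg_translate k)).
  by move=> a u v /=; rewrite !malg_translate_lin.
by move=> l; rewrite /= !malg_translateU mulgA.
Qed.

Lemma malg_translate_iso phi (hphi : pos_def phi) g x y :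
  gns_sip hphi (malg_translate g x) (malg_translate g y) = gns_sip hphi x y.
Proof.
rewrite [RHS]gns_formE sip_suml; apply: eq_bigr => k _; rewrite sip_sumr.
apply: eq_bigr => l _; rewrite sipZl sipZr mulrA; congr (_ * _).
by rewrite [LHS]gns_form_single invMg mulgA mulgKV.
Qed.

(** The last clause is cyclicity of [xi], stated as triviality of the orthogonal complement of its
    orbit. Countability of [G] arranges a spanning family of the group algebra in a sequence, as
    Gram-Schmidt requires. *)
Theorem GNS phi : countable [set: G] -> pos_def phi ->
  exists (H : hilbert R) (pi : G -> H -> H) (xi : H),
  [/\ unitary_rep pi,
      forall g k, hdot H (pi g xi) (pi k xi) = phi (k^-1 * g)%g &
      forall w, (forall g, hdot H w (pi g xi) = 0) -> w = 0].
Proof.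
move=> Gc hphi; have [f fi] := countable_injP _ Gc.
have [en enE] : exists en : nat -> V, forall g, exists n, en n = single g.
  (* Integers outside the range of the injection [f] are sent to the zero vector, which Gram-Schmidt
     tolerates. *)
  have : forall n, exists x, forall g, f g = n -> x = single g.
    move=> n; have [[g gn]|no] := pselect (exists g, f g = n).
      by exists (single g) => k kn; congr (monalg.mkmalgU _ _); apply: fi; rewrite ?kn ?gn //; apply: mem_set.
    by exists 0 => g gn; case: no; exists g.
  move=> /choice[en enP]; exists en => g; exists (f g); exact: enP.
pose B := gns_sip hphi.
have spanning x : exists N, expands B en N x.
  rewrite [x]malg_singleE; elim/big_ind : _ => [|u w [N eu] [M ew]|g _].
  - exact: expands0.
  - by rewrite -(scale1r u); apply: expands_lin; [exists N|exists M].
  - rewrite -(addr0 (_ *: _)); apply: expands_lin; last exact: expands0.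
    by have [n <-] := enE g; exists n.+1; exact: expands_gen.
pose tl := malg_translate_lin.
have iso := malg_translate_iso hphi.
exists (ell2_hilbert R (pivots B en)).
exists (gns_rep spanning iso), (gns_vec B en (single 1%g)).
have vec g : gns_rep spanning iso g (gns_vec B en (single 1%g)) = gns_vec B en (single g).
  rewrite (gns_rep_vec spanning _ malg_translate1 malg_translateM).
  by rewrite malg_translateU mulg1.
split.
- split=> [g|g u v||g k].
  + exact: gns_rep_linear.
  + rewrite !hsipE isometry_dot //; first exact: gns_rep_linear.
    by move=> w; rewrite (nrm_gns_rep spanning tl _ malg_translate1 malg_translateM).
  + exact: (gns_rep1 _ _ malg_translate1).
  + exact: (gns_repM spanning tl _ malg_translateM).
- by move=> g k; rewrite !vec (gns_dot spanning) [LHS]gns_form_single.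
- move=> w wg; apply: (@ell2_ext R (pivots B en)) => t.
  rewrite -gns_coord; move: (gs _ _ _) => x.
  rewrite [x]malg_singleE (lin_sum (gns_vec_linear _ _)) hdot_sumr big1 // => g _.
  by rewrite (linZ (gns_vec_linear _ _)) hdotZr -vec wg mulr0.
Qed.
End group_gns.

(** * The spectral gap given by property (T) *)

Section lazy_intertwine.
Variables (R : realType) (V W : lmodType R[i]) (p : nat) (f : V -> W).
Variables (al be : 'I_p -> V -> V) (al' be' : 'I_p -> W -> W).
Hypothesis f_lin : linear f.
Hypothesis f_al : forall s x, f (al s x) = al' s (f x).
Hypothesis f_be : forall s x, f (be s x) = be' s (f x).

Lemma lazy_intertwine x : f (lazy al be x) = lazy al' be' (f x).
Proof.
rewrite /lazy /avg (linZ f_lin) (linD f_lin) (linZ f_lin) (lin_sum f_lin).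
by under eq_bigr do rewrite (linD f_lin) f_al f_be.
Qed.

Lemma iter_lazy_intertwine m x :
  f (iter m (lazy al be) x) = iter m (lazy al' be') (f x).
Proof. by elim: m => // m IH; rewrite !iterS lazy_intertwine IH. Qed.
End lazy_intertwine.

Section unitary_reps.
Variables (R : realType) (G : groupType) (H : hilbert R) (pi : G -> H -> H).
Hypothesis piU : unitary_rep pi.

Lemma rep_linear g : linear (pi g). Proof. by case: piU. Qed.
Lemma rep_dot g u v : hdot H (pi g u) (pi g v) = hdot H u v. Proof. by case: piU. Qed.
Lemma rep1 u : pi 1%g u = u. Proof. by case: piU => _ _ -> _. Qed.
Lemma repM g k u : pi (g * k)%g u = pi g (pi k u). Proof. by case: piU => _ _ _ ->. Qed.
Lemma rep_nrm g u : nrm (hsip H) (pi g u) = nrm (hsip H) u.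
Proof. by rewrite /nrm -!hsipE rep_dot. Qed.
Lemma rep_adj g u v : hdot H (pi g^-1%g u) v = hdot H u (pi g v).
Proof. by rewrite -(rep_dot g) -repM mulgV rep1. Qed.

Variables (p : nat) (s : 'I_p -> G).
Definition rep_lazy : H -> H := lazy (fun i => pi (s i)) (fun i => pi (s i)^-1%g).

Variable eta : H.
Definition orbit_map : monalg.malg G R[i] -> H := malg_ext (fun g => pi g eta).

Lemma orbit_map_linear : linear orbit_map. Proof. exact: malg_ext_linear. Qed.

Lemma orbit_map_translate g x : orbit_map (malg_translate g x) = pi g (orbit_map x).
Proof.
move: x; apply: malg_linear_eq => [a x y|a x y|k].
- by rewrite malg_translate_lin orbit_map_linear.
- by rewrite orbit_map_linear rep_linear.
- by rewrite malg_translateU /orbit_map !malg_extU repM.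
Qed.

Lemma orbit_map_dot phi (hphi : pos_def phi) x y :
  (forall g, hdot H (pi g eta) eta = phi g) ->
  hdot H (orbit_map x) (orbit_map y) = gns_sip hphi x y.
Proof.
move=> E; rewrite hsipE [RHS]gns_formE sip_suml; apply: eq_bigr => k _.
rewrite sip_sumr; apply: eq_bigr => l _; rewrite sipZl sipZr mulrA; congr (_ * _).
by rewrite -E repM -hsipE rep_adj ?invgK.
Qed.

(** Iterates of the average are computed in the group algebra, so by [orbit_map_dot] their norms
    depend only on the coefficient function of [eta]. Two representations with the same coefficient
    thus share all estimates on these vectors. *)
Lemma rep_lazy_orbit m x : iter m rep_lazy (orbit_map x) =
  orbit_map (iter m (lazy (fun i => malg_translate (s i))
                         (fun i => malg_translate (s i)^-1%g)) x).
Proof.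
by rewrite (iter_lazy_intertwine orbit_map_linear
  (al' := fun i => pi (s i)) (be' := fun i => pi (s i)^-1%g)) // => i u;
  rewrite orbit_map_translate.
Qed.

Lemma pos_def_gram (phi : G -> R[i]) (J : G -> H) :
  (forall g k, hdot H (J g) (J k) = phi (k^-1 * g)%g) -> pos_def phi.
Proof.
move=> E; split=> [g|t c].
  by rewrite -[g^-1%g]mulg1 -E hdotC E invg1 mul1g.
have := hdot_ge0 (\sum_(g <- t) c g *: J g); rewrite hsipE sip_suml.
under eq_bigr do rewrite sip_sumr.
suff -> : \sum_(g <- t) \sum_(k <- t) hsip H (c g *: J g) (c k *: J k) =
  \sum_(g <- t) \sum_(k <- t) c g * (c k)^* * phi (k^-1 * g)%g by [].
apply: eq_bigr => g _; apply: eq_bigr => k _.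
by rewrite sipZl sipZr -hsipE E mulrA.
Qed.

End unitary_reps.

Lemma nat_bounded_eq0 (R : realType) (a b : R) : 0 <= a ->
  (forall m : nat, m%:R * a <= b) -> a = 0.
Proof.
move=> a0 h; apply/eqP; apply: contraT => an0.
have ap : 0 < a by rewrite lt_def an0.
have := h (Num.bound (b / a)); rewrite -ler_pdivlMr // => h1.
have := archi_boundP (le_trans (ler0n _ _) h1); lra.
Qed.

Section kazhdan_gap.
Variables (R : realType) (G : groupType).
Hypothesis Gc : countable [set: G].
Variables (F : set G) (e : R).
Hypothesis e0 : 0 < e.
Hypothesis kazhdan : forall (H : hilbert R) (pi : G -> H -> H), unitary_rep pi ->
      (exists2 u : H, u != 0 & forall g, F g -> `|pi g u - u| < e%:C%C * `|u|) ->
      exists2 u : H, u != 0 & forall g, pi g u = u.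
Variables (p : nat) (s : 'I_p -> G).
Hypothesis p0 : (0 < p)%N.
Hypothesis Fs : forall g, F g -> exists i, s i = g.

Section one_rep.
Variables (H : hilbert R) (pi : G -> H -> H).
Hypothesis piU : unitary_rep pi.
Local Notation h := (rep_lazy pi s).
Local Notation N := (nrm (hsip H)).

Let al_lin i : linear (pi (s i)). Proof. exact: rep_linear. Qed.
Let be_lin i : linear (pi (s i)^-1%g). Proof. exact: rep_linear. Qed.
Let al_iso i u : N (pi (s i) u) = N u. Proof. exact: rep_nrm. Qed.
Let be_iso i u : N (pi (s i)^-1%g u) = N u. Proof. exact: rep_nrm. Qed.
Let adj i u v : hsip H (pi (s i)^-1%g u) v = hsip H u (pi (s i) v).
Proof. by rewrite -!hsipE rep_adj. Qed.

(** Without nonzero invariant vectors, the Kazhdan condition excludes almost invariant ones, so some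
    generator displaces [u] by at least [e * N u] and [lazy_gap] applies. *)
Lemma no_invariant_gap u : (forall w, (forall g, pi g w = w) -> w = 0) ->
  N (h u) <= Num.sqrt (1 - (e ^+ 2 / (4 * p%:R)) ^+ 2) * N u.
Proof.
move=> noinv; have [->|u0] := eqVneq u 0.
  by rewrite /rep_lazy (lin0 (lazy_linear al_lin be_lin)) nrm0 mulr0.
have [g Fg ge] : exists2 g, F g & e * N u <= N (pi g u - u).
  apply: contrapT => no.
  have [|w /eqP w0 wi] := kazhdan piU; last by apply: w0; exact: noinv.
  exists u => // g Fg; rewrite !hnormE -rmorphM ltcR ltNge; apply/negP => ge.
  by apply: no; exists g.
have [i si] := Fs Fg; rewrite -si in ge.
have := lazy_gap p0 al_iso be_iso adj (ltW e0) ge.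
rewrite -/h; set c := 1 - _ => le.
rewrite -[N u]ger0_norm ?nrm_ge0 // -[N (h u)]ger0_norm ?nrm_ge0 // -!sqrtr_sqr.
rewrite mulrC -sqrtrM ?sqr_ge0 // mulrC ler_sqrt //.
by apply: le_trans le; exact: sqr_ge0.
Qed.

Lemma rep_lazy_invariant w u : (forall g, pi g w = w) -> hdot H w (h u) = hdot H w u.
Proof.
move=> wi; have inv g : hdot H w (pi g u) = hdot H w u by rewrite -(rep_adj piU) wi.
rewrite /rep_lazy /lazy /avg !hsipE sipZr sipDr sipZr sip_sumr.
under eq_bigr do rewrite sipDr -!hsipE !inv.
rewrite sumr_const card_ord -!hsipE !conj_realc.
set z := hdot H w u; have pn : p%:R != 0 :> R by rewrite pnatr_eq0 -lt0n.
have -> : (z + z) *+ p = (p%:R : R)%:C%C * (z + z) by rewrite rmorph_nat mulr_natl.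
by apply: complexP; case: z => a b /=; field.
Qed.

Lemma rep_lazy_invariant_iter m w u :
  (forall g, pi g w = w) -> hdot H w (iter m h u) = hdot H w u.
Proof. by move=> wi; elim: m => // m IH; rewrite iterS rep_lazy_invariant. Qed.

Lemma rep_ergodic m xi : m%:R * N (iter m h (xi - h xi)) ^+ 2 <= N xi ^+ 2.
Proof. exact: (ergodic p0 al_lin be_lin al_iso be_iso). Qed.
End one_rep.

(* The cyclic representation generated by [xi - h xi] has no invariant vector
   [w]: such a [w] satisfies <w, h^m (xi - h xi)> = <w, xi - h xi>, and the left
   side tends to 0. *)
Theorem rep_gap (H : hilbert R) (pi : G -> H -> H) (xi : H) : unitary_rep pi ->
  nrm (hsip H) (rep_lazy pi s (xi - rep_lazy pi s xi)) <=
  Num.sqrt (1 - (e ^+ 2 / (4 * p%:R)) ^+ 2) * nrm (hsip H) (xi - rep_lazy pi s xi).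
Proof.
move=> piU; set eta := xi - _; pose phi g := hdot H (pi g eta) eta.
have hphi : pos_def phi.
  apply: (@pos_def_gram R G H phi (fun g => pi g eta)) => g k.
  by rewrite /phi (repM piU) (rep_adj piU).
(* The GNS representation of the coefficient of [eta] stands in for the closed cyclic subspace;
   [same] below transfers the norms. *)
have [H' [pi' [eta' [piU' gram cyc]]]] := GNS Gc hphi.
have coef' g : hdot H' (pi' g eta') eta' = phi g.
  by rewrite -[eta' in X in hdot H' _ X](rep1 piU') gram invg1 mul1g.
have one_eta (K : hilbert R) (rho : G -> K -> K) z : unitary_rep rho ->
    orbit_map rho z (monalg.mkmalgU 1%g 1) = z.
  by move=> rhoU; rewrite /orbit_map malg_extU (rep1 rhoU).
have same m : nrm (hsip H') (iter m (rep_lazy pi' s) eta') =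
              nrm (hsip H) (iter m (rep_lazy pi s) eta).
  rewrite -{1}(one_eta _ _ eta' piU') -{1}(one_eta _ _ eta piU) !rep_lazy_orbit // /nrm -!hsipE.
  by rewrite (orbit_map_dot piU' hphi) // (orbit_map_dot piU hphi).
rewrite -[X in _ <= _ * X](same 0%N) -[leLHS](same 1%N) /=.
apply: no_invariant_gap => // w wi; apply: cyc => g.
have -> : hdot H' w (pi' g eta') = hdot H' w eta' by rewrite -(rep_adj piU') wi.
apply/eq0_normc/eqP; rewrite -sqrf_eq0; apply/eqP.
apply: (@nat_bounded_eq0 _ _ ((nrm (hsip H') w * nrm (hsip H) xi) ^+ 2)) => [|m].
  exact: sqr_ge0.
rewrite -(rep_lazy_invariant_iter piU' m) // exprMn hsipE.
have h1 : normc (hsip H' w (iter m (rep_lazy pi' s) eta')) ^+ 2 <=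
    (nrm (hsip H') w * nrm (hsip H) (iter m (rep_lazy pi s) eta)) ^+ 2.
  rewrite lerXn2r ?nnegrE ?mulr_ge0 ?normc_ge0 ?nrm_ge0 // -same; exact: sip_CS.
apply: le_trans (ler_wpM2l (ler0n _ m) h1) _.
by rewrite exprMn mulrCA ler_wpM2l ?sqr_ge0 // rep_ergodic.
Qed.

End kazhdan_gap.

Section words.
Variables (G : groupType) (p : nat) (s : 'I_p -> G).

Definition word := seq ('I_p * bool).

Definition letter_val (l : 'I_p * bool) : G := if l.2 then s l.1 else (s l.1)^-1%g.
Definition word_val (w : word) : G := foldr (fun l g => (letter_val l * g)%g) 1%g w.

Definition word_inv (w : word) : word := rev [seq (l.1, ~~ l.2) | l <- w].

Lemma word_val_cat w1 w2 : word_val (w1 ++ w2) = (word_val w1 * word_val w2)%g.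
Proof. by elim: w1 => [|l w1 IH] /=; rewrite ?mul1g // IH mulgA. Qed.

Lemma word_val_inv w : word_val (word_inv w) = (word_val w)^-1%g.
Proof.
elim: w => [|l w IH] /=; first by rewrite invg1.
rewrite /word_inv /= rev_cons -cats1 word_val_cat IH invMg /= mulg1; congr (_ * _)%g.
by rewrite /letter_val; case: l.2 => //=; rewrite invgK.
Qed.
End words.

(** * The subgroup generated by a Kazhdan set has finite index *)

Section finite_generation.
Variables (R : realType) (G : groupType).
Hypothesis Gc : countable [set: G].
Variables (F : set G) (e : R).
Hypothesis e0 : 0 < e.
Hypothesis kazhdan : forall (H : hilbert R) (pi : G -> H -> H), unitary_rep pi ->
      (exists2 u : H, u != 0 & forall g, F g -> `|pi g u - u| < e%:C%C * `|u|) ->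
      exists2 u : H, u != 0 & forall g, pi g u = u.

Inductive subgroup_gen : G -> Prop :=
| subgroup_gen1 : subgroup_gen 1%g
| subgroup_genM g k : F g -> subgroup_gen k -> subgroup_gen (g * k)%g
| subgroup_genV g k : F g -> subgroup_gen k -> subgroup_gen (g^-1 * k)%g.

Lemma subgroup_gen_mul g k : subgroup_gen g -> subgroup_gen k -> subgroup_gen (g * k)%g.
Proof.
move=> + kF; elim => [|l m Fl _ IH|l m Fl _ IH]; first by rewrite mul1g.
  by rewrite -mulgA; exact: subgroup_genM.
by rewrite -mulgA; exact: subgroup_genV.
Qed.

Lemma subgroup_gen_inv g : subgroup_gen g -> subgroup_gen g^-1%g.
Proof.
elim => [|l m Fl _ IH|l m Fl _ IH]; rewrite ?invg1 ?invMg; first exact: subgroup_gen1.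
  apply: subgroup_gen_mul => //; rewrite -[l^-1%g]mulg1.
  by apply: subgroup_genV => //; exact: subgroup_gen1.
rewrite invgK; apply: subgroup_gen_mul => //; rewrite -[l]mulg1.
by apply: subgroup_genM => //; exact: subgroup_gen1.
Qed.

(** A chosen element of the left coset of [g], depending only on that coset; cosets are compared
    through equality in [G], without a quotient type. *)
Definition coset_rep g : G := xget 1%g [set k | subgroup_gen (k^-1 * g)%g].

Lemma coset_repP g : subgroup_gen ((coset_rep g)^-1 * g)%g.
Proof.
apply: (@xgetPex _ 1%g [set k | subgroup_gen (k^-1 * g)%g]).
by exists g; rewrite /= mulVg; exact: subgroup_gen1.
Qed.

Lemma coset_rep_eq g k : subgroup_gen (k^-1 * g)%g -> coset_rep g = coset_rep k.
Proof.
move=> gk; rewrite /coset_rep; congr (xget _ _); apply/seteqP; split=> l /= hl.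
  have -> : (l^-1 * k)%g = (l^-1 * g * (k^-1 * g)^-1)%g by rewrite invMg invgK mulgA mulgK.
  by apply: subgroup_gen_mul => //; exact: subgroup_gen_inv.
have -> : (l^-1 * g)%g = (l^-1 * k * (k^-1 * g))%g by rewrite mulgA mulgK.
exact: subgroup_gen_mul.
Qed.

Lemma coset_rep_gen g k : coset_rep g = coset_rep k -> subgroup_gen (k^-1 * g)%g.
Proof.
move=> gk; have := coset_repP g; have := coset_repP k; rewrite gk => hk hg.
have -> : (k^-1 * g)%g = (((coset_rep k)^-1 * k)^-1 * ((coset_rep k)^-1 * g))%g.
  by rewrite invMg invgK mulgA mulgK.
by apply: subgroup_gen_mul => //; exact: subgroup_gen_inv.
Qed.

Lemma delta_dot (g k : G) :
  hdot (ell2_hilbert R G) (delta R g) (delta R k) = (g == k)%:R.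
Proof. by rewrite (@dot_coord _ _ _ _ k) //= eq_sym. Qed.

(** The indicator function of the subgroup generated by [F]. Its GNS representation is the
    quasi-regular representation on the cosets. *)
Definition coset_fun (g : G) : R[i] := (coset_rep g == coset_rep 1%g)%:R.

Lemma coset_fun_gram g k :
  hdot (ell2_hilbert R G) (delta R (coset_rep g)) (delta R (coset_rep k)) =
  coset_fun (k^-1 * g)%g.
Proof.
rewrite delta_dot /coset_fun; congr (_%:R); congr nat_of_bool.
apply/eqP/eqP => [/coset_rep_gen|/coset_rep_gen] h; apply: coset_rep_eq.
  by rewrite invg1 mul1g.
by move: h; rewrite invg1 mul1g.
Qed.

(** The cyclic vector [xi] represents the trivial coset and is fixed by [F], so there is a nonzero
    invariant vector [u]. Its inner products with the orbit of [xi] are all equal, and nonzero by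
    cyclicity. Distinct cosets give orthonormal vectors in this orbit, so Bessel's inequality bounds
    their number. *)
Lemma finite_index : exists L : seq G, forall g, exists2 l, l \in L & subgroup_gen (l^-1 * g)%g.
Proof.
have hphi := pos_def_gram coset_fun_gram.
have [H [pi [xi [piU gram cyc]]]] := GNS Gc hphi.
have phi1 : coset_fun 1%g = 1 by rewrite /coset_fun eqxx.
have xi1 : nrm (hsip H) xi = 1.
  apply/eqP; rewrite -sqrp_eq1 ?nrm_ge0 // nrm_sqr -hsipE.
  by rewrite -[xi](rep1 piU) gram mulVg phi1.
have [|u u0 ui] := kazhdan piU.
  exists xi; first by apply: contra_eq_neq xi1 => ->; rewrite nrm0 eq_sym oner_eq0.
  move=> g Fg; rewrite !hnormE xi1 -rmorphM ltcR mulr1.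
  suff /eqP -> : nrm (hsip H) (pi g xi - xi) == 0 by [].
  rewrite -sqrf_eq0 nrm_sqrB (rep_nrm piU) xi1 expr1n -hsipE -[xi in X in hdot H _ X](rep1 piU).
  rewrite gram invg1 mul1g /coset_fun (_ : coset_rep g == _) /=; first by apply/eqP; lra.
  apply/eqP/coset_rep_eq; rewrite invg1 mul1g -[g]mulg1.
  by apply: subgroup_genM => //; exact: subgroup_gen1.
have const g : hdot H u (pi g xi) = hdot H u xi by rewrite -(rep_adj piU) ui.
have c0 : hdot H u xi != 0.
  by apply: contra_neq u0 => c0; apply: cyc => g; rewrite const.
apply: contrapT => noL; move/eqP: c0; apply; apply/eq0_normc/eqP; rewrite -sqrf_eq0; apply/eqP.
apply: (@nat_bounded_eq0 _ _ (nrm (hsip H) u ^+ 2)) => [|n]; first exact: sqr_ge0.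
have [L [sL uL]] : exists L : seq G, size L = n /\ uniq (map coset_rep L).
  elim: n => [|n [L [sL uL]]]; first by exists [::].
  have [g hg] : exists g, forall l, l \in L -> ~ subgroup_gen (l^-1 * g)%g.
    apply: contrapT => no; apply: noL; exists L => g; apply: contrapT => no2.
    by apply: no; exists g => l lL hl; apply: no2; exists l.
  exists (g :: L); rewrite /= sL uL andbT; split=> //.
  by apply/mapP => -[l lL /coset_rep_gen]; exact: hg.
pose ev (i : 'I_n) := pi (nth 1%g L i) xi.
have orth i j : hsip H (ev i) (ev j) = (i == j)%:R.
  rewrite -hsipE gram -coset_fun_gram delta_dot; congr (_%:R); congr nat_of_bool.
  rewrite -!(nth_map _ (coset_rep 1%g)) ?sL // nth_uniq ?size_map ?sL //.
have := @bessel _ _ (hsip H) _ ev (index_enum 'I_n) u (index_enum_uniq _) orth.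
under eq_bigr do rewrite -hsipE /ev const.
by rewrite sumr_const card_ord mulr_natl.
Qed.
End finite_generation.

Theorem property_T_gap (R : realType) (G : groupType) :
  countable [set: G] -> property_T R G ->
  exists (p : nat) (s : 'I_p -> G) (q : R),
  [/\ (0 < p)%N, 0 <= q < 1, forall g, exists w, word_val s w = g &
    forall (H : hilbert R) (pi : G -> H -> H) (xi : H), unitary_rep pi ->
      nrm (hsip H) (rep_lazy pi s (xi - rep_lazy pi s xi)) <=
      q * nrm (hsip H) (xi - rep_lazy pi s xi)].
Proof.
move=> Gc [F [e [/finite_seqP[sF FE] e0 kaz]]].
have [L LP] := finite_index Gc e0 kaz.
(* Coset representatives are added to the Kazhdan set so that the list generates [G]; the leading 1
   makes it nonempty. *)
pose S := 1%g :: sF ++ L; pose s (i : 'I_(size S)) := nth 1%g S i.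
have sS g : g \in S -> exists i, s i = g.
  move=> gS; have ig : (index g S < size S)%N by rewrite index_mem.
  by exists (Ordinal ig); rewrite /s nth_index.
have Fs g : F g -> exists i, s i = g.
  by rewrite FE => gF; apply: sS; rewrite inE mem_cat gF orbT.
exists (size S), s, (Num.sqrt (1 - (e ^+ 2 / (4 * (size S)%:R)) ^+ 2)); split=> //.
- rewrite sqrtr_ge0 /= -[X in _ < X]sqrtr1 ltr_sqrt ?ltr01 //.
  by rewrite ltrBlDr ltrDl exprn_gt0 // divr_gt0 ?exprn_gt0 // mulr_gt0 // ltr0n.
- have gen k : subgroup_gen F k -> exists w, word_val s w = k.
    elim=> [|g m /Fs[i <-] _ [w <-]|g m /Fs[i <-] _ [w <-]]; first by exists [::].
      by exists ((i, true) :: w).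
    by exists ((i, false) :: w).
  move=> g; have [l lL /gen[w wE]] := LP g.
  have [i si] : exists i, s i = l by apply: sS; rewrite inE mem_cat lL !orbT.
  by exists ((i, true) :: w); rewrite /= wE /letter_val /= si mulKVg.
- by move=> H pi xi piU; exact: (rep_gap Gc e0 kaz).
Qed.

(** * Matrices with the normalized trace *)

(* The conjugate transpose at a fixed matrix type, so that all matrix products
   use the same ring structure on [R[i]]. *)
Definition mxadj (R : realType) (n : nat) (A : 'M[R[i]]_n) : 'M[R[i]]_n := A^t*.
Local Notation "A ^H" := (mxadj A) (at level 30).

Lemma mxadjE (R : realType) (n : nat) (A : 'M[R[i]]_n) i j : A^H i j = (A j i)^*.
Proof. by rewrite !mxE. Qed.

Section matrices_sip.
Variables (R : realType) (n : nat).
Local Notation M := 'M[R[i]]_n.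
Implicit Types (A B C D U V : M).

(* Specializations at [R[i]] that keep the ring structure inferred for ['M[R[i]]_n];
   comparing the different inheritance paths is expensive. *)
Lemma mxA A B C : A *m (B *m C) = A *m B *m C. Proof. exact: mulmxA. Qed.
Lemma mxBr A B C : A *m (B - C) = A *m B - A *m C. Proof. exact: mulmxBr. Qed.
Lemma mxBl A B C : (A - B) *m C = A *m C - B *m C. Proof. exact: mulmxBl. Qed.
Lemma mxDr A B C : A *m (B + C) = A *m B + A *m C. Proof. exact: mulmxDr. Qed.
Lemma mxDl A B C : (A + B) *m C = A *m C + B *m C. Proof. exact: mulmxDl. Qed.
Lemma mx1r A : A *m 1%:M = A. Proof. exact: mulmx1. Qed.
Lemma mx1l A : 1%:M *m A = A. Proof. exact: mul1mx. Qed.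
Lemma mxZl a A B : (a *: A) *m B = a *: (A *m B). Proof. by rewrite scalemxAl. Qed.
Lemma mxZr a A B : A *m (a *: B) = a *: (A *m B). Proof. by rewrite scalemxAr. Qed.
Lemma unitM U V : U \is unitarymx -> V \is unitarymx -> U *m V \is unitarymx.
Proof. exact: mul_unitarymx. Qed.

Definition mx_form A C : R[i] := ntr (C^H *m A).

Lemma mx_formE A C : mx_form A C = n%:R^-1 * \sum_i \sum_j A i j * (C i j)^*.
Proof.
rewrite /mx_form /ntr /mxtrace exchange_big /=; congr (_ * _); apply: eq_bigr => j _.
by rewrite !mxE; apply: eq_bigr => i _; rewrite mxadjE mulrC.
Qed.

Lemma mx_forml a A C D : mx_form (a *: A + C) D = a * mx_form A D + mx_form C D.
Proof.
rewrite /mx_form /ntr mxDr -scalemxAr mxtraceD mxtraceZ; ring.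
Qed.

Lemma mx_formC A C : mx_form A C = (mx_form C A)^*.
Proof.
rewrite !mx_formE rmorphM /= fmorphV /= rmorph_nat rmorph_sum; congr (_ * _).
apply: eq_bigr => i _; rewrite rmorph_sum; apply: eq_bigr => j _.
by rewrite rmorphM /= conjCK mulrC.
Qed.

Lemma mx_form_diagE A :
  mx_form A A = (n%:R^-1 * \sum_i \sum_j normc (A i j) ^+ 2)%:C%C.
Proof.
rewrite mx_formE rmorphM /= fmorphV rmorph_nat rmorph_sum; congr (_ * _).
apply: eq_bigr => i _; rewrite /= rmorph_sum; apply: eq_bigr => j _.
by rewrite mul_conjE.
Qed.

Lemma mx_form_ge0 A : 0 <= mx_form A A.
Proof.
rewrite mx_form_diagE ler0c mulr_ge0 ?invr_ge0 // sumr_ge0 // => i _.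
by rewrite sumr_ge0 // => j _; rewrite sqr_ge0.
Qed.

Fact mx_sip_key : unit. Proof. exact: tt. Qed.
Definition mx_sip : sip M :=
  locked_with mx_sip_key (Sip mx_forml mx_formC mx_form_ge0).

Local Notation m2 := (nrm mx_sip).

Lemma mx_sipE A C : mx_sip A C = ntr (C^H *m A).
Proof. by rewrite /mx_sip unlock. Qed.

Lemma m2_sqr A : m2 A ^+ 2 = n%:R^-1 * \sum_i \sum_j normc (A i j) ^+ 2.
Proof. by rewrite nrm_sqr mx_sipE -[ntr _]/(mx_form A A) mx_form_diagE. Qed.

Lemma trCM A C : (A *m C)^H = C^H *m A^H.
Proof. by rewrite /mxadj trmx_mul map_mxM. Qed.

Lemma trCK A : A^H^H = A. Proof. exact: trmxCK. Qed.

Lemma trCB A C : (A - C)^H = A^H - C^H.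
Proof. by apply/matrixP => i j; rewrite mxadjE !mxE rmorphB. Qed.

Lemma trC1 : (1%:M : M)^H = 1%:M.
Proof. by rewrite /mxadj trmx1 map_mx1. Qed.

Lemma ntrC A C : ntr (A *m C) = ntr (C *m A).
Proof. by rewrite /ntr mxtrace_mulC. Qed.

Lemma unitarymx_trC U : U \is unitarymx -> U^H \is unitarymx.
Proof. by rewrite trmxC_unitary. Qed.

Lemma unitarymxVl U : U \is unitarymx -> U^H *m U = 1%:M.
Proof. by move=> /unitarymx_trC/unitarymxP; rewrite -/(mxadj _) trCK. Qed.

Lemma unitarymxVr U : U \is unitarymx -> U *m U^H = 1%:M.
Proof. by move/unitarymxP. Qed.

Lemma mx_sip_mull A C D : mx_sip (D *m A) C = mx_sip A (D^H *m C).
Proof. by rewrite !mx_sipE trCM trCK mxA. Qed.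

Lemma mx_sip_mulr A C D : mx_sip (A *m D) C = mx_sip A (C *m D^H).
Proof. by rewrite !mx_sipE trCM trCK mxA ntrC mxA. Qed.

Lemma unitaryKl U A : U \is unitarymx -> U^H *m (U *m A) = A.
Proof. by move=> Uu; rewrite mxA unitarymxVl // mx1l. Qed.

Lemma unitaryKr U A : U \is unitarymx -> A *m U *m U^H = A.
Proof. by move=> Uu; rewrite -mxA unitarymxVr // mx1r. Qed.

Lemma m2_mulUl U A : U \is unitarymx -> m2 (U *m A) = m2 A.
Proof. by move=> Uu; rewrite /nrm mx_sip_mull unitaryKl. Qed.

Lemma m2_mulUr U A : U \is unitarymx -> m2 (A *m U) = m2 A.
Proof. by move=> Uu; rewrite /nrm mx_sip_mulr unitaryKr. Qed.

Lemma m2_trC A : m2 (A^H) = m2 A.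
Proof. by rewrite /nrm !mx_sipE trCK ntrC. Qed.

Lemma ntr1 : (0 < n)%N -> ntr (1%:M : M) = 1.
Proof. by move=> n0; rewrite /ntr mxtrace1 mulVf // pnatr_eq0 -lt0n. Qed.

Lemma m2_1_le : m2 1%:M <= 1.
Proof.
have [n0|n0] := posnP n.
  by rewrite /nrm mx_sipE /ntr n0 invr0 mul0r sqrtr0 ler01.
have -> : m2 1%:M = 1; last by [].
by rewrite /nrm mx_sipE trC1 mx1l ntr1 // sqrtr1.
Qed.

Lemma m2_unitary U : U \is unitarymx -> m2 U <= 1.
Proof. by move=> Uu; rewrite -[U]mx1r m2_mulUl // m2_1_le. Qed.

Lemma normc_ntr A : normc (ntr A) <= m2 A.
Proof.
have -> : ntr A = mx_sip A 1%:M by rewrite mx_sipE trC1 mx1l.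
by apply: le_trans (sip_CS _ _ _) _; rewrite ler_piMr ?nrm_ge0 // m2_1_le.
Qed.

(* Polar/singular value decomposition; stated for invertible matrices, which
   suffices because they are dense. *)
Lemma svd_unit A : A \in unitmx -> exists (P Q : M) (sg : 'I_n -> R),
  [/\ P \is unitarymx, Q \is unitarymx, forall j, 0 < sg j &
      A = P *m diag_mx (\row_j (sg j)%:C%C) *m Q].
Proof.
move=> Aun; have AAh : A^H *m A \is hermsymmx.
  by apply/is_hermitianmxP; rewrite expr0 scale1r -[RHS]/((A^H *m A)^H) trCM trCK.
have /orthomx_spectralP := hermitian_normalmx AAh.
set Q := spectralmx _; set D := spectral_diag _.
have Qu : Q \is unitarymx by exact: spectral_unitarymx.
rewrite invmx_unitary // -[Q^t*]/(Q^H) => AE; pose C := A *m Q^H.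
have CC : C^H *m C = diag_mx D.
  rewrite /C trCM trCK mxA -(mxA Q) AE !mxA unitarymxVr // mx1l.
  by rewrite -mxA unitarymxVr // mx1r.
have Dj j : D 0 j = (\sum_i normc (C i j) ^+ 2)%:C%C.
  have := congr1 (fun X : M => X j j) CC; rewrite !mxE eqxx mulr1n => <-.
  by rewrite rmorph_sum; apply: eq_bigr => i _; rewrite mxadjE mulrC mul_conjE.
have Cun : C \in unitmx.
  by rewrite unitmx_mul Aun; apply/unitarymx_unit/unitarymx_trC.
have AC : A = C *m Q by rewrite /C -mxA unitarymxVl // mx1r.
clearbody C.
pose sg j := Num.sqrt (\sum_i normc (C i j) ^+ 2).
have sum0 j : 0 < \sum_i normc (C i j) ^+ 2.
  rewrite lt_def sumr_ge0 ?andbT => [|i _]; last exact: sqr_ge0.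
  apply/eqP => s0; have : diag_mx D \in unitmx.
    by rewrite -CC unitmx_mul Cun andbT /mxadj map_unitmx unitmx_tr.
  rewrite unitmxE det_diag unitfE prodf_seq_neq0 => /allP/(_ j).
  by rewrite mem_index_enum Dj s0 eqxx => /(_ isT).
exists (C *m diag_mx (\row_j ((sg j)^-1)%:C%C)), Q, sg.
have sg0 j : 0 < sg j by rewrite sqrtr_gt0.
have diagC (a : 'I_n -> R) : (diag_mx (\row_j (a j)%:C%C) : M)^H = diag_mx (\row_j (a j)%:C%C).
  apply/matrixP => i j; rewrite mxadjE !mxE eq_sym; case: eqVneq => [->|_].
    by rewrite !mulr1n conj_realc.
  by rewrite !mulr0n conjC0.
split; [|exact: Qu|exact: sg0|].
- rewrite -trmxC_unitary -/(mxadj _); apply/unitarymxP; rewrite -/(mxadj _) trCK trCM diagC.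
  set E := diag_mx _; have -> : E *m C^H *m (C *m E) = E *m (C^H *m C) *m E.
    by rewrite !mxA.
  rewrite CC /E; apply/matrixP => i j; rewrite mul_mx_diag mul_diag_mx !mxE.
  case: eqVneq => [->|_]; last by rewrite !mulr0n mulr0 mul0r.
  rewrite !mulr1n Dj -!rmorphM; have -> : \sum_i normc (C i j) ^+ 2 = sg j ^+ 2.
    by rewrite sqr_sqrtr // ltW.
  by rewrite expr2 mulKf ?gt_eqF // divff ?gt_eqF.
- set E := diag_mx _; set E' := diag_mx _.
  have EE : E *m E' = 1%:M.
    apply/matrixP => i j; rewrite mul_diag_mx !mxE; case: eqVneq => [->|_].
      by rewrite !mulr1n -rmorphM /= mulVf ?gt_eqF.
    by rewrite !mulr0n mulr0.
  by rewrite -(mxA C) EE mx1r.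
Qed.

(** The matrix [A + t] is singular for at most [n] values of [t], the roots of a characteristic
    polynomial up to sign, whereas [n.+1] distinct values [eta / k.+1%:R] are at hand. *)
Lemma unit_perturb A (eta : R) : 0 < eta -> exists t : R,
  [/\ 0 < t, t <= eta & A + t%:C%C%:M \in unitmx].
Proof.
move=> eta0; pose tk (k : nat) : R := eta / k.+1%:R.
have tk0 k : 0 < tk k by rewrite divr_gt0 // ltr0n.
apply: contrapT => no.
have rt k : root (char_poly A) (- (tk k)%:C%C).
  rewrite -eigenvalue_root_char; apply: contrapT => /negP ne; apply: no; exists (tk k).
  split => //; first by rewrite ler_pdivrMr ?ltr0n // ler_peMr ?(ltW eta0) // ler1n.
  rewrite -row_free_unit -kermx_eq0; move: ne.
  by rewrite /eigenvalue /eigenspace negbK rmorphN opprK.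
pose rs := [seq - (tk k)%:C%C | k <- iota 0 n.+1] : seq R[i].
have urs : uniq rs.
  rewrite map_inj_uniq ?iota_uniq // => k l /oppr_inj/(congr1 (@complex.Re R)) /=.
  move=> /(mulfI (lt0r_neq0 eta0))/invr_inj/eqP; rewrite eqr_nat => /eqP.
  by case.
have /(max_poly_roots (monic_neq0 (char_poly_monic A))) : all (root (char_poly A)) rs.
  by apply/allP => _ /mapP[k _ ->].
by move=> /(_ urs); rewrite size_char_poly size_map size_iota ltnn.
Qed.

End matrices_sip.

Lemma addr_subACA (V : zmodType) (a b c d : V) : a - b + (c - d) = a - d + (c - b).
Proof. by rewrite addrACA [RHS]addrACA (addrC (- b)). Qed.

(** * Polar decomposition and almost intertwiners *)

Section polar.
Variables (R : realType) (n : nat).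
Local Notation M := 'M[R[i]]_n.
Implicit Types (A B C D U V W : M).
Local Notation m2 := (nrm (mx_sip R n)).

(* Associativity instances on variables: unification is costly on adjoints. *)
Lemma mul6A (A B C D E F : M) :
  A *m (B *m C) *m (D *m E *m F) = A *m (B *m (C *m D) *m E) *m F.
Proof. by rewrite !mxA. Qed.
Lemma mul5A (A B C D E : M) : A *m B *m C *m (D *m E) = A *m (B *m C *m D) *m E.
Proof. by rewrite !mxA. Qed.
Lemma mul5A' (A B C D E : M) : A *m (B *m C *m D) *m E = (A *m B) *m C *m (D *m E).
Proof. by rewrite !mxA. Qed.
Lemma mul6A' (A B C D E F : M) :
  A *m B *m C *m (D *m E *m F) = A *m B *m (C *m D) *m E *m F.
Proof. by rewrite !mxA. Qed.
Lemma mul6A'' (A B C D E F : M) :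
  A *m (B *m (C *m D *m E)) *m F = A *m B *m C *m D *m (E *m F).
Proof. by rewrite !mxA. Qed.
Lemma mul6A''' (A B C D E F : M) :
  A *m (B *m C *m D *m E) *m F = A *m B *m (C *m (D *m E *m F)).
Proof. by rewrite !mxA. Qed.

Lemma scal_comm (a : R[i]) A : a%:M *m A = A *m a%:M.
Proof. by rewrite mul_scalar_mx mul_mx_scalar. Qed.

Definition rdiag (a : 'I_n -> R) : M := diag_mx (\row_j (a j)%:C%C).

Lemma mul_rdiag_r A a i j : (A *m rdiag a) i j = A i j * (a j)%:C%C.
Proof. by rewrite /rdiag mul_mx_diag !mxE. Qed.

Lemma mul_rdiag_l A a i j : (rdiag a *m A) i j = (a i)%:C%C * A i j.
Proof. by rewrite /rdiag mul_diag_mx !mxE. Qed.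

Lemma mx_subE A B i j : (A - B) i j = A i j - B i j. Proof. by rewrite !mxE. Qed.
Lemma mx_addE A B i j : (A + B) i j = A i j + B i j. Proof. by rewrite !mxE. Qed.
Lemma mx_scaleE a A i j : (a *: A) i j = a * A i j. Proof. by rewrite !mxE. Qed.

Lemma rdiag_trC a : (rdiag a)^H = rdiag a.
Proof.
apply/matrixP => i j; rewrite mxadjE !mxE eq_sym; case: eqVneq => [->|_].
  by rewrite !mulr1n conj_realc.
by rewrite !mulr0n conjC0.
Qed.

Lemma rdiagM a b : rdiag a *m rdiag b = rdiag (fun j => a j * b j).
Proof.
apply/matrixP => i j; rewrite mul_diag_mx !mxE; case: eqVneq => [->|_].
  by rewrite !mulr1n -rmorphM.
by rewrite !mulr0n mulr0.
Qed.

Lemma rdiag1 : rdiag (fun=> 1) = 1%:M.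
Proof. by apply/matrixP => i j; rewrite !mxE; case: eqP. Qed.

Lemma rdiagB a b : rdiag a - rdiag b = rdiag (fun j => a j - b j).
Proof.
apply/matrixP => i j; rewrite !mxE; case: eqVneq => [->|_].
  by rewrite !mulr1n -rmorphB.
by rewrite !mulr0n subrr.
Qed.

Lemma m2_le_entries A C : (forall i j, normc (A i j) <= normc (C i j)) -> m2 A <= m2 C.
Proof.
move=> AC; rewrite -ler_sqr ?nnegrE ?nrm_ge0 // !m2_sqr ler_wpM2l ?invr_ge0 //.
apply: ler_sum => i _; apply: ler_sum => j _.
by rewrite lerXn2r ?nnegrE ?normc_ge0.
Qed.

Lemma rdiagE a i j : rdiag a i j = (a i *+ (i == j))%:C%C.
Proof. by rewrite !mxE raddfMn. Qed.

Lemma m2_scalar (t : R) : 0 <= t -> m2 (t%:C%C%:M) <= t.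
Proof.
move=> t0; rewrite -scalemx1 nrmZ normc_real ger0_norm // ler_piMr //.
exact: m2_1_le.
Qed.

(** For a singular value [sg j], the deviation from 1 is at most that of its square, because
    [sg j + 1 >= 1]. The slack [eta] pays for the shift that makes [A] invertible. *)
Lemma near_unitary A (eta : R) : 0 < eta ->
  exists2 U, U \is unitarymx & m2 (A - U) <= m2 (A^H *m A - 1%:M) + eta.
Proof.
(* A shift by [t <= 1] costs at most [t] in [A] itself and [t * (2 * m2 A + 1)] in its Gram matrix,
   [t * c] in total. *)
move=> eta0; pose c := 2 + 2 * m2 A.
have c0 : 0 < c by rewrite ltr_wpDr // mulr_ge0 // nrm_ge0.
have [|t [t0 tle Aun]] := @unit_perturb _ _ A (Num.min 1 (eta / c)).
  by rewrite lt_min ltr01 divr_gt0.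
have {tle} [t1 tc] : t <= 1 /\ t * c <= eta.
  by move: tle; rewrite le_min => /andP[-> ]; rewrite ler_pdivlMr.
set T := t%:C%C%:M in Aun.
have [P [Q [sg [Pu Qu sg0 AE]]]] := svd_unit Aun; rewrite -/(rdiag sg) in AE.
exists (P *m Q); first exact: (unitM Pu Qu).
have T2 : m2 T <= t by apply: m2_scalar; exact: ltW.
have h1 : m2 (A + T - P *m Q) = m2 (rdiag sg - rdiag (fun=> 1)).
  have -> : A + T - P *m Q = P *m (rdiag sg - rdiag (fun=> 1)) *m Q.
    by rewrite AE rdiag1 mxBr mxBl mx1r.
  by rewrite (m2_mulUr _ Qu) (m2_mulUl _ Pu).
have h2 : m2 (rdiag sg - rdiag (fun=> 1)) <= m2 (rdiag (fun j => sg j * sg j) - rdiag (fun=> 1)).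
  rewrite !rdiagB; apply: m2_le_entries => i j; rewrite !rdiagE !normc_real.
  case: eqVneq => [->|_]; rewrite ?mulr1n ?mulr0n // ?normr0 //.
  have -> : sg j * sg j - 1 = (sg j - 1) * (sg j + 1) by ring.
  by rewrite normrM ler_peMr // ger0_norm; have := sg0 j; lra.
have h3 : m2 (rdiag (fun j => sg j * sg j) - rdiag (fun=> 1)) = m2 ((A + T)^H *m (A + T) - 1%:M).
  have -> : (A + T)^H *m (A + T) - 1%:M =
      Q^H *m (rdiag (fun j => sg j * sg j) - rdiag (fun=> 1)) *m Q.
    rewrite AE !trCM rdiag_trC -rdiagM rdiag1 mxBr mxBl mx1r.
    rewrite (unitarymxVl Qu); congr (_ - _).
    have -> : Q^H *m (rdiag sg *m P^H) *m (P *m rdiag sg *m Q) =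
      Q^H *m (rdiag sg *m (P^H *m P) *m rdiag sg) *m Q by exact: mul6A.
    by rewrite (unitarymxVl Pu) mx1r.
  by rewrite (m2_mulUr _ Qu) (m2_mulUl _ (unitarymx_trC Qu)).
have h4 : (A + T)^H *m (A + T) - 1%:M =
    (A^H *m A - 1%:M) + (t%:C%C *: A^H + t%:C%C *: A + t%:C%C *: T).
  have -> : (A + T)^H = A^H + T.
    rewrite /mxadj linearD /= map_mxD; congr (_ + _).
    by rewrite /T tr_scalar_mx map_scalar_mx; congr (_%:M); exact: conj_realc.
  rewrite mxDl !mxDr /T mul_mx_scalar !mul_scalar_mx -!addrA; congr (_ + _).
  by rewrite [in RHS]addrC -!addrA.
have h5 : m2 (t%:C%C *: A^H + t%:C%C *: A + t%:C%C *: T) <= t * m2 A + t * m2 A + t * m2 T.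
  apply: le_trans (nrmD _ _ _) _; rewrite lerD //; last by rewrite nrmZ normc_real gtr0_norm.
  by apply: le_trans (nrmD _ _ _) _; rewrite !nrmZ normc_real gtr0_norm // m2_trC.
have h6 : m2 (A - P *m Q) <= m2 (A + T - P *m Q) + m2 T.
  have -> : A - P *m Q = (A + T - P *m Q) - T by rewrite (addrAC A T) addrK.
  exact: nrmB.
have h7 : t * m2 T <= t * 1 by rewrite ler_wpM2l ?(ltW t0) // (le_trans T2).
rewrite h1 in h6; rewrite h3 h4 in h2.
have h8 := nrmD (mx_sip R n) (A^H *m A - 1%:M) (t%:C%C *: A^H + t%:C%C *: A + t%:C%C *: T).
by move: tc; rewrite /c => tc; clear -h6 h2 h8 h5 h7 tc T2 t0 t1; lra.
Qed.

Definition col_proj (J : {set 'I_n}) : M := rdiag (fun j => (j \in J)%:R).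

(* With [W = P S Q] and [D] the difference of [U] and [V] transported by the
   unitary part of [W], both [U W - W V] and its adjoint are small, hence so is
   [D S + S D]; as [S >= 0], this bounds [D] away from the small singular values. *)
Lemma intertwiner_defect p (U V : 'I_p -> M) W (d : R) : 0 < d ->
  (forall s, U s \is unitarymx) -> (forall s, V s \is unitarymx) ->
  (forall s, m2 (U s *m W - W *m V s) <= d) ->
  exists (Z Q : M) (J : {set 'I_n}),
  [/\ Z \is unitarymx, Q \is unitarymx,
      #|J|%:R <= 4 * (n%:R * (m2 (W - 1%:M) + d) ^+ 2) &
      forall s, m2 ((Z *m U s *m Z^H - V s) -
                    (Z *m U s *m Z^H - V s) *m (Q^H *m col_proj J *m Q)) <= 12 * d].
Proof.
move=> d0 Uu Vu UWV.
have [t [t0 td Wun]] := unit_perturb W d0.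
set T := t%:C%C%:M in Wun; set W' : M := W + T in Wun.
have [P [Q [sg [Pu Qu sg0 WE]]]] := svd_unit Wun; rewrite -/(rdiag sg) in WE.
have T2 : m2 T <= d by apply: le_trans td; apply: m2_scalar; exact: ltW.
(* The cut at 1/2 serves twice. Off [J] the factor [2 * (sg j + sg i)] is at least 1. On [J], a unit
   column of [Q^H] is at squared distance at least 1/4 from the matching column of [P *m rdiag sg],
   which gives the factor 4 in the bound on [#|J|]. *)
pose J : {set 'I_n} := [set j | sg j <= 2^-1]%SET.
exists (Q^H *m P^H), Q, J; split.
- by apply: unitM; exact: unitarymx_trC.
- exact: Qu.
- have h1 : m2 (W' - 1%:M) <= m2 (W - 1%:M) + d.
    have -> : W' - 1%:M = W - 1%:M + T by rewrite /W' addrAC.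
    by apply: le_trans (nrmD _ _ _) _; rewrite lerD2l.
  have h2 : m2 (W' - 1%:M) = m2 (P *m rdiag sg - Q^H).
    rewrite -(m2_mulUr (W' - 1%:M) (unitarymx_trC Qu)) mxBl mx1l WE.
    by rewrite (unitaryKr _ Qu).
  have [n0|n0] := posnP n.
    have -> : #|J| = 0%N.
      by apply/eqP; rewrite cards_eq0; apply/eqP/setP => j; have := ltn_ord j; rewrite {2}n0.
    by apply: mulr_ge0 => //; apply: mulr_ge0 => //; exact: sqr_ge0.
  have h3 : #|J|%:R <= 4 * (n%:R * m2 (W' - 1%:M) ^+ 2).
    rewrite h2 m2_sqr mulVKf ?pnatr_eq0 -?lt0n // exchange_big /=.
    rewrite -sum1_card natr_sum mulr_sumr.
    have colsum (X : M) j : X \is unitarymx -> \sum_i normc (X i j) ^+ 2 = 1.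
      move=> Xu; have := congr1 (fun Y : M => Re (Y j j)) (unitarymxVl Xu).
      rewrite !mxE eqxx /= Re_sum => <-; apply: eq_bigr => i _.
      by rewrite mxadjE mulrC mul_conjE.
    rewrite [leRHS](bigID (mem J)) /= ler_wpDr //.
      by rewrite sumr_ge0 // => j _; rewrite mulr_ge0 // sumr_ge0 // => i _; exact: sqr_ge0.
    apply: ler_sum => j; rewrite inE => sj.
    have e1 := colsum _ j (unitarymx_trC Qu); have e2 := colsum _ j Pu.
    have e3 : 1 <= \sum_i (2 * normc ((P *m rdiag sg - Q^H) i j) ^+ 2
                           + 2 * (sg j ^+ 2 * normc (P i j) ^+ 2)).
      rewrite -[leLHS]e1; apply: ler_sum => i _.
      have -> : Q^H i j = - (P *m rdiag sg - Q^H) i j + P i j * (sg j)%:C%C.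
        by rewrite mx_subE mul_rdiag_r; ring.
      apply: le_trans (normc_sqrD _ _) _.
      by rewrite normcN normcM normc_real exprMn real_normK ?num_real // [_ * sg j ^+ 2]mulrC.
    rewrite big_split /= -!mulr_sumr e2 mulr1 in e3.
    have : sg j ^+ 2 <= 2^-1 ^+ 2 by rewrite lerXn2r ?nnegrE ?(ltW (sg0 j)).
    rewrite expr2; lra.
  apply: le_trans h3 _; rewrite ler_pM2l // ler_wpM2l //.
  by rewrite lerXn2r ?nnegrE ?addr_ge0 ?nrm_ge0 ?(ltW d0).
- move=> s; pose U' : M := P^H *m U s *m P; pose V' : M := Q *m V s *m Q^H.
  have U'u : U' \is unitarymx by exact: (unitM (unitM (unitarymx_trC Pu) (Uu s)) Pu).
  have V'u : V' \is unitarymx by exact: (unitM (unitM Qu (Vu s)) (unitarymx_trC Qu)).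
  pose S : M := rdiag sg; pose X : M := U' *m S - S *m V'.
  have [D DE] : exists D : M, D = U' - V' by exists (U' - V').
  have ZUZ : Q^H *m P^H *m U s *m (Q^H *m P^H)^H = Q^H *m U' *m Q.
    by rewrite trCM !trCK; exact: mul5A.
  have VQ : V s = Q^H *m V' *m Q.
    have -> : Q^H *m V' *m Q = (Q^H *m Q) *m V s *m (Q^H *m Q) by exact: mul5A'.
    by rewrite (unitarymxVl Qu) mx1l mx1r.
  have -> : Q^H *m P^H *m U s *m (Q^H *m P^H)^H - V s = Q^H *m D *m Q.
    by rewrite ZUZ {1}VQ DE mxBr mxBl.
  have -> : Q^H *m D *m Q - Q^H *m D *m Q *m (Q^H *m col_proj J *m Q) =
            Q^H *m (D - D *m col_proj J) *m Q.
    rewrite mxBr mxBl; congr (_ - _).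
    have -> : Q^H *m D *m Q *m (Q^H *m col_proj J *m Q) =
              Q^H *m D *m (Q *m Q^H) *m col_proj J *m Q by exact: mul6A'.
    by rewrite (unitarymxVr Qu) mx1r (mxA (Q^H)).
  rewrite (m2_mulUr _ Qu) (m2_mulUl _ (unitarymx_trC Qu)).
  have X3 : m2 X <= 3 * d.
    have -> : X = P^H *m (U s *m W' - W' *m V s) *m Q^H.
      rewrite /X /U' /V' WE -/S mxBr mxBl; congr (_ - _).
        have -> : P^H *m (U s *m (P *m S *m Q)) *m Q^H = P^H *m U s *m P *m S *m (Q *m Q^H).
          exact: mul6A''.
        by rewrite (unitarymxVr Qu) mx1r.
      have -> : P^H *m (P *m S *m Q *m V s) *m Q^H = P^H *m P *m (S *m (Q *m V s *m Q^H)).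
        exact: mul6A'''.
      by rewrite (unitarymxVl Pu) mx1l.
    rewrite (m2_mulUr _ (unitarymx_trC Qu)) (m2_mulUl _ (unitarymx_trC Pu)).
    have -> : U s *m W' - W' *m V s = (U s *m W - W *m V s) + (U s *m T - T *m V s).
      by rewrite /W' mxDr mxDl opprD addrACA.
    apply: le_trans (nrmD _ _ _) _; have := UWV s.
    have : m2 (U s *m T - T *m V s) <= m2 T + m2 T.
      apply: le_trans (nrmB _ _ _) _; rewrite (m2_mulUl _ (Uu s)) lerD2l /T.
        have -> : t%:C%C%:M *m V s = V s *m t%:C%C%:M by exact: scal_comm.
        by rewrite (m2_mulUl _ (Vu s)).
    lra.
  have X6 : m2 (D *m S + S *m D) <= 6 * d.
    (* The adjoint relation enters through the second term: sandwiched between [V'] and [U'], the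
       adjoint of [X] equals [V' *m S - S *m U']. *)
    have -> : D *m S + S *m D = X + - (V' *m (X^H) *m U').
      have -> : X^H = S *m U'^H - V'^H *m S.
        by rewrite /X trCB !trCM rdiag_trC.
      rewrite mxBr mxBl (mxA V' (V'^H)) (unitarymxVr V'u) mx1l.
      rewrite -(mxA V') -(mxA S) (unitarymxVl U'u) mx1r.
      rewrite DE /X mxBl mxBr opprB; exact: addr_subACA.
    apply: le_trans (nrmB _ _ _) _.
    rewrite (m2_mulUr _ U'u) (m2_mulUl _ V'u) m2_trC; lra.
  apply: le_trans (_ : 2 * m2 (D *m S + S *m D) <= _); last by lra.
  have <- : m2 ((2 : R)%:C%C *: (D *m S + S *m D)) = 2 * m2 (D *m S + S *m D).
    by rewrite nrmZ normc_real ger0_norm.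
  apply: m2_le_entries => i j.
  rewrite mx_subE mx_scaleE mx_addE /col_proj !mul_rdiag_r mul_rdiag_l.
  have -> : (2 : R)%:C%C * (D i j * (sg j)%:C%C + (sg i)%:C%C * D i j) =
            (2 * (sg j + sg i))%:C%C * D i j by rewrite !rmorphM rmorphD; ring.
  rewrite normcM normc_real; case: (boolP (j \in J)) => jJ.
    by rewrite mulr1 subrr normc0 mulr_ge0 ?normc_ge0.
  rewrite mulr0 subr0 ler_peMl ?normc_ge0 //.
  move: jJ; rewrite inE -ltNge => jJ; rewrite ger0_norm; have := sg0 i; lra.
Qed.

End polar.

(** * Ultralimits of matrix coefficients *)

Section ultralimit.
Variables (R : realType) (U : set_system nat).
Hypothesis UU : UltraFilter U.
Hypothesis U_free : forall N, U [set k | (N <= k)%N].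
Implicit Types a b : nat -> R.

Definition ulim a (l : R) := forall e : R, 0 < e -> U [set k | `|a k - l| < e].

Lemma ulim_uniq a l l' : ulim a l -> ulim a l' -> l = l'.
Proof.
move=> al al'; apply/eqP; rewrite -subr_eq0; apply: contraT => ll'.
have e0 : 0 < `|l - l'| / 2 by rewrite divr_gt0 // normr_gt0.
have [k []] := filter_ex (filterI (al _ e0) (al' _ e0)).
move=> /= h1 h2; have := ler_normB (a k - l') (a k - l).
have -> : a k - l' - (a k - l) = l - l' by ring.
lra.
Qed.

Lemma ulimD a b l m : ulim a l -> ulim b m -> ulim (fun k => a k + b k) (l + m).
Proof.
move=> al bm e e0; have e2 : 0 < e / 2 by rewrite divr_gt0.
apply: filterS2 (al _ e2) (bm _ e2) => k /= h1 h2.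
have -> : a k + b k - (l + m) = (a k - l) + (b k - m) by ring.
by apply: le_lt_trans (ler_normD _ _) _; lra.
Qed.

Lemma ulimZ a l c : ulim a l -> ulim (fun k => c * a k) (c * l).
Proof.
move=> al e e0; have c0 : 0 < `|c| + 1 by rewrite ltr_wpDl.
apply: filterS (al _ (divr_gt0 e0 c0)) => k /=; rewrite ltr_pdivlMr // => h.
rewrite -mulrBr normrM mulrC; apply: le_lt_trans h.
by rewrite ler_wpM2l // lerDl.
Qed.

Lemma ulim_eq a b l : (forall k, b k = a k) -> ulim a l -> ulim b l.
Proof. by move=> /funext ->. Qed.

Lemma ulim_cst c : ulim (fun=> c) c.
Proof.
by move=> e e0; apply: filterS (U_free 0%N) => k _ /=; rewrite subrr normr0.
Qed.

Lemma ulim_ge0 a l : (forall k, 0 <= a k) -> ulim a l -> 0 <= l.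
Proof.
move=> a0 al; rewrite leNgt; apply/negP => l0.
have l0' : 0 < - l by rewrite oppr_gt0.
have [k /=] := filter_ex (al _ l0'); have := a0 k; have := ler_norm (a k - l); lra.
Qed.

Lemma ulim_cvg0 a : (forall e : R, 0 < e -> exists N, forall k, (N <= k)%N -> `|a k| < e) -> ulim a 0.
Proof.
move=> h e /h [N hN]; apply: filterS (U_free N) => k /= Nk; rewrite subr0; exact: hN.
Qed.

Lemma ulim_ex a (M : R) : (forall k, `|a k| <= M) -> exists l, ulim a l.
Proof.
move=> aM; have cpt : compact `[- M, M] := @segment_compact R (- M) M.
have UI : U [set k | `[- M, M]%classic (a k)].
  apply: filterS (U_free 0%N) => k _ /=; rewrite in_itv /=.
  by have := aM k; rewrite ler_norml.
have [l [_ cl]] := cpt (a @ U) _ UI.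
exists l => e e0; have [//|Uc] := in_ultra_setVsetC [set k | `|a k - l| < e] UU.
have [] := cl [set x | ~ (`|x - l| < e)] (ball l e); first exact: Uc.
  exact: nbhsx_ballx.
by move=> x [/= nx]; rewrite /ball /= distrC.
Qed.

Definition bounded_seq (z : nat -> R[i]) := exists M : R, forall k, normc (z k) <= M.

(* The limit along the ultrafilter; meaningful only for bounded sequences. *)
Definition uL a : R := xget 0 (ulim a).
Definition cL (z : nat -> R[i]) : R[i] :=
  (uL (fun k => Re (z k)) +i* uL (fun k => Im (z k)))%C.

Lemma uLE a l : ulim a l -> uL a = l.
Proof.
by move=> al; apply: (@ulim_uniq a) => //; apply: (@xgetPex _ 0 (ulim a)); exists l.
Qed.

Definition clim (z : nat -> R[i]) (l : R[i]) :=
  ulim (fun k => Re (z k)) (Re l) /\ ulim (fun k => Im (z k)) (Im l).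

Lemma clim_uniq z l l' : clim z l -> clim z l' -> l = l'.
Proof. by move=> [h1 h2] [h3 h4]; apply: complexP; [exact: ulim_uniq h1 h3|exact: ulim_uniq h2 h4]. Qed.

Lemma climE z : bounded_seq z -> clim z (cL z).
Proof.
move=> [M zM].
have [l lP] : exists l, ulim (fun k => Re (z k)) l.
  apply: (@ulim_ex _ M) => k; apply: le_trans (zM k); case: (z k) => x y /=.
  by rewrite -sqrtr_sqr ler_wsqrtr // lerDl sqr_ge0.
have [m mP] : exists l, ulim (fun k => Im (z k)) l.
  apply: (@ulim_ex _ M) => k; apply: le_trans (zM k); case: (z k) => x y /=.
  by rewrite -sqrtr_sqr ler_wsqrtr // lerDr sqr_ge0.
by split; rewrite /cL /= ?(uLE lP) ?(uLE mP).
Qed.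

Lemma climD z w l m : clim z l -> clim w m -> clim (fun k => z k + w k) (l + m).
Proof.
move=> [h1 h2] [h3 h4]; split.
  by rewrite ReD; apply: ulim_eq (ulimD h1 h3) => k; rewrite ReD.
by rewrite ImD; apply: ulim_eq (ulimD h2 h4) => k; rewrite ImD.
Qed.

Lemma climZ z l c : clim z l -> clim (fun k => c * z k) (c * l).
Proof.
move=> [h1 h2]; split.
  rewrite ReM -mulNr; apply: ulim_eq (ulimD (ulimZ _ h1) (ulimZ _ h2)) => k.
  by rewrite ReM mulNr.
by rewrite ImM; apply: ulim_eq (ulimD (ulimZ _ h2) (ulimZ _ h1)) => k; rewrite ImM.
Qed.

Lemma clim0 : clim (fun=> 0) 0.
Proof. by split; exact: ulim_cst. Qed.

Lemma clim_sum (I : Type) (s : seq I) (F : I -> nat -> R[i]) (l : I -> R[i]) :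
  (forall i, clim (F i) (l i)) -> clim (fun k => \sum_(i <- s) F i k) (\sum_(i <- s) l i).
Proof.
move=> h; elim: s => [|i s IH].
  have -> : (fun k => \sum_(i <- [::]) F i k) = (fun=> 0) by apply/funext => k; rewrite big_nil.
  by rewrite big_nil; exact: clim0.
have -> : (fun k => \sum_(j <- i :: s) F j k) = (fun k => F i k + \sum_(j <- s) F j k).
  by apply/funext => k; rewrite big_cons.
by rewrite big_cons; apply: climD.
Qed.

Lemma climJ z l : clim z l -> clim (fun k => (z k)^*) l^*.
Proof.
move=> [h1 h2]; split.
  by rewrite ReJ; apply: ulim_eq h1 => k; rewrite ReJ.
rewrite ImJ -mulN1r; apply: ulim_eq (ulimZ _ h2) => k; by rewrite ImJ mulN1r.
Qed.

Lemma clim_ge0 z l : (forall k, 0 <= z k) -> clim z l -> 0 <= l.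
Proof.
move=> z0 [h1 h2]; rewrite lecE; apply/andP; split.
  apply/eqP; apply: (ulim_uniq h2); have -> : (fun k => Im (z k)) = (fun=> 0).
    by apply/funext => k; have := z0 k; rewrite lecE => /andP[/eqP].
  exact: ulim_cst.
apply: ulim_ge0 h1 => k; by have := z0 k; rewrite lecE => /andP[].
Qed.

Lemma clim_near z w l : (forall e : R, 0 < e -> exists N, forall k, (N <= k)%N -> normc (z k - w k) < e) ->
  clim z l -> clim w l.
Proof.
move=> h [h1 h2].
have Reb (x : R[i]) : `|Re x| <= normc x.
  by case: x => x y /=; rewrite -sqrtr_sqr ler_wsqrtr // lerDl sqr_ge0.
have Imb (x : R[i]) : `|Im x| <= normc x.
  by case: x => x y /=; rewrite -sqrtr_sqr ler_wsqrtr // lerDr sqr_ge0.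
split.
  rewrite -[Re l]addr0; have -> : (fun k => Re (w k)) = (fun k => Re (z k) + Re (w k - z k)).
    by apply/funext => k; rewrite ReB; lra.
  apply: ulimD h1 _; apply: ulim_cvg0 => e /h [N hN]; exists N => k Nk.
  by apply: le_lt_trans (Reb _) _; rewrite -opprB normcN; exact: hN.
rewrite -[Im l]addr0; have -> : (fun k => Im (w k)) = (fun k => Im (z k) + Im (w k - z k)).
  by apply/funext => k; rewrite raddfB /=; lra.
apply: ulimD h2 _; apply: ulim_cvg0 => e /h [N hN]; exists N => k Nk.
by apply: le_lt_trans (Imb _) _; rewrite -opprB normcN; exact: hN.
Qed.

End ultralimit.

Lemma free_ultrafilter : exists U : set_system nat,
  UltraFilter U /\ forall N, U [set k | (N <= k)%N].
Proof.
have [U [UU oU]] := @ultraFilterLemma nat \oo _.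
by exists U; split => // N; apply: oU; exists N.
Qed.

Section word_matrices.
Variables (R : realType) (n p : nat).
Local Notation M := 'M[R[i]]_n.
Local Notation m2 := (nrm (mx_sip R n)).
Implicit Types (U V : 'I_p -> M) (w : word p).

Definition letter_mx U (l : 'I_p * bool) : M := if l.2 then U l.1 else (U l.1)^H.
Definition word_mx U w : M := foldr (fun l A => letter_mx U l *m A) 1%:M w.

Lemma word_mx_cat U w1 w2 : word_mx U (w1 ++ w2) = word_mx U w1 *m word_mx U w2.
Proof. by elim: w1 => [|l w1 /= ->]; rewrite ?mx1l ?mxA. Qed.

Lemma word_mx_inv U w : word_mx U (word_inv w) = (word_mx U w)^H.
Proof.
elim: w => [|l w IH]; first by rewrite /word_mx /= trC1.
rewrite /word_inv /= rev_cons -cats1 word_mx_cat -/(word_inv w) IH /= mx1r trCM.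
by congr (_ *m _); rewrite /letter_mx; case: l.2; rewrite //= trCK.
Qed.

Definition unitary_tuple U := forall s, U s \is unitarymx.

Lemma letter_mx_unitary U l : unitary_tuple U -> letter_mx U l \is unitarymx.
Proof. by move=> Uu; rewrite /letter_mx; case: l.2; [|exact: unitarymx_trC]. Qed.

Lemma mx1_unitary : (1%:M : M) \is unitarymx.
Proof. by apply/unitarymxP; rewrite -/(mxadj _) trC1 mx1r. Qed.

Lemma word_mx_unitary U w : unitary_tuple U -> word_mx U w \is unitarymx.
Proof.
move=> Uu; elim: w => [|l w IH]; first exact: mx1_unitary.
exact: (unitM (letter_mx_unitary l Uu) IH).
Qed.

End word_matrices.

Lemma sum_lt_of_products (R : realType) (x y a b c d e : R) :
  x <= a * b -> y <= c * d -> a * b <= a * 1 -> c * d <= 1 * d ->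
  a < e / 2 -> d < e / 2 -> x + y < e.
Proof. lra. Qed.

Section conjugation.
Variables (R : realType) (n p : nat) (U V : 'I_p -> 'M[R[i]]_n).
Local Notation M := 'M[R[i]]_n.
Local Notation m2 := (nrm (mx_sip R n)).
Hypothesis Uu : unitary_tuple U.
Hypothesis Vu : unitary_tuple V.

Definition conj_al (s : 'I_p) (A : M) : M := U s *m A *m (V s)^H.
Definition conj_be (s : 'I_p) (A : M) : M := (U s)^H *m A *m V s.
Definition conj_lazy : M -> M := lazy conj_al conj_be.

Lemma sandwich_linear (B C : M) : linear (fun A : M => (B *m A *m C) : M).
Proof. by move=> a A A'; rewrite mxDr mxDl mxZr mxZl. Qed.

Lemma conj_al_lin s : linear (conj_al s). Proof. exact: sandwich_linear. Qed.
Lemma conj_be_lin s : linear (conj_be s). Proof. exact: sandwich_linear. Qed.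
Lemma conj_al_iso s A : m2 (conj_al s A) = m2 A.
Proof. by rewrite /conj_al (m2_mulUr _ (unitarymx_trC (Vu s))) (m2_mulUl _ (Uu s)). Qed.
Lemma conj_be_iso s A : m2 (conj_be s A) = m2 A.
Proof. by rewrite /conj_be (m2_mulUr _ (Vu s)) (m2_mulUl _ (unitarymx_trC (Uu s))). Qed.
Lemma conj_adj s A C : mx_sip R n (conj_be s A) C = mx_sip R n A (conj_al s C).
Proof. by rewrite /conj_be mx_sip_mulr mx_sip_mull trCK mxA. Qed.

Lemma conj_displacement s A : m2 (conj_al s A - A) = m2 (U s *m A - A *m V s).
Proof.
rewrite -(m2_mulUr _ (Vu s)) mxBl /conj_al.
have -> : U s *m A *m (V s)^H *m V s = U s *m A *m ((V s)^H *m V s) by rewrite mxA.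
by rewrite (unitarymxVl (Vu s)) mx1r.
Qed.

(** The orbit of the identity under the twisted conjugations [conj_al] and [conj_be], read along
    words. By [word_conj_sip] its Gram matrix consists of traces of [word_conj] at single words,
    which is the shape of a coefficient function. *)
Definition word_conj (w : word p) : M := word_mx U w *m (word_mx V w)^H.

Lemma word_conj_cons l w : word_conj (l :: w) =
  if l.2 then conj_al l.1 (word_conj w) else conj_be l.1 (word_conj w).
Proof.
rewrite /word_conj /= trCM /letter_mx /conj_al /conj_be.
by case: l.2; rewrite ?trCK !mxA.
Qed.

Lemma word_conj_sip w w' : mx_sip R n (word_conj w) (word_conj w') =
  ntr (word_conj (word_inv w' ++ w)).
Proof.
rewrite mx_sipE /word_conj trCM trCK !word_mx_cat !word_mx_inv trCM trCK.
by rewrite -(mxA (word_mx V w')) ntrC !mxA.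
Qed.

Lemma normc_word_conj w : normc (ntr (word_conj w)) <= 1.
Proof.
apply: le_trans (normc_ntr _) _; apply: m2_unitary.
exact: (unitM (word_mx_unitary w Uu) (unitarymx_trC (word_mx_unitary w Vu))).
Qed.

End conjugation.

(** * Almost representations and their limit coefficients *)

Section approximate_representations.
Variables (R : realType) (G : groupType) (p : nat) (s : 'I_p -> G).

(** One parameter bounds the word length and the tolerance, so that a sequence indexed by [N]
    satisfies every relation of [G] in the limit. For unitaries, a trace close to 1 means closeness
    to the identity in 2-norm. *)
Definition approx_rep (N n : nat) (U : 'I_p -> 'M[R[i]]_n) :=
  forall w : word p, (size w <= N)%N -> word_val s w = 1%g ->
    normc (ntr (word_mx U w) - 1) <= N.+1%:R^-1.

Lemma approx_rep_word N n (U : 'I_p -> 'M[R[i]]_n) w w' : unitary_tuple U ->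
  approx_rep N U -> (size w + size w' <= N)%N -> word_val s w = word_val s w' ->
  nrm (mx_sip R n) (word_mx U w - word_mx U w') ^+ 2 <= 2 * N.+1%:R^-1.
Proof.
move=> Uu aU sz ww'; rewrite nrm_sqrB mx_sipE -word_mx_inv -word_mx_cat.
have := aU (word_inv w' ++ w) _ _; rewrite size_cat size_rev size_map addnC => /(_ sz).
rewrite word_val_cat word_val_inv ww' mulVg => /(_ erefl) h.
have := Re_le_normc (- (ntr (word_mx U (word_inv w' ++ w)) - 1)).
rewrite normcN ReN ReB -[Re 1]/(1 : R) => h2.
have m1 v : nrm (mx_sip R n) (word_mx U v) ^+ 2 <= 1.
  by rewrite expr_le1 ?nrm_ge0 //; apply: m2_unitary; exact: word_mx_unitary.
have := m1 w; have := m1 w'; move: h h2; set a := _^-1; set b := normc _; set z := Re _. lra.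
Qed.

Section limit.
Variables (n : nat -> nat) (U V : forall k, 'I_p -> 'M[R[i]]_(n k)).
Hypothesis Uu : forall k, unitary_tuple (U k).
Hypothesis Vu : forall k, unitary_tuple (V k).
Hypothesis aU : forall k, approx_rep k (U k).
Hypothesis aV : forall k, approx_rep k (V k).

Definition Phi (w : word p) (k : nat) : R[i] := ntr (word_conj (U k) (V k) w).

Lemma Phi_bounded w : bounded_seq (Phi w).
Proof. by exists 1 => k; exact: normc_word_conj. Qed.

(** Exchanging [w] for [w'] first in [U] and then in [V] changes the trace by at most the two 2-norm
    distances, which [approx_rep_word] makes small; the tolerance index is the position [k] in the
    sequence. *)
Lemma Phi_near w w' : word_val s w = word_val s w' ->
  forall e : R, 0 < e -> exists N, forall k, (N <= k)%N -> normc (Phi w k - Phi w' k) < e.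
Proof.
move=> ww' e e0; pose N := (size w + size w' + Num.bound (2 / (e / 2) ^+ 2))%N.
exists N => k Nk.
have e2 : 0 < (e / 2) ^+ 2 by rewrite exprn_gt0 // divr_gt0.
have small (X : forall k, 'I_p -> 'M[R[i]]_(n k)) : (forall k, unitary_tuple (X k)) ->
    (forall k, approx_rep k (X k)) -> nrm (mx_sip R (n k)) (word_mx (X k) w - word_mx (X k) w') < e / 2.
  move=> Xu aX; rewrite -ltr_sqr ?nnegrE ?nrm_ge0 ?divr_ge0 ?(ltW e0) //.
  have sz : (size w + size w' <= k)%N by apply: leq_trans Nk; rewrite leq_addr.
  apply: le_lt_trans (approx_rep_word (Xu k) (aX k) sz ww') _.
  rewrite ltr_pdivrMr ?ltr0n // mulrC -ltr_pdivrMr //.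
  have b0 : 0 <= 2 / (e / 2) ^+ 2 by rewrite divr_ge0 // ltW.
  apply: lt_le_trans (archi_boundP b0) _; rewrite ler_nat.
  by apply: leq_trans (leqnSn _); apply: leq_trans Nk; rewrite leq_addl.
have -> : Phi w k - Phi w' k =
    mx_sip R (n k) (word_mx (U k) w - word_mx (U k) w') (word_mx (V k) w) +
    mx_sip R (n k) (word_mx (U k) w') (word_mx (V k) w - word_mx (V k) w').
  rewrite sipBl sipBr !mx_sipE /Phi /word_conj !(ntrC (_^H)).
  by rewrite addrA subrK.
have one (X : forall k, 'I_p -> 'M[R[i]]_(n k)) v : (forall k, unitary_tuple (X k)) -> nrm (mx_sip R (n k)) (word_mx (X k) v) <= 1.
  by move=> Xu; apply: m2_unitary; exact: word_mx_unitary.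
apply: le_lt_trans (normc_le_add _ _) _.
have h1 := sip_CS (mx_sip R (n k)) (word_mx (U k) w - word_mx (U k) w') (word_mx (V k) w).
have h2 := sip_CS (mx_sip R (n k)) (word_mx (U k) w') (word_mx (V k) w - word_mx (V k) w').
have h3 := ler_wpM2l (nrm_ge0 (mx_sip R (n k)) (word_mx (U k) w - word_mx (U k) w')) (one V w Vu).
have h4 := ler_wpM2r (nrm_ge0 (mx_sip R (n k)) (word_mx (V k) w - word_mx (V k) w')) (one U w' Uu).
exact: sum_lt_of_products h1 h2 h3 h4 (small U Uu aU) (small V Vu aV).
Qed.

Variables (F : set_system nat).
Hypothesis FU : UltraFilter F.
Hypothesis F_free : forall N, F [set k | (N <= k)%N].
Hypothesis gen : forall g, exists w, word_val s w = g.
Hypothesis Gc : countable [set: G].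
Variable q : R.
Hypothesis q01 : 0 <= q < 1.
Hypothesis gap : forall (H : hilbert R) (pi : G -> H -> H) (xi : H), unitary_rep pi ->
      nrm (hsip H) (rep_lazy pi s (xi - rep_lazy pi s xi)) <=
      q * nrm (hsip H) (xi - rep_lazy pi s xi).

(** Along the ultrafilter the coefficients depend on a word only through its value in [G], by
    [Phi_near]. Positivity passes to the limit from the Gram matrices of the [word_conj]. *)
Lemma limit_coefficient : exists2 phi : G -> R[i], pos_def phi &
  forall w, clim F (Phi w) (phi (word_val s w)).
Proof.
have /choice[wd wdE] := gen.
pose phi g := cL F (Phi (wd g)).
have lim w : clim F (Phi w) (phi (word_val s w)).
  apply: (clim_near FU F_free _ (climE FU F_free (Phi_bounded (wd (word_val s w))))).
  by apply: Phi_near; rewrite wdE.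
exists phi => //; split=> [g|t c].
  have h1 := lim (word_inv (wd g)); rewrite word_val_inv wdE in h1.
  have h2 := climJ FU (lim (wd g)); rewrite wdE in h2.
  have E : Phi (word_inv (wd g)) = (fun k => (Phi (wd g) k)^*).
    apply/funext => k; have := sipC (mx_sip R (n k)) (word_mx (V k) (wd g)) (word_mx (U k) (wd g)).
    by rewrite /Phi /word_conj !mx_sipE !word_mx_inv trCK => ->; rewrite [in RHS]ntrC.
  by rewrite E in h1; exact: (clim_uniq FU h1 h2).
pose z k := \sum_(g <- t) \sum_(l <- t) c g * (c l)^* * Phi (word_inv (wd l) ++ wd g) k.
apply: (@clim_ge0 _ F FU F_free z) => [k|].
  have := sip_ge0 (mx_sip R (n k)) (\sum_(g <- t) c g *: word_conj (U k) (V k) (wd g)).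
  rewrite sip_suml; under eq_bigr do rewrite sip_sumr.
  under eq_bigr do under eq_bigr do rewrite sipZl sipZr word_conj_sip mulrA.
  by [].
apply: (clim_sum FU F_free) => g; apply: (clim_sum FU F_free) => l; apply: (climZ FU).
by rewrite -[X in phi X](_ : word_val s (word_inv (wd l) ++ wd g) = _) // word_val_cat word_val_inv !wdE.
Qed.

(** The matrices carry no exact action of [G], so the average is lifted to the space spanned by
    formal words. It maps compatibly to every matrix space by [free_mx] and to the GNS space of the
    limit coefficient. *)
Definition free_al (i : 'I_p) : monalg.malg (word p) R[i] -> monalg.malg (word p) R[i] :=
  malg_ext (fun w => monalg.mkmalgU ((i, true) :: w : word p) 1).
Definition free_be (i : 'I_p) : monalg.malg (word p) R[i] -> monalg.malg (word p) R[i] :=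
  malg_ext (fun w => monalg.mkmalgU ((i, false) :: w : word p) 1).

Definition free_mx k : monalg.malg (word p) R[i] -> 'M[R[i]]_(n k) :=
  malg_ext (word_conj (U k) (V k)).

Lemma free_mx_al k i x : free_mx k (free_al i x) = conj_al (U k) (V k) i (free_mx k x).
Proof.
move: x; apply: malg_linear_eq => [a x y|a x y|w].
- by rewrite /free_al /free_mx !malg_ext_linear.
- by rewrite /free_mx malg_ext_linear conj_al_lin.
- by rewrite /free_al /free_mx !malg_extU word_conj_cons.
Qed.

Lemma free_mx_be k i x : free_mx k (free_be i x) = conj_be (U k) (V k) i (free_mx k x).
Proof.
move: x; apply: malg_linear_eq => [a x y|a x y|w].
- by rewrite /free_be /free_mx !malg_ext_linear.
- by rewrite /free_mx malg_ext_linear conj_be_lin.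
- by rewrite /free_be /free_mx !malg_extU word_conj_cons.
Qed.

Definition free_vec j := 
  let e := monalg.mkmalgU ([::] : word p) (1 : R[i]) in
  iter j (lazy free_al free_be) (e - lazy free_al free_be e).

Lemma free_mx_vec k j : free_mx k (free_vec j) =
  iter j (conj_lazy (U k) (V k)) (1%:M - conj_lazy (U k) (V k) 1%:M).
Proof.
have fl : linear (free_mx k) by exact: malg_ext_linear.
have e1 : free_mx k (monalg.mkmalgU ([::] : word p) (1 : R[i])) = 1%:M.
  by rewrite /free_mx malg_extU /word_conj /word_mx /= trC1 mx1r.
rewrite /free_vec (iter_lazy_intertwine fl (free_mx_al k) (free_mx_be k)).
by rewrite (linB fl) (lazy_intertwine fl (free_mx_al k) (free_mx_be k)) e1.
Qed.

(** For each combination of words, the squared 2-norms of its matrix images converge along the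
    ultrafilter to its squared norm in the GNS space, where the gap holds exactly. A failure by
    [eta] at every [k] would survive in the limit as a failure by [eta ^+ 2] between squares. *)
Lemma limit_gap j (eta : R) : 0 < eta -> exists k,
  nrm (mx_sip R (n k)) (iter j (conj_lazy (U k) (V k)) (1%:M - conj_lazy (U k) (V k) 1%:M)) <=
  q ^+ j * nrm (mx_sip R (n k)) (1%:M - conj_lazy (U k) (V k) 1%:M) + eta.
Proof.
move=> eta0; have [phi hphi lim] := limit_coefficient.
have [H [pi [xi [piU gram cyc]]]] := GNS Gc hphi.
pose rho : monalg.malg (word p) R[i] -> H := malg_ext (fun w => pi (word_val s w) xi).
have rl : linear rho by exact: malg_ext_linear.
have r_al i x : rho (free_al i x) = pi (s i) (rho x).
  move: x; apply: malg_linear_eq => [a x y|a x y|w].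
  - by rewrite /free_al malg_ext_linear rl.
  - by rewrite rl rep_linear.
  - by rewrite /free_al /rho !malg_extU /= (repM piU).
have r_be i x : rho (free_be i x) = pi (s i)^-1%g (rho x).
  move: x; apply: malg_linear_eq => [a x y|a x y|w].
  - by rewrite /free_be malg_ext_linear rl.
  - by rewrite rl rep_linear.
  - by rewrite /free_be /rho !malg_extU /= (repM piU).
pose h := rep_lazy pi s.
have r_vec i : rho (free_vec i) = iter i h (xi - h xi).
  have e1 : rho (monalg.mkmalgU ([::] : word p) (1 : R[i])) = xi.
    by rewrite /rho malg_extU /= (rep1 piU).
  rewrite /free_vec (iter_lazy_intertwine (al' := fun i => pi (s i))
    (be' := fun i => pi (s i)^-1%g) rl r_al r_be).
  by rewrite (linB rl) (lazy_intertwine (al' := fun i => pi (s i))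
    (be' := fun i => pi (s i)^-1%g) rl r_al r_be) e1.
have hgap i : nrm (hsip H) (iter i h (xi - h xi)) <= q ^+ i * nrm (hsip H) (xi - h xi).
  have hl : linear h by apply: lazy_linear => t; exact: rep_linear.
  elim: i => [|i IH]; first by rewrite expr0 mul1r.
  have iterB m u : iter m h (u - h u) = iter m h u - h (iter m h u).
    by elim: m => // m; rewrite !iterS => ->; rewrite (linB hl).
  rewrite iterS iterB; apply: le_trans (gap _ piU) _; rewrite -/h -iterB exprS -mulrA.
  by case/andP: q01 => q0 _; rewrite ler_wpM2l.
have nlim x : ulim F (fun k => nrm (mx_sip R (n k)) (free_mx k x) ^+ 2) (nrm (hsip H) (rho x) ^+ 2).
  have : clim F (fun k => mx_sip R (n k) (free_mx k x) (free_mx k x)) (hsip H (rho x) (rho x)).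
    pose z k := \sum_(w <- monalg.msupp x) \sum_(w' <- monalg.msupp x)
       monalg.mcoeff w x * (monalg.mcoeff w' x)^* * Phi (word_inv w' ++ w) k.
    have -> : (fun k => mx_sip R (n k) (free_mx k x) (free_mx k x)) = z.
      apply/funext => k; rewrite sip_suml; apply: eq_bigr => w _; rewrite sip_sumr.
      by apply: eq_bigr => w' _; rewrite sipZl sipZr word_conj_sip mulrA.
    have -> : hsip H (rho x) (rho x) = \sum_(w <- monalg.msupp x) \sum_(w' <- monalg.msupp x)
       monalg.mcoeff w x * (monalg.mcoeff w' x)^* * phi (word_val s (word_inv w' ++ w)).
      rewrite sip_suml; apply: eq_bigr => w _; rewrite sip_sumr.
      apply: eq_bigr => w' _; rewrite sipZl sipZr -hsipE gram mulrA.
      by rewrite word_val_cat word_val_inv.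
    by apply: (clim_sum FU F_free) => w; apply: (clim_sum FU F_free) => w'; apply: (climZ FU).
  move=> [hr _]; rewrite nrm_sqr; apply: ulim_eq hr => k; by rewrite nrm_sqr.
apply: contrapT => no.
have big k : q ^+ j * nrm (mx_sip R (n k)) (free_mx k (free_vec 0)) + eta <=
             nrm (mx_sip R (n k)) (free_mx k (free_vec j)).
  rewrite leNgt; apply/negP => lt; apply: no; exists k.
  by move: lt; rewrite !free_mx_vec => /ltW.
have q0 : 0 <= q ^+ j by rewrite exprn_ge0 //; case/andP: q01.
have : 0 <= nrm (hsip H) (rho (free_vec j)) ^+ 2 +
            ((- (q ^+ j) ^+ 2) * nrm (hsip H) (rho (free_vec 0)) ^+ 2 + (- eta ^+ 2)).
  have ul := ulimD FU (nlim (free_vec j))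
    (ulimD FU (ulimZ FU (- (q ^+ j) ^+ 2) (nlim (free_vec 0))) (ulim_cst FU F_free (- eta ^+ 2))).
  apply: (ulim_ge0 FU _ ul) => k; have := big k.
  set a := nrm _ _; set b := nrm _ _ => ab.
  have b0 : 0 <= a by exact: nrm_ge0.
  have : (q ^+ j * a + eta) ^+ 2 <= b ^+ 2.
    by rewrite lerXn2r ?nnegrE ?nrm_ge0 // addr_ge0 ?mulr_ge0 // ltW.
  rewrite sqrrD exprMn; have : 0 <= q ^+ j * a * eta *+ 2 by rewrite mulrn_wge0 // !mulr_ge0 // ltW.
  lra.
have := hgap j; rewrite -!r_vec -[xi - h xi]/(iter 0 h (xi - h xi)) -r_vec => hj.
have : nrm (hsip H) (rho (free_vec j)) ^+ 2 <= (q ^+ j * nrm (hsip H) (rho (free_vec 0))) ^+ 2.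
  by rewrite lerXn2r ?nnegrE ?mulr_ge0 ?nrm_ge0.
rewrite exprMn; have : 0 < eta ^+ 2 by rewrite exprn_gt0.
lra.
Qed.

End limit.
End approximate_representations.

(** * Uniform gap and almost intertwiners *)

Section rigidity.
Variables (R : realType) (G : groupType) (p : nat) (s : 'I_p -> G) (q : R).
Hypothesis p0 : (0 < p)%N.
Hypothesis gen : forall g, exists w, word_val s w = g.
Hypothesis Gc : countable [set: G].
Hypothesis q01 : 0 <= q < 1.
Hypothesis gap : forall (H : hilbert R) (pi : G -> H -> H) (xi : H), unitary_rep pi ->
      nrm (hsip H) (rep_lazy pi s (xi - rep_lazy pi s xi)) <=
      q * nrm (hsip H) (xi - rep_lazy pi s xi).

Lemma approx_rep_le N N' n (U : 'I_p -> 'M[R[i]]_n) : (N <= N')%N ->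
  approx_rep s N' U -> approx_rep s N U.
Proof.
move=> NN' aU w sw w1; apply: le_trans (aU w (leq_trans sw NN') w1) _.
by rewrite lef_pV2 ?posrE ?ltr0n // ler_nat ltnS.
Qed.

(** The length of the step from the iterate of index [j] of the identity to the next one. *)
Definition residual n (U V : 'I_p -> 'M[R[i]]_n) j : R :=
  nrm (mx_sip R n) (iter j (conj_lazy U V) (1%:M - conj_lazy U V 1%:M)).

(** Counterexamples for every [N], in dimensions that may vary with [N], form a sequence to which
    [limit_gap] applies, a contradiction. *)
Lemma uniform_gap1 j (eta : R) : 0 < eta ->
  exists N, forall n (U V : 'I_p -> 'M[R[i]]_n), unitary_tuple U -> unitary_tuple V ->
    approx_rep s N U -> approx_rep s N V ->
    residual U V j <= q ^+ j * residual U V 0 + eta.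
Proof.
move=> eta0; apply: contrapT => no.
have : forall N, exists x : {n : nat & (('I_p -> 'M[R[i]]_n) * ('I_p -> 'M[R[i]]_n))%type},
    [/\ unitary_tuple (projT2 x).1, unitary_tuple (projT2 x).2,
        approx_rep s N (projT2 x).1, approx_rep s N (projT2 x).2 &
        q ^+ j * residual (projT2 x).1 (projT2 x).2 0 + eta < residual (projT2 x).1 (projT2 x).2 j].
  move=> N; apply: contrapT => no2; apply: no; exists N => n U V Uu Vu aU aV.
  rewrite leNgt; apply/negP => lt; apply: no2.
  exists (existT _ n (U, V)); split; [exact: Uu|exact: Vu|exact: aU|exact: aV|exact: lt].
move=> /choice[f fP].
have [F [FU Ff]] := free_ultrafilter.
have [k] := @limit_gap R G p s (fun k => projT1 (f k)) (fun k => (projT2 (f k)).1)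
  (fun k => (projT2 (f k)).2) (fun k => let: And5 h _ _ _ _ := fP k in h)
  (fun k => let: And5 _ h _ _ _ := fP k in h) (fun k => let: And5 _ _ h _ _ := fP k in h)
  (fun k => let: And5 _ _ _ h _ := fP k in h) F FU Ff gen Gc q q01 gap j eta eta0.
by have [_ _ _ _] := fP k; rewrite ltNge => /negP h /h.
Qed.

Lemma uniform_gap m (eta : R) : 0 < eta ->
  exists N, forall n (U V : 'I_p -> 'M[R[i]]_n), unitary_tuple U -> unitary_tuple V ->
    approx_rep s N U -> approx_rep s N V ->
    forall j, (j <= m)%N -> residual U V j <= q ^+ j * residual U V 0 + eta.
Proof.
move=> eta0; elim: m => [|m [N hN]].
  exists 0%N => n U V _ _ _ _ j; rewrite leqn0 => /eqP ->.
  by rewrite expr0 mul1r lerDl ltW.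
have [N' hN'] := uniform_gap1 m.+1 eta0.
exists (maxn N N') => n U V Uu Vu aU aV j; rewrite leq_eqVlt => /orP[/eqP ->|jm].
  by apply: hN' => //; [exact: approx_rep_le (leq_maxr N N') aU|exact: approx_rep_le (leq_maxr N N') aV].
by apply: hN jm => //; [exact: approx_rep_le (leq_maxl N N') aU|exact: approx_rep_le (leq_maxl N N') aV].
Qed.

Lemma residual0_le n (U V : 'I_p -> 'M[R[i]]_n) (e : R) :
  unitary_tuple U -> unitary_tuple V ->
  (forall i, nrm (mx_sip R n) (U i - V i) <= e) -> residual U V 0 <= e.
Proof.
move=> Uu Vu UVe; rewrite /residual /= /conj_lazy lazy_complement nrmZ normc_real ger0_norm ?invr_ge0 //.
have e0 : 0 <= e by apply: le_trans (nrm_ge0 _ _) (UVe (Ordinal p0)).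
have pr : 0 < 2 * p%:R :> R by rewrite mulr_gt0 // ltr0n.
have -> : (1%:M : 'M[R[i]]_n) - avg (conj_al U V) (conj_be U V) 1%:M =
   ((2 * p%:R)^-1 : R)%:C%C *:
     \sum_i ((1%:M - conj_al U V i 1%:M) + (1%:M - conj_be U V i 1%:M)).
  have -> : \sum_i ((1%:M - conj_al U V i 1%:M) + (1%:M - conj_be U V i 1%:M)) =
      \sum_i ((1%:M + 1%:M) - (conj_al U V i 1%:M + conj_be U V i 1%:M)) :> 'M[R[i]]_n.
    by apply: eq_bigr => i _; rewrite addrACA -opprD.
  rewrite sumrB sumr_const card_ord scalerBr /avg; congr (_ - _).
  rewrite -mulr2n -mulrnA -(scaler_nat _ (1%:M : 'M[R[i]]_n)) scalerA -[LHS]scale1r; congr (_ *: _).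
  have -> : ((2 * p)%:R : R[i]) = (2 * p%:R : R)%:C%C by rewrite -natrM rmorph_nat.
  by rewrite -rmorphM /= mulVf ?gt_eqF.
rewrite nrmZ normc_real ger0_norm ?invr_ge0 ?(ltW pr) //.
have h : nrm (mx_sip R n) (\sum_i ((1%:M - conj_al U V i 1%:M) + (1%:M - conj_be U V i 1%:M)))
    <= 2 * p%:R * e.
  apply: le_trans (nrm_sum _ _ _ _) _.
  apply: (@le_trans _ _ (\sum_(i < p) (2 * e))); last first.
    by rewrite sumr_const card_ord -mulr_natr le_eqVlt; apply/orP; left; apply/eqP; ring.
  apply: ler_sum => i _; apply: le_trans (nrmD _ _ _) _; rewrite mulrDl mul1r; apply: lerD.
    by rewrite nrmBC conj_displacement // mx1r mx1l.
  rewrite nrmBC; have -> : conj_be U V i 1%:M - 1%:M = mxadj (U i) *m (V i - U i).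
    by rewrite /conj_be mx1r mxBr (unitarymxVl (Uu i)).
  by rewrite (m2_mulUl _ (unitarymx_trC (Uu i))) nrmBC.
apply: le_trans (_ : 2^-1 * e <= _); last by lra.
by rewrite ler_wpM2l // mulrC ler_pdivrMr // mulrC.
Qed.

Lemma expr_small (x : R) : 0 < x -> exists m, q ^+ m <= x.
Proof.
move=> x0; case/andP: q01 => q0 q1.
have /cvgrPdist_lt/(_ _ x0) [N _ hN] : (fun m => q ^+ m) @ \oo --> (0 : R).
  by apply: cvg_expr; rewrite ger0_norm.
exists N; have := hN N (leqnn N); rewrite /= sub0r normrN ger0_norm ?exprn_ge0 //.
exact: ltW.
Qed.

(* [W] is a high iterate of [conj_lazy U V] applied to the identity. *)
Theorem almost_intertwiner (d : R) : 0 < d ->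
  exists N, forall n (U V : 'I_p -> 'M[R[i]]_n) (e : R), unitary_tuple U -> unitary_tuple V ->
    approx_rep s N U -> approx_rep s N V ->
    (forall i, nrm (mx_sip R n) (U i - V i) <= e) ->
    exists2 W : 'M[R[i]]_n, nrm (mx_sip R n) (W - 1%:M) <= (1 - q)^-1 * e + d &
      forall i, nrm (mx_sip R n) (U i *m W - W *m V i) <= d.
Proof.
move=> d0; case/andP: (q01) => q0 q1.
have pr : 0 < 4 * p%:R :> R by rewrite mulr_gt0 // ltr0n.
have x0 : 0 < d ^+ 2 / (4 * p%:R) / 4 by rewrite !divr_gt0 // exprn_gt0.
have [m qm] := expr_small x0.
(* The first bound keeps the sum of [m] errors below [d]. The second, with the bound 2 on the
   initial residual and the choice of [m], makes the last residual at most [d ^+ 2 / (4 * p%:R)],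
   which [displacement_sqr_le] turns into an intertwining error [d]. *)
pose eta := Num.min (d / m.+1%:R) (d ^+ 2 / (4 * p%:R) / 2).
have eta0 : 0 < eta by rewrite lt_min !divr_gt0 ?ltr0n ?exprn_gt0.
have [N hN] := uniform_gap m eta0.
exists N => n U V e Uu Vu aU aV UVe.
have r0 := residual0_le Uu Vu UVe.
have rj := hN n U V Uu Vu aU aV.
pose al_lin := @conj_al_lin R n p U V; pose be_lin := @conj_be_lin R n p U V.
pose al_iso := conj_al_iso Uu Vu; pose be_iso := conj_be_iso Uu Vu.
pose T := conj_lazy U V; pose W j := iter j T (1%:M : 'M[R[i]]_n).
have WB j : nrm (mx_sip R n) (W j - W j.+1) = residual U V j.
  by rewrite /residual (iter_lazyB al_lin be_lin).
have e0 : 0 <= e by apply: le_trans (nrm_ge0 _ _) (UVe (Ordinal p0)).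
exists (W m).
- have sumW k : (k <= m)%N -> nrm (mx_sip R n) (W k - 1%:M) <= \sum_(j < k) (q ^+ j * e + eta).
    elim: k => [|k IH] km; first by rewrite big_ord0 /W /= subrr nrm0.
    rewrite big_ord_recr /=; apply: le_trans (nrm_dist _ (W k) _ _) _.
    rewrite addrC lerD ?IH 1?ltnW // nrmBC WB.
    apply: le_trans (rj k (ltnW km)) _; rewrite lerD2r ler_wpM2l ?exprn_ge0 //.
  apply: le_trans (sumW m (leqnn m)) _; rewrite big_split /= -mulr_suml lerD //.
    rewrite ler_wpM2r // -[leRHS]mul1r ler_pdivlMr ?subr_gt0 //.
    have E := subrX1 q m; have qm0 : 0 <= q ^+ m by rewrite exprn_ge0.
    move: E; set S := \sum_(i < m) _ => E.
    have -> : S * (1 - q) = - ((q - 1) * S) by ring.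
    by rewrite -E opprB; lra.
  rewrite sumr_const card_ord -mulr_natr.
  have : eta <= d / m.+1%:R by rewrite ge_min lexx.
  rewrite ler_pdivlMr ?ltr0n // => h; apply: le_trans h.
  by rewrite ler_wpM2l ?(ltW eta0) // ler_nat.
- move=> i; rewrite -(conj_displacement U Vu) -ler_sqr ?nnegrE ?nrm_ge0 ?(ltW d0) //.
  have h := displacement_sqr_le p0 al_iso (@conj_adj R n p U V) (W m) i.
  apply: le_trans h _; rewrite -[lazy _ _ (W m)]/(W m.+1) WB.
  have W1 : nrm (mx_sip R n) (W m) <= 1.
    rewrite /W; elim: m {qm eta eta0 hN rj WB} => [|k IH]; first exact: m2_1_le.
    by rewrite iterS; apply: le_trans IH; exact: (nrm_lazy p0 al_iso be_iso).
  have r2 : residual U V 0 <= 2.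
    rewrite /residual /=; apply: le_trans (nrmB _ _ _) _.
    have h1 := m2_1_le R n; have h2 := nrm_lazy p0 al_iso be_iso 1%:M.
    by rewrite -/T in h2; apply: le_trans (lerD h1 (le_trans h2 h1)) _.
  have rm : residual U V m <= d ^+ 2 / (4 * p%:R).
    have h1 : eta <= d ^+ 2 / (4 * p%:R) / 2 by rewrite ge_min lexx orbT.
    have h2 : q ^+ m * residual U V 0 <= d ^+ 2 / (4 * p%:R) / 4 * 2.
      by apply: ler_pM => //; [exact: exprn_ge0|exact: nrm_ge0].
    have h3 := rj m (leqnn m); clear -h1 h2 h3; move: h1 h2 h3; set x := d ^+ 2 / _.
    by move=> h1 h2 h3; apply: le_trans h3 _; apply: le_trans (lerD h2 h1) _; lra.
  apply: le_trans (ler_wpM2l _ W1) _.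
    by rewrite mulr_ge0 ?(ltW pr) // nrm_ge0.
  by rewrite mulr1 mulrC -ler_pdivlMr.
Qed.

End rigidity.

(** * Covering almost representations up to conjugacy *)

Section cells.
Variable X : Type.
Implicit Types (P : X -> Prop) (r : X -> X -> Prop).

(* [P] splits into at most [K] classes, each of which is an [r]-clique. *)
Definition cells P r (K : nat) := exists c : X -> nat,
  (forall x, P x -> (c x < K)%N) /\ forall x y, P x -> P y -> c x = c y -> r x y.

End cells.

Lemma radix_inj K x y x' y' : (y < K)%N -> (y' < K)%N ->
  (x * K + y = x' * K + y')%N -> x = x' /\ y = y'.
Proof.
move=> yK y'K E; have K0 : (0 < K)%N by apply: leq_ltn_trans yK.
split.
  by have := congr1 (divn ^~ K) E; rewrite /= !divnMDl // !divn_small // !addn0.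
by have := congr1 (modn ^~ K) E; rewrite /= !modnMDl !modn_small.
Qed.

Lemma radix_lt K A x y : (x < A)%N -> (y < K)%N -> (x * K + y < A * K)%N.
Proof.
move=> xA yK; apply: (@leq_trans (x.+1 * K)); last by rewrite leq_mul2r xA orbT.
by rewrite mulSn addnC ltn_add2r.
Qed.

(** * Counting integer points in a ball *)

Section lattice_code.
Variables (R : realType) (I : finType) (M : nat).
Local Notation T := {ffun I -> bool * 'I_M.+1}.

Definition lattice_small : {set T} := [set f : T | (\sum_i (f i).2 <= M)%N]%SET.

Lemma geo_half m : \sum_(j < m) (2^-1 : R) ^+ j <= 2.
Proof.
have E := subrX1 (2^-1 : R) m; have : 0 <= (2^-1 : R) ^+ m by rewrite exprn_ge0 // invr_ge0.
move: E; set S := \sum_(j < m) _; lra.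
Qed.

(* Chernoff: weight a function [f] by [2 ^ - \sum_i f i]. *)
Lemma card_lattice_small : (#|lattice_small| <= 2 ^ M * 4 ^ #|I|)%N.
Proof.
pose w (x : bool * 'I_M.+1) : R := (2^-1) ^+ (nat_of_ord x.2).
have w0 x : 0 <= w x by rewrite exprn_ge0 // invr_ge0.
have total : \sum_(f : T) \prod_i w (f i) <= 4 ^+ #|I|.
  rewrite -(bigA_distr_bigA (fun _ => w)) /=.
  (* Each coordinate contributes two signs times a geometric series bounded by 2. *)
  apply: (@le_trans _ _ (\prod_(i : I) 4)); last by rewrite prodr_const.
  apply: ler_prod => i _; apply/andP; split; first exact: sumr_ge0.
  rewrite -(pair_bigA _ (fun b j => w (b, j))) /= big_bool /=.
  have := geo_half M.+1; rewrite /w /=; lra.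
have lower : #|lattice_small|%:R * (2^-1) ^+ M <= \sum_(f : T) \prod_i w (f i).
  rewrite [leRHS](bigID (mem lattice_small)) /= -[leLHS]addr0 lerD //; last first.
    by apply: sumr_ge0 => f _; exact: prodr_ge0.
  rewrite mulr_natl -sumr_const; apply: ler_sum => f; rewrite inE => fM.
  rewrite /w prodrXr.
  by rewrite ler_wiXn2l // ?invr_ge0 // invf_le1 // ler1n.
have := le_trans lower total; rewrite exprVn ler_pdivrMr ?exprn_gt0 //.
by rewrite -!natrX -natrM ler_nat mulnC.
Qed.

(** Sign and integer part of each coordinate; [inord] does not truncate as long as the squares sum
    to at most [M]. *)
Definition lattice_round (x : I -> R) : T :=
  [ffun i => (0 <= x i, inord (Num.truncn `|x i|))].

Definition lattice_code (x : I -> R) : nat := index (lattice_round x) (enum lattice_small).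

(** Since k <= k^2 for natural k, a Euclidean bound on [x] becomes an l^1 bound on the rounded
    vector, which is what [lattice_small] counts. *)
Lemma truncn_sqr_le (x : R) : (Num.truncn `|x|)%:R <= x ^+ 2.
Proof.
have := truncn_le `|x|; rewrite normr_ge0; set k := Num.truncn _ => kx.
rewrite -real_normK ?num_real //; apply: (@le_trans _ _ (k%:R ^+ 2)); last first.
  by rewrite lerXn2r ?nnegrE ?ler0n ?normr_ge0 ?kx.
by rewrite -natrX ler_nat; case: (k) => // m; rewrite expnS expn1 leq_pmulr.
Qed.

Lemma sqr_sum_term (x : I -> R) i : x i ^+ 2 <= \sum_j x j ^+ 2.
Proof. by rewrite (bigD1 i) //= lerDl sumr_ge0 // => j _; exact: sqr_ge0. Qed.

Lemma lattice_round_snd (x : I -> R) i : \sum_j x j ^+ 2 <= M%:R ->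
  (lattice_round x i).2 = Num.truncn `|x i| :> nat.
Proof.
move=> xM; rewrite ffunE /= inordK // ltnS -(ler_nat R).
by apply: le_trans (truncn_sqr_le _) _; apply: le_trans xM; exact: sqr_sum_term.
Qed.

Lemma lattice_round_small (x : I -> R) : \sum_j x j ^+ 2 <= M%:R ->
  lattice_round x \in lattice_small.
Proof.
move=> xM; rewrite inE -(ler_nat R) natr_sum; apply: le_trans (xM).
by apply: ler_sum => i _; rewrite (lattice_round_snd i xM); exact: truncn_sqr_le.
Qed.

Lemma lattice_code_lt (x : I -> R) : \sum_j x j ^+ 2 <= M%:R ->
  (lattice_code x < 2 ^ M * 4 ^ #|I|)%N.
Proof.
move=> xM; apply: leq_trans card_lattice_small; rewrite cardE index_mem mem_enum.
exact: lattice_round_small.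
Qed.

Lemma lattice_code_eq (x y : I -> R) : \sum_j x j ^+ 2 <= M%:R -> \sum_j y j ^+ 2 <= M%:R ->
  lattice_code x = lattice_code y -> forall i, `|x i - y i| <= 1.
Proof.
move=> xM yM cxy i.
have E : lattice_round x = lattice_round y.
  have xin := lattice_round_small xM; have yin := lattice_round_small yM.
  rewrite -(nth_index (lattice_round x) (s := enum lattice_small) (x := lattice_round x)) ?mem_enum //.
  by rewrite -/(lattice_code x) cxy nth_index // mem_enum.
have E1 : (0 <= x i) = (0 <= y i).
  by have := congr1 (fun f : T => (f i).1) E; rewrite !ffunE.
have E2 : Num.truncn `|x i| = Num.truncn `|y i|.
  by rewrite -(lattice_round_snd i xM) -(lattice_round_snd i yM) E.
have /andP[x1 x2] := truncn_itv (normr_ge0 (x i)).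
have /andP[] := truncn_itv (normr_ge0 (y i)); rewrite -E2 => y1 y2.
move: x1 x2 y1 y2; rewrite -natr1; set k := (Num.truncn _)%:R => x1 x2 y1 y2.
rewrite ler_norml; move: E1 x1 x2 y1 y2.
by case: (ger0P (x i)) => hx; case: (ger0P (y i)) => hy //; lra.
Qed.

End lattice_code.

Lemma sum_prod (R : realType) (I J : finType) (F : I * J -> R) :
  \sum_x F x = \sum_i \sum_j F (i, j).
Proof. by rewrite pair_bigA; apply: eq_bigr => -[]. Qed.

(** * Coordinates of the part of a defect on small singular values *)

Section orbit_cells.
Variables (R : realType) (p n : nat).
Hypothesis n0 : (0 < n)%N.
Local Notation M := 'M[R[i]]_n.
Local Notation m2 := (nrm (mx_sip R n)).
Implicit Types (U V : 'I_p -> M) (J : {set 'I_n}).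

Definition orb (e : R) U V := exists2 Z : M, Z \is unitarymx &
  forall s, m2 (U s - Z *m V s *m Z^H) <= e.

Definition corner_entry (B : 'I_p -> M) (Q : M) (o : option 'I_p) (i j : 'I_n) : R[i] :=
  if o is Some s then B s i j else Q j i.

(* The real coordinates of the columns in [J] of the matrices [B s] and of the
   rows in [J] of [Q], rescaled by [l]. *)
Definition corner_coords (l : R) (J : {set 'I_n}) (B : 'I_p -> M) (Q : M)
    (x : 'I_n * {j | j \in J} * bool * option 'I_p) : R :=
  let: (i, j, b, o) := x in
  let z := corner_entry B Q o i (val j) in
  l * (if b then Re z else Im z).

Arguments corner_coords : clear implicits.

Lemma card_corner J :
  #|{: 'I_n * {j | j \in J} * bool * option 'I_p}| = (n * #|J| * 2 * p.+1)%N.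
Proof. by rewrite !card_prod card_ord card_sig card_bool card_option card_ord. Qed.

Lemma sum_sig_set J (F : 'I_n -> R) : \sum_(j : {j | j \in J}) F (val j) = \sum_(j in J) F j.
Proof.
rewrite [RHS](reindex_omap (val : {j | j \in J} -> 'I_n) insub) => [|j jJ]; last first.
  by rewrite insubT.
by apply: eq_big => [j|//]; rewrite (valP j) valK eqxx.
Qed.

Lemma sum_corner l J B Q :
  \sum_x corner_coords l J B Q x ^+ 2 =
  l ^+ 2 * (\sum_s \sum_(j in J) \sum_i normc (B s i j) ^+ 2 +
            \sum_(j in J) \sum_i normc (Q j i) ^+ 2).
Proof.
pose z := corner_entry B Q.
have E : \sum_x corner_coords l J B Q x ^+ 2 =
    \sum_(o : option 'I_p) \sum_(j in J) \sum_i l ^+ 2 * normc (z o i j) ^+ 2.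
  rewrite sum_prod exchange_big /=; apply: eq_bigr => o _.
  rewrite sum_prod sum_prod exchange_big /=.
  rewrite -(sum_sig_set J (fun j => \sum_i l ^+ 2 * normc (z o i j) ^+ 2)).
  apply: eq_bigr => j _; apply: eq_bigr => i _.
  by rewrite big_bool /= normc_sqr -/(z o i (val j)) mulrDr !exprMn.
rewrite E (bigD1 None) //= addrC mulrDr !mulr_sumr; congr (_ + _).
  rewrite (reindex_omap Some id) => [|[s|] //]; apply: eq_big => [s|s _]; first by rewrite eqxx.
  by rewrite mulr_sumr; apply: eq_bigr => j _; rewrite mulr_sumr.
by apply: eq_bigr => j _; rewrite mulr_sumr.
Qed.

Lemma corner_close l J B Q B' Q' : 0 < l ->
  (forall x, `|corner_coords l J B Q x - corner_coords l J B' Q' x| <= 1) ->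
  forall o i j, j \in J ->
  normc (corner_entry B Q o i j - corner_entry B' Q' o i j) ^+ 2 <= 2 / l ^+ 2.
Proof.
move=> l0 h o i j jJ.
have hb b : `|corner_coords l J B Q (i, exist _ j jJ, b, o) -
              corner_coords l J B' Q' (i, exist _ j jJ, b, o)| <= 1 by exact: h.
have hb2 (x y : R) : `|l * x - l * y| <= 1 -> (x - y) ^+ 2 <= (l ^+ 2)^-1.
  rewrite -mulrBr normrM gtr0_norm // mulrC -ler_pdivlMr // div1r => le.
  by rewrite -real_normK ?num_real // -exprVn lerXn2r ?nnegrE ?invr_ge0 ?(ltW l0).
have := hb2 _ _ (hb true); have := hb2 _ _ (hb false); rewrite /corner_coords /=.
by rewrite normc_sqr ReB raddfB /=; lra.
Qed.

End orbit_cells.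

Arguments corner_coords {R p n} l J B Q x.

Section corner_estimates.
Variables (R : realType) (p n : nat).
Hypothesis n0 : (0 < n)%N.
Local Notation M := 'M[R[i]]_n.
Local Notation m2 := (nrm (mx_sip R n)).
Implicit Types (U V : 'I_p -> M) (J : {set 'I_n}).

Lemma unitary_col (X : M) j : X \is unitarymx -> \sum_i normc (X i j) ^+ 2 = 1.
Proof.
move=> Xu; have := congr1 (fun Y : M => Re (Y j j)) (unitarymxVl Xu).
rewrite !mxE eqxx /= Re_sum => <-; apply: eq_bigr => i _.
by rewrite mxadjE mulrC mul_conjE.
Qed.

Lemma unitary_row (X : M) j : X \is unitarymx -> \sum_i normc (X j i) ^+ 2 = 1.
Proof.
move=> Xu; rewrite -(unitary_col j (unitarymx_trC Xu)); apply: eq_bigr => i _.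
by rewrite -/(mxadj X) mxadjE normc_conj.
Qed.

Lemma unitary_sub_col (X Y : M) j : X \is unitarymx -> Y \is unitarymx ->
  \sum_i normc ((X - Y) i j) ^+ 2 <= 4.
Proof.
move=> Xu Yu; apply: (@le_trans _ _ (\sum_i (2 * normc (X i j) ^+ 2 + 2 * normc (Y i j) ^+ 2))).
  by apply: ler_sum => i _; rewrite mx_subE -[normc (Y i j)]normcN; exact: normc_sqrD.
by rewrite big_split /= -!mulr_sumr !unitary_col //; lra.
Qed.

Lemma m2_corner (X : M) J (x : R) :
  (forall i j, normc (X i j) ^+ 2 <= (j \in J)%:R * x) -> m2 X <= Num.sqrt (#|J|%:R * x).
Proof.
move=> Xx; rewrite -[leLHS]ger0_norm ?nrm_ge0 // -sqrtr_sqr ler_wsqrtr // m2_sqr.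
rewrite mulrC ler_pdivrMr ?ltr0n //.
apply: (@le_trans _ _ (\sum_(i < n) \sum_(j < n) (j \in J)%:R * x)).
  by apply: ler_sum => i _; apply: ler_sum => j _.
have cJ : (\sum_(j < n) (j \in J) = #|J|)%N.
  by rewrite -sum1_card [RHS]big_mkcond; apply: eq_bigr => j _; case: (j \in J).
by rewrite sumr_const card_ord -mulr_suml -natr_sum cJ mulr_natr.
Qed.

(** The factor 3 is 2 + 1: [B] is a difference of two unitaries, so multiplication by it at most
    doubles a 2-norm, and multiplication by [Q'] preserves it. Since [col_proj] stands between the
    factors, only columns of [B] and rows of [Q] indexed by [J] matter. *)
Lemma corner_dist J (B B' X Y Q Q' : M) (x : R) :
  [/\ X \is unitarymx, Y \is unitarymx, Q \is unitarymx & Q' \is unitarymx] ->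
  B = X - Y -> 0 <= x ->
  (forall i j, j \in J -> normc (B i j - B' i j) ^+ 2 <= x) ->
  (forall i j, j \in J -> normc (Q j i - Q' j i) ^+ 2 <= x) ->
  m2 (B *m col_proj R J *m Q - B' *m col_proj R J *m Q') <= 3 * Num.sqrt (#|J|%:R * x).
Proof.
move=> [Xu Yu Qu Q'u] BE x0 hB hQ; set E := col_proj R J.
have EE : E *m E = E.
  by rewrite /E /col_proj rdiagM; congr rdiag; apply/funext => j; case: (j \in J); rewrite ?mulr1 ?mulr0.
have -> : B *m E *m Q - B' *m E *m Q' = B *m (E *m (Q - Q')) + (B - B') *m E *m Q'.
  rewrite !mxBr !mxBl !mxA addrA subrK //.
have h1 : m2 ((B - B') *m E *m Q') <= Num.sqrt (#|J|%:R * x).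
  rewrite (m2_mulUr _ Q'u); apply: m2_corner => i j.
  rewrite /E /col_proj mul_rdiag_r mx_subE; case: (boolP (j \in J)) => jJ.
    by rewrite mulr1 mul1r; exact: hB.
  by rewrite mulr0 normc0 expr0n mul0r.
have h2 : m2 (E *m (Q - Q')) <= Num.sqrt (#|J|%:R * x).
  rewrite -m2_trC; apply: m2_corner => i j; rewrite mxadjE normc_conj.
  rewrite /E /col_proj mul_rdiag_l mx_subE; case: (boolP (j \in J)) => jJ.
    by rewrite !mul1r; exact: hQ.
  by rewrite mul0r normc0 expr0n mul0r.
have h3 : m2 (B *m (E *m (Q - Q'))) <= 2 * m2 (E *m (Q - Q')).
  rewrite BE mxBl; apply: le_trans (nrmB _ _ _) _.
  by rewrite (m2_mulUl _ Xu) (m2_mulUl _ Yu) mulrDl !mul1r.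
apply: le_trans (nrmD _ _ _) _; apply: le_trans (lerD h3 h1) _.
by apply: le_trans (lerD (ler_wpM2l _ h2) (lexx _)) _ => //; lra.
Qed.
End corner_estimates.

(** * Refining a cover by a factor of two *)

Section step.
Variables (R : realType) (G : groupType) (p : nat) (s : 'I_p -> G) (q : R).
Hypothesis q01 : 0 <= q < 1.
Variables (N : nat) (d : R).
Hypothesis d0 : 0 < d.

Definition good n (U : 'I_p -> 'M[R[i]]_n) := unitary_tuple U /\ approx_rep s N U.

Hypothesis close : forall n (U V : 'I_p -> 'M[R[i]]_n) (e : R), good U -> good V ->
    (forall i, nrm (mx_sip R n) (U i - V i) <= e) ->
    exists2 W : 'M[R[i]]_n, nrm (mx_sip R n) (W - 1%:M) <= (1 - q)^-1 * e + d &
      forall i, nrm (mx_sip R n) (U i *m W - W *m V i) <= d.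

Variable n : nat.
Hypothesis n0 : (0 < n)%N.
Local Notation M := 'M[R[i]]_n.
Local Notation m2 := (nrm (mx_sip R n)).
Implicit Types (U V : 'I_p -> M) (J : {set 'I_n}).

Lemma word_mx_conjugate (Y : M) U w : Y \is unitarymx ->
  word_mx (fun i => Y^H *m U i *m Y) w = Y^H *m word_mx U w *m Y.
Proof.
move=> Yu; elim: w => [|l w IH]; first by rewrite /= mx1r (unitarymxVl Yu).
rewrite /= IH; have -> : letter_mx (fun i => Y^H *m U i *m Y) l = Y^H *m letter_mx U l *m Y.
  by rewrite /letter_mx; case: l.2 => //; rewrite !trCM trCK mxA.
have -> : forall A B C D E F : M, A *m B *m C *m (D *m E *m F) = A *m B *m (C *m D) *m E *m F.
  by move=> A B C D E F; rewrite !mxA.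
by rewrite (unitarymxVr Yu) mx1r (mxA (Y^H)).
Qed.

Lemma good_conjugate (Y : M) U : Y \is unitarymx -> good U -> good (fun i => Y^H *m U i *m Y).
Proof.
move=> Yu [Uu aU]; split=> [i|w sw w1].
  exact: (unitM (unitM (unitarymx_trC Yu) (Uu i)) Yu).
rewrite word_mx_conjugate // ntrC mxA (unitarymxVr Yu) mx1l; exact: aU.
Qed.

Definition compare_defect (Z : M) U V i : M := Z *m U i *m Z^H - V i.

(** Conjugation by the unitary of [orb] brings the tuples within [e] of each other, so [close] and
    [intertwiner_defect] apply. With C for [(1 - q)^-1], the distance of [W] to 1 plus [d] is at
    most 2 C e, as 2 d <= C e; hence the bound 4 n (2 C e)^2 on [#|J|]. *)
Lemma orb_defect (e : R) U V : 0 < e -> 96 * d <= e -> good U -> good V -> orb e U V ->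
  exists x : M * M * {set 'I_n},
  [/\ x.1.1 \is unitarymx, x.1.2 \is unitarymx,
      #|x.2|%:R <= 16 * ((1 - q)^-1) ^+ 2 * e ^+ 2 * n%:R &
      forall i, m2 (compare_defect x.1.1 U V i -
        compare_defect x.1.1 U V i *m (x.1.2)^H *m col_proj R x.2 *m x.1.2) <= 12 * d].
Proof.
move=> e0 de gU gV [Y Yu UYV].
have gU' := good_conjugate Yu gU.
have UV' i : m2 (Y^H *m U i *m Y - V i) <= e.
  rewrite -(m2_mulUl _ Yu) -(m2_mulUr _ (unitarymx_trC Yu)).
  have -> : Y *m (Y^H *m U i *m Y - V i) *m Y^H = U i - Y *m V i *m Y^H; last exact: UYV.
  rewrite mxBr mxBl; congr (_ - _).
  have -> : Y *m (Y^H *m U i *m Y) *m Y^H = (Y *m Y^H) *m U i *m (Y *m Y^H) by rewrite !mxA.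
  by rewrite (unitarymxVr Yu) mx1l mx1r.
have [W W1 UW] := close gU' gV UV'.
have [Z [Q [J [Zu Qu cJ df]]]] := intertwiner_defect d0 gU'.1 gV.1 UW.
have Z'u : Z *m Y^H \is unitarymx by exact: (unitM Zu (unitarymx_trC Yu)).
exists (Z *m Y^H, Q, J); split => /=; [exact: Z'u|exact: Qu| |].
- apply: le_trans cJ _.
  have C1 : 1 <= (1 - q)^-1 by case/andP: q01 => q0 q1; rewrite invf_ge1 ?subr_gt0 // gerBl.
  have Ce : e <= (1 - q)^-1 * e by rewrite ler_peMl // ltW.
  have le2 : m2 (W - 1%:M) + d <= 2 * ((1 - q)^-1 * e).
    by apply: le_trans (lerD W1 (lexx _)) _; lra.
  have : (m2 (W - 1%:M) + d) ^+ 2 <= (2 * ((1 - q)^-1 * e)) ^+ 2.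
    by rewrite lerXn2r ?nnegrE ?addr_ge0 ?nrm_ge0 ?(ltW d0) // (le_trans _ le2) // addr_ge0 ?nrm_ge0 ?(ltW d0).
  move=> h; have h2 := ler_wpM2l (ler0n R n) h; rewrite !exprMn in h2.
  apply: le_trans (ler_wpM2l _ h2) _ => //; rewrite le_eqVlt; apply/orP; left; apply/eqP; ring.
- move=> i; have := df i.
  have -> : Z *m (Y^H *m U i *m Y) *m Z^H = Z *m Y^H *m U i *m (Z *m Y^H)^H.
    by rewrite trCM trCK !mxA.
  rewrite -/(compare_defect (Z *m Y^H) U V i); move: (compare_defect _ _ _ _) => D.
  by rewrite !mxA.
Qed.

End step.

Section step.
Variables (R : realType) (G : groupType) (p : nat) (s : 'I_p -> G) (q : R).
Hypothesis q01 : 0 <= q < 1.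
Variables (N : nat) (d : R).
Hypothesis d0 : 0 < d.
Hypothesis close : forall n (U V : 'I_p -> 'M[R[i]]_n) (e : R), good s N U -> good s N V ->
    (forall i, nrm (mx_sip R n) (U i - V i) <= e) ->
    exists2 W : 'M[R[i]]_n, nrm (mx_sip R n) (W - 1%:M) <= (1 - q)^-1 * e + d &
      forall i, nrm (mx_sip R n) (U i *m W - W *m V i) <= d.
Variable tau : nat.
Hypothesis tauC : 4608 * ((1 - q)^-1) ^+ 2 <= tau%:R.
Variable n : nat.
Hypothesis n0 : (0 < n)%N.
Local Notation M := 'M[R[i]]_n.
Local Notation m2 := (nrm (mx_sip R n)).
Implicit Types (U V : 'I_p -> M) (J : {set 'I_n}).

Let C0 : 0 < (1 - q)^-1. Proof. by case/andP: q01 => _ q1; rewrite invr_gt0 subr_gt0. Qed.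
Let tau0 : 0 < tau%:R :> R.
Proof. by apply: lt_le_trans tauC; apply: mulr_gt0; [by rewrite ltr0n|exact: exprn_gt0]. Qed.
(** Bits per unit of [n * #|J|]: the factor [2 ^ M] of the lattice count gives [tau * (4 * p).+1],
    and two bits for each of the [2 * p.+1] real coordinates give the rest. *)
Definition code_exponent := (tau * (4 * p).+1 + 4 * p.+1)%N.

(** A mesh of order [1 / sqrt n] per entry is a fixed Euclidean accuracy on a column, so the
    logarithm of the count is proportional to [n * #|J|]. *)
Let lam : R := Num.sqrt (tau%:R * n%:R).
Let lam2 : lam ^+ 2 = tau%:R * n%:R. Proof. by rewrite sqr_sqrtr ?mulr_ge0. Qed.
Let lam0 : 0 < lam. Proof. by rewrite sqrtr_gt0 mulr_gt0 // ltr0n. Qed.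

Definition corner_bound (J : {set 'I_n}) := (tau * n * ((4 * p).+1 * #|J|))%N.

(** For each index in [J], a column of each of the [p] defects, being a difference of unitaries, has
    squared norm at most 4, and a row of [Q] has squared norm 1. *)
Lemma corner_sum U V (Z Q : M) J : unitary_tuple U -> unitary_tuple V ->
  Z \is unitarymx -> Q \is unitarymx ->
  \sum_x corner_coords lam J (fun i => compare_defect Z U V i *m Q^H) Q x ^+ 2
    <= (corner_bound J)%:R.
Proof.
move=> Uu Vu Zu Qu; rewrite sum_corner lam2 /corner_bound !natrM ler_wpM2l ?mulr_ge0 //.
rewrite -natr1 mulrDl mul1r; apply: lerD.
  have -> : (4 * p)%:R * #|J|%:R = \sum_(i < p) \sum_(j in J) (4 : R).
    by rewrite !sumr_const card_ord -[RHS]mulr_natr -[4 *+ #|J|]mulr_natr natrM; ring.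
  apply: ler_sum => i _; apply: ler_sum => j _.
  rewrite /compare_defect mxBl; apply: unitary_sub_col.
    exact: (unitM (unitM (unitM Zu (Uu i)) (unitarymx_trC Zu)) (unitarymx_trC Qu)).
  exact: (unitM (Vu i) (unitarymx_trC Qu)).
rewrite -sumr_const; apply: ler_sum => j _; rewrite unitary_row //.
Qed.

Lemma corner_code_lt U V (Z Q : M) J r : unitary_tuple U -> unitary_tuple V ->
  Z \is unitarymx -> Q \is unitarymx -> (#|J| <= r)%N ->
  (lattice_code (corner_bound J)
    (corner_coords lam J (fun i => compare_defect Z U V i *m Q^H) Q)
     < 2 ^ (code_exponent * n * r))%N.
Proof.
move=> Uu Vu Zu Qu Jr.
apply: leq_trans (lattice_code_lt (corner_sum J Uu Vu Zu Qu)) _.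
rewrite card_corner -[4%N]/(2 ^ 2)%N -expnM -expnD leq_exp2l // /corner_bound /code_exponent.
apply: (@leq_trans ((tau * (4 * p).+1 + 4 * p.+1) * n * #|J|)); last by rewrite leq_mul2l Jr orbT.
by rewrite leq_eqVlt; apply/orP; left; apply/eqP; ring.
Qed.

(** Both tuples are compared with the same [V], which cancels in the difference of the two defects.
    Each defect is within [12 * d] of its part on [J], and the equality of codes makes those parts
    close. *)
Lemma code_close (e : R) U U' V (Z Z' Q Q' : M) J : 0 < e -> 96 * d <= e ->
  unitary_tuple U -> unitary_tuple U' -> unitary_tuple V ->
  [/\ Z \is unitarymx, Z' \is unitarymx, Q \is unitarymx & Q' \is unitarymx] ->
  #|J|%:R <= 16 * ((1 - q)^-1) ^+ 2 * e ^+ 2 * n%:R ->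
  (forall i, m2 (compare_defect Z U V i -
        compare_defect Z U V i *m Q^H *m col_proj R J *m Q) <= 12 * d) ->
  (forall i, m2 (compare_defect Z' U' V i -
        compare_defect Z' U' V i *m Q'^H *m col_proj R J *m Q') <= 12 * d) ->
  lattice_code (corner_bound J) (corner_coords lam J (fun i => compare_defect Z U V i *m Q^H) Q) =
  lattice_code (corner_bound J) (corner_coords lam J (fun i => compare_defect Z' U' V i *m Q'^H) Q') ->
  orb (e / 2) U U'.
Proof.
move=> e0 de Uu U'u Vu [Zu Z'u Qu Q'u] cJ df df' ceq.
have cl := lattice_code_eq (corner_sum J Uu Vu Zu Qu) (corner_sum J U'u Vu Z'u Q'u) ceq.
have cc := corner_close lam0 cl.
exists (Z^H *m Z'); first exact: (unitM (unitarymx_trC Zu) Z'u).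
move=> i.
have x0 : 0 <= 2 / lam ^+ 2 by rewrite divr_ge0 // sqr_ge0.
have BE : compare_defect Z U V i *m Q^H = Z *m U i *m Z^H *m Q^H - V i *m Q^H.
  by rewrite /compare_defect mxBl.
have X1 : Z *m U i *m Z^H *m Q^H \is unitarymx.
  exact: (unitM (unitM (unitM Zu (Uu i)) (unitarymx_trC Zu)) (unitarymx_trC Qu)).
have X2 : V i *m Q^H \is unitarymx by exact: (unitM (Vu i) (unitarymx_trC Qu)).
have h := corner_dist n0 (B' := compare_defect Z' U' V i *m Q'^H) (And4 X1 X2 Qu Q'u) BE x0
  (fun a b => cc (Some i) a b) (fun a b => cc None a b).
(* Rounding leaves a squared error at most 2 / (tau n) per complex entry, hence 2 #|J| / (tau n) in
   squared normalized norm. With #|J| <= 16 C^2 e^2 n, where C is [(1 - q)^-1], and tau >= 4608 C^2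
   = 144 * 32 C^2, this is at most (e / 12)^2. *)
have small : 3 * Num.sqrt (#|J|%:R * (2 / lam ^+ 2)) <= e / 4.
  have y : #|J|%:R * (2 / lam ^+ 2) <= (e / 12) ^+ 2.
    rewrite lam2 mulrA ler_pdivrMr; last by rewrite mulr_gt0 // ltr0n.
    apply: (@le_trans _ _ (16 * ((1 - q)^-1) ^+ 2 * e ^+ 2 * n%:R * 2)).
      by rewrite ler_wpM2r.
    move: tauC; set C := (1 - q)^-1 => tC.
    have h2 := ler_wpM2r (ler0n R n) (ler_wpM2l (sqr_ge0 e) tC).
    have -> : 16 * C ^+ 2 * e ^+ 2 * n%:R * 2 = 144^-1 * (e ^+ 2 * (4608 * C ^+ 2) * n%:R) by field.
    have -> : (e / 12) ^+ 2 * (tau%:R * n%:R) = 144^-1 * (e ^+ 2 * tau%:R * n%:R) by field.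
    by rewrite ler_wpM2l.
  have := ler_wsqrtr y; rewrite sqrtr_sqr ger0_norm ?divr_ge0 ?(ltW e0) //; lra.
have -> : m2 (U i - Z^H *m Z' *m U' i *m (Z^H *m Z')^H) =
          m2 (compare_defect Z U V i - compare_defect Z' U' V i).
  have -> : compare_defect Z U V i - compare_defect Z' U' V i =
      Z *m (U i - Z^H *m Z' *m U' i *m (Z^H *m Z')^H) *m Z^H.
    rewrite /compare_defect mxBr mxBl opprB addrA subrK trCM trCK; congr (_ - _).
    have -> : forall A B C D E F : M, A *m (B *m C *m D *m (E *m F)) *m B = (A *m B) *m (C *m D *m E) *m (F *m B).
      by move=> A B C D E F; rewrite !mxA.
    by rewrite (unitarymxVr Zu) mx1l mx1r.
  by rewrite (m2_mulUr _ (unitarymx_trC Zu)) (m2_mulUl _ Zu).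
set F := compare_defect Z U V i *m Q^H *m col_proj R J *m Q in h df.
set F' := compare_defect Z' U' V i *m Q'^H *m col_proj R J *m Q' in h df'.
have t1 := nrm_dist (mx_sip R n) F (compare_defect Z U V i) (compare_defect Z' U' V i).
have t2 := nrm_dist (mx_sip R n) F' F (compare_defect Z' U' V i).
have t3 := df i; have t4 := df' i; rewrite nrmBC in t4.
rewrite -/F in t3; rewrite -/F' in t4.
(* The total error is 12 d + e / 4 + 12 d, at most e / 2 because 96 d <= e. *)
apply: le_trans t1 _; apply: le_trans (lerD t3 (le_trans t2 (lerD (le_trans h small) t4))) _.
lra.
Qed.

(** The new class of [U] records its old class, the set [J] (one of [2 ^ n]) and the rounded
    coordinates of its defect relative to a fixed representative [V] of the old class. *)
Lemma cells_step (e : R) K r : 0 < e -> 96 * d <= e ->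
  (forall m : nat, m%:R <= 16 * ((1 - q)^-1) ^+ 2 * e ^+ 2 * n%:R -> (m <= r)%N) ->
  cells (good s N (n := n)) (orb e) K ->
  cells (good s N (n := n)) (orb (e / 2)) (K * 2 ^ (n + code_exponent * n * r)).
Proof.
move=> e0 de hr [c [cK co]].
have /choice[V VP] : forall k, exists V : 'I_p -> M,
    (exists U, good s N U /\ c U = k) -> good s N V /\ c V = k.
  move=> k; have [[U UP]|no] := pselect (exists U : 'I_p -> M, good s N U /\ c U = k).
    by exists U.
  by exists (fun=> 1%:M) => /no.
have VU U : good s N U -> good s N (V (c U)) /\ c (V (c U)) = c U by move=> gU; apply: VP; exists U.
have /choice[x xP] : forall U, exists x : M * M * {set 'I_n}, good s N U ->
    [/\ x.1.1 \is unitarymx, x.1.2 \is unitarymx,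
      #|x.2|%:R <= 16 * ((1 - q)^-1) ^+ 2 * e ^+ 2 * n%:R &
      forall i, m2 (compare_defect x.1.1 U (V (c U)) i -
        compare_defect x.1.1 U (V (c U)) i *m (x.1.2)^H *m col_proj R x.2 *m x.1.2) <= 12 * d].
  move=> U; have [gU|no] := pselect (good s N U); last by exists (1%:M, 1%:M, finset.set0).
  have [gV cV] := VU U gU.
  by have [x xP] := orb_defect q01 d0 close e0 de gU gV (co _ _ gU gV (esym cV)); exists x.
pose code U := lattice_code (corner_bound (x U).2) (corner_coords lam (x U).2
   (fun i => compare_defect (x U).1.1 U (V (c U)) i *m ((x U).1.2)^H) (x U).1.2).
pose K' := (2 ^ (code_exponent * n * r))%N.
pose rk U : nat := enum_rank (x U).2.
have rkn U : (rk U < 2 ^ n)%N.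
  have c2 : #|{set 'I_n}| = (2 ^ n)%N by rewrite -cardsT -powersetT card_powerset cardsT card_ord.
  by rewrite -c2 /rk; exact: ltn_ord.
have codeK U : good s N U -> (code U < K')%N.
  move=> gU; have [x1 x2 x3 _] := xP U gU; have [gV _] := VU U gU.
  exact: (corner_code_lt gU.1 gV.1 x1 x2 (hr _ x3)).
exists (fun U => ((c U * 2 ^ n + rk U) * K' + code U)%N); split.
  move=> U gU; rewrite expnD mulnA; apply: radix_lt; last exact: codeK.
  by apply: radix_lt => //; exact: cK.
move=> U U' gU gU' /(radix_inj (codeK _ gU) (codeK _ gU')) [/(radix_inj (rkn U) (rkn U'))[cE rkE] codeE].
have J_eq : (x U).2 = (x U').2 by apply: enum_rank_inj; apply: val_inj.
have [x1 x2 x3 x4] := xP U gU; have [y1 y2 y3 y4] := xP U' gU'.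
have [gV _] := VU U gU.
move: codeE y4; rewrite /code -J_eq -cE => codeE y4.
exact: (code_close e0 de gU.1 gU'.1 gV.1 (And4 x1 y1 x2 y2) x3 x4 y4 codeE).
Qed.

End step.

(** * Summation over the dyadic scales *)

Section iteration.
Variables (R : realType) (G : groupType) (p : nat) (s : 'I_p -> G) (q : R).
Hypothesis p0 : (0 < p)%N.
Hypothesis gen : forall g, exists w, word_val s w = g.
Hypothesis Gc : countable [set: G].
Hypothesis q01 : 0 <= q < 1.
Hypothesis gap : forall (H : hilbert R) (pi : G -> H -> H) (xi : H), unitary_rep pi ->
      nrm (hsip H) (rep_lazy pi s (xi - rep_lazy pi s xi)) <=
      q * nrm (hsip H) (xi - rep_lazy pi s xi).

Lemma orb_2 n (U V : 'I_p -> 'M[R[i]]_n) : unitary_tuple U -> unitary_tuple V -> orb 2 U V.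
Proof.
move=> Uu Vu; exists 1%:M; first exact: mx1_unitary.
move=> i; rewrite trC1 mx1r mx1l; apply: le_trans (nrmB _ _ _) _.
exact: (lerD (m2_unitary (Uu i)) (m2_unitary (Vu i))).
Qed.

Lemma geo_quarter m : \sum_(j < m) (2 * 2^-1 ^+ j : R) ^+ 2 <= 8.
Proof.
have E := subrX1 (4^-1 : R) m; have : 0 <= (4^-1 : R) ^+ m by rewrite exprn_ge0 // invr_ge0.
have -> : \sum_(j < m) (2 * 2^-1 ^+ j : R) ^+ 2 = 4 * \sum_(j < m) 4^-1 ^+ j.
  rewrite mulr_sumr; apply: eq_bigr => j _; rewrite exprMn -exprM mulnC exprM.
  have -> : (2^-1 : R) ^+ 2 = 4^-1 by field.
  by have -> : (2 : R) ^+ 2 = 4 by ring.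
move: E; set S := \sum_(j < m) _; lra.
Qed.

(* The scale is halved at each step; the exponents [O(e_j^2 n^2)] are summable. *)
Theorem entropy_cells : exists c : R, forall k, exists N, forall n, (0 < n)%N ->
  exists2 E : nat, E%:R <= (k * n)%:R + c * n%:R ^+ 2 &
    cells (good (R := R) s N (n := n)) (orb (2 * 2^-1 ^+ k)) (2 ^ E).
Proof.
pose C := (1 - q)^-1; pose tau := (Num.truncn (4608 * C ^+ 2)).+1.
have C0 : 0 < C by case/andP: q01 => _ q1; rewrite invr_gt0 subr_gt0.
have tauC : 4608 * C ^+ 2 <= tau%:R by apply: ltW; exact: truncnS_gt.
pose a := code_exponent p tau; pose A : R := a%:R * (16 * C ^+ 2).
have A0 : 0 <= A by rewrite mulr_ge0 // mulr_ge0 // ?ler0n // sqr_ge0.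
(* [A] is the exponent per unit of [e j ^+ 2 * n%:R ^+ 2] and 8 bounds the sum of the squared
   scales; neither involves [k]. *)
exists (8 * A) => k; pose e j : R := 2 * 2^-1 ^+ j.
have e0 j : 0 < e j by rewrite mulr_gt0 // exprn_gt0 // invr_gt0.
have e_le j : (j <= k)%N -> e k <= e j.
  by move=> jk; rewrite ler_pM2l // ler_wiXn2l // ?invr_ge0 // invf_le1 // ler1n.
(* The tolerance is tied to the last scale, so the same [N] is valid at every earlier one. *)
have d0 : 0 < e k / 96 by rewrite divr_gt0 // ltr0n.
have [N hN] := almost_intertwiner p0 gen Gc q01 gap d0.
exists N => n n0.
have close m (U V : 'I_p -> 'M[R[i]]_m) (x : R) : good s N U -> good s N V ->
    (forall i, nrm (mx_sip R m) (U i - V i) <= x) ->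
    exists2 W : 'M[R[i]]_m, nrm (mx_sip R m) (W - 1%:M) <= (1 - q)^-1 * x + e k / 96 &
      forall i, nrm (mx_sip R m) (U i *m W - W *m V i) <= e k / 96.
  by move=> [Uu aU] [Vu aV]; exact: hN.
have main j : (j <= k)%N -> exists2 E : nat,
    E%:R <= (j * n)%:R + A * n%:R ^+ 2 * \sum_(i < j) e i ^+ 2 &
    cells (good (R := R) s N (n := n)) (orb (e j)) (2 ^ E).
  elim: j => [|j IH] jk.
    exists 0%N; first by rewrite big_ord0 mulr0 addr0 mul0n.
    exists (fun=> 0%N); split => // U V [Uu _] [Vu _] _.
    by rewrite /e expr0 mulr1; exact: orb_2.
  have [E Ele cE] := IH (ltnW jk).
  pose x := 16 * C ^+ 2 * e j ^+ 2 * n%:R; pose r := Num.truncn x.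
  have x0 : 0 <= x by rewrite /x mulr_ge0 // mulr_ge0 ?sqr_ge0 // mulr_ge0 ?sqr_ge0.
  have hr (m : nat) : m%:R <= 16 * ((1 - q)^-1) ^+ 2 * e j ^+ 2 * n%:R -> (m <= r)%N.
    by move=> h; rewrite /r truncn_ge_nat //.
  have de : 96 * (e k / 96) <= e j.
    by rewrite mulrC divfK ?pnatr_eq0 //; exact: e_le (ltnW jk).
  have := cells_step q01 d0 close tauC n0 (e0 j) de hr cE.
  rewrite -expnD -/a; have -> : e j / 2 = e j.+1 by rewrite /e exprSr mulrA.
  move=> cS; exists (E + (n + a * n * r))%N => //.
  rewrite natrD big_ord_recr /= mulrDr mulSn !natrD.
  have h1 : (a * n * r)%:R <= A * n%:R ^+ 2 * e j ^+ 2.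
    have rx : r%:R <= x by rewrite truncn_le.
    rewrite !natrM; apply: le_trans (ler_wpM2l _ rx) _; first by rewrite mulr_ge0.
    by rewrite le_eqVlt; apply/orP; left; apply/eqP; rewrite /x /A; ring.
  move: Ele h1; set S := _ * \sum_(i < j) _; set T := _ * e j ^+ 2; set a1 := (a * n * r)%:R.
  by set b1 := (j * n)%:R; lra.
have [E Ele cE] := main k (leqnn k); exists E => //.
apply: le_trans Ele _; rewrite lerD2l.
have := ler_wpM2l (mulr_ge0 A0 (sqr_ge0 n%:R)) (geo_quarter k); rewrite -/e => h.
by apply: le_trans h _; rewrite le_eqVlt; apply/orP; left; apply/eqP; ring.
Qed.

End iteration.

(** * Strong closures and adjoints *)

Section pointwise_topology.
Variables (R : realType) (T : eqType) (V : normedModType R[i]).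
Implicit Types (f g : T -> V) (S : set (T -> V)).

Definition ptws_ball f (s : seq T) (e : R) : set (T -> V) :=
  [set g | forall v, v \in s -> `|f v - g v| < e%:C%C].

Lemma ptws_nbhs f s (e : R) : 0 < e -> nbhs (f : {ptws T -> V}) (ptws_ball f s e).
Proof.
have FF := nbhs_filter (f : {ptws T -> V}).
move=> e0; elim: s => [|v s ih]; first by apply: filterS (@filterT _ _ FF) => g _ v.
have hv := @proj_continuous T (fun=> V) v f.
have e0' : 0 < e%:C%C :> R[i] by rewrite ltcR.
move/cvgrPdist_lt: hv => /(_ _ e0') hv.
apply: filterS2 ih hv => g gs gv w; rewrite inE => /orP[/eqP->|/gs//]; exact: gv.
Qed.

End pointwise_topology.

Section pointwise_closure.
Variables (R : realType) (T : topologicalType) (V : normedModType R[i]).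
Implicit Types (f g : T -> V) (S : set (T -> V)).

Lemma ptws_closureP S f : closure (S : set {ptws T -> V}) f <->
  forall s (e : R), 0 < e -> exists2 g, S g & ptws_ball f s e g.
Proof.
split=> [Sf s e e0|h].
  by have [g [Sg fg]] := Sf _ (ptws_nbhs f s e0); exists g.
pose F := filter_from [set p : seq T * R | 0 < p.2]
  (fun p => S `&` ptws_ball f p.1 p.2).
have FF : ProperFilter F.
  apply: filter_from_proper; last first.
    by move=> [s e] /= /(h s) [g Sg fg]; exists g.
  apply: filter_from_filter; first by exists ([::], 1); exact: ltr01.
  move=> [s1 e1] [s2 e2] /= e10 e20; exists (s1 ++ s2, Num.min e1 e2) => /=.
    by rewrite lt_min e10.
  move=> g [Sg fg]; split; split=> // v vs.
    by apply: lt_le_trans (fg v _) _; rewrite ?mem_cat ?vs// lecR ge_min lexx.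
  by apply: lt_le_trans (fg v _) _; rewrite ?mem_cat ?vs ?orbT// lecR ge_min lexx orbT.
rewrite closureEcvg; exists F => //; split; last first.
  by move=> A SA; exists ([::], 1); [exact: ltr01|move=> g [/SA]].
apply/pointwise_cvgP => v; apply/cvgrPdist_lt => -[e e'].
rewrite ltcE/= => /andP[/eqP-> e0].
by exists ([:: v], e); [|move=> g [_ fg]; apply: fg; exact: mem_head].
Qed.

End pointwise_closure.

Section operator_lemmas.
Variables (R : realType) (H : hilbert R).
Implicit Types (x y : H -> H) (S : set (H -> H)).
Local Notation N := (nrm (hsip H)).

Lemma hnorm_ltE u (e : R) : (`|u| < e%:C%C) = (N u < e).
Proof. by rewrite hnormE ltcR. Qed.

Lemma hnorm_leE u (e : R) : (`|u| <= e%:C%C) = (N u <= e).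
Proof. by rewrite hnormE lecR. Qed.

Lemma bounded_opP x : bounded_op x <->
  linear x /\ exists2 K : R, 0 <= K & forall v, N (x v) <= K * N v.
Proof.
split=> [[xl xc]|[xl [K K0 xK]]]; split=> //.
  have /cvgrPdist_lt/(_ 1 ltr01) := xc 0.
  rewrite (lin0 xl) => /nbhs_ballP[[e e'] /=]; rewrite ltcE/= => /andP[/eqP-> e0] he.
  have xe v : N v < e -> N (x v) < 1.
    move=> ve; rewrite -hnorm_ltE -normrN -sub0r; apply: he.
    by rewrite -ball_normE /ball_/= sub0r normrN hnorm_ltE.
  exists (2 / e) => [|v]; first by rewrite divr_ge0// ltW.
  have [v0|vn0] := eqVneq (N v) 0.
    by rewrite (nrm_hsip_eq0 v0) (lin0 xl) nrm0 mulr0.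
  have v0 : 0 < N v by rewrite lt_def vn0 nrm_ge0.
  pose c := (e / 2) / N v.
  have c0 : 0 < c by rewrite !divr_gt0.
  have cN : c * N v = e / 2 by rewrite /c divfK.
  have := xe (c%:C%C *: v); rewrite (linZ xl) !nrmZ normc_real gtr0_norm// cN => h.
  have {}h : c * N (x v) < 1 by apply: h; lra.
  have -> : 2 / e * N v = c^-1 by rewrite /c !invf_div mulrC.
  by rewrite -[leRHS]mulr1 ler_pdivlMl// ltW.
move=> v; apply/cvgrPdist_lt => -[e e']; rewrite ltcE/= => /andP[/eqP-> e0].
have K1 : 0 < K + 1 by rewrite ltr_wpDl.
have d0 : 0 < (e / (K + 1))%:C%C :> R[i] by rewrite ltcR divr_gt0.
apply: filterS (nbhs_ball_norm v (PosNum d0)) => w; rewrite /ball_/= hnorm_ltE => vw.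
rewrite hnorm_ltE -(linB xl) (le_lt_trans (xK _))//.
apply: (@le_lt_trans _ _ ((K + 1) * N (v - w))).
  by rewrite ler_wpM2r ?nrm_ge0// lerDl.
by rewrite mulrC -ltr_pdivlMr.
Qed.

End operator_lemmas.

Section cauchy_limit.
Variables (R : realType) (H : hilbert R).
Local Notation N := (nrm (hsip H)).

Lemma hilbert_limit (T : Type) (F : set_system T) (f : T -> H) : ProperFilter F ->
  (forall e : R, 0 < e -> exists2 A, F A & forall a b, A a -> A b -> N (f a - f b) < e) ->
  exists l, forall e : R, 0 < e -> F [set a | N (l - f a) < e].
Proof.
move=> FF Fc.
have /cvg_ex[l] : cvg (f @ F).
  apply: cauchy_cvg; apply: cauchy_exP => -[e e'].
  rewrite ltcE/= => /andP[/eqP-> e0]; have [A FA Ae] := Fc e e0.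
  have [a Aa] := filter_ex FA; exists (f a).
  rewrite /nbhs/= /fmap/=; apply: filterS FA => b Ab.
  rewrite -ball_normE /ball_/= hnorm_ltE; exact: Ae.
move/cvgrPdist_lt => h; exists l => e e0.
have e0' : 0 < e%:C%C :> R[i] by rewrite ltcR.
by have := h _ e0'; apply: filterS => a; rewrite hnorm_ltE.
Qed.

End cauchy_limit.

(** * Orthogonal projection through almost minimizers *)

Section near_minimizer.
Variables (R : realType) (V : lmodType R[i]) (B : sip V) (S : set V) (u : V).
Hypothesis S0 : S 0.
Hypothesis SD : forall a x y, S x -> S y -> S (a *: x + y).
Local Notation N := (nrm B).

Let D := [set N (u - b) ^+ 2 | b in S].
Let d := inf D.

(** [S] is a subspace that need not be closed, so the distance from [u] may not be attained. By the
    parallelogram law these sets shrink as [e] tends to 0. *)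
Definition near_min (e : R) : set V := [set b | S b /\ N (u - b) ^+ 2 <= d + e].

Let D_inf : has_inf D.
Proof.
split; first by exists (N (u - 0) ^+ 2); exists 0.
by exists 0 => _ [b _ <-]; exact: sqr_ge0.
Qed.

Let d_le b : S b -> d <= N (u - b) ^+ 2.
Proof. by move=> Sb; apply: ge_inf; [case: D_inf|exists b]. Qed.

Lemma near_min_ex e : 0 < e -> exists b, near_min e b.
Proof.
move=> e0; have [_ [b Sb <-] h] := inf_adherent e0 D_inf.
by exists b; split=> //; exact: ltW.
Qed.

Lemma near_min_le e e' b : e <= e' -> near_min e b -> near_min e' b.
Proof. by move=> ee [Sb h]; split=> //; apply: le_trans h _; rewrite lerD2l. Qed.

Lemma near_min_close e b b' : near_min e b -> near_min e b' -> N (b - b') ^+ 2 <= 4 * e.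
Proof.
move=> [Sb h] [Sb' h'].
pose c := 2^-1 *: b + 2^-1 *: b'.
have Sc : S c by apply: SD => //; rewrite -[_ *: _]addr0; exact: SD.
have := parallelogram B (u - b) (u - b').
have -> : u - b - (u - b') = b' - b by rewrite opprB addrC addrA subrK.
have -> : u - b + (u - b') = 2 *: (u - c).
  rewrite scalerBr scalerDr !scalerA divff ?pnatr_eq0// !scale1r scaler_nat mulr2n.
  by rewrite opprD addrACA.
have := d_le Sc; rewrite nrmZ exprMn (nrmBC B b b').
have -> : normc (2 : R[i]) ^+ 2 = 4.
  by rewrite -[2]/(2%:R) -(rmorph_nat (real_complex R)) normc_real ger0_norm//; lra.
lra.
Qed.

Lemma near_min_orth e b c : 0 <= e -> near_min e b -> S c ->
  normc (B (u - b) c) ^+ 2 <= e * N c ^+ 2.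
Proof.
move=> e0 [Sb h] Sc; set x := u - b.
have [c0|c0] := eqVneq (N c) 0.
  have := sip_CS B x c; rewrite c0 mulr0 => h0.
  have -> : normc (B x c) = 0 by apply/le_anti; rewrite h0 normc_ge0.
  by rewrite expr0n mulr0.
have cp : 0 < N c ^+ 2 by rewrite exprn_gt0// lt_def c0 nrm_ge0.
pose t : R[i] := ((N c ^+ 2)^-1)%:C%C * B x c.
have := d_le (SD t Sc Sb); rewrite opprD addrCA addrC -/x => h1.
have h2 : N (x - t *: c) ^+ 2 = N x ^+ 2 - normc (B x c) ^+ 2 / N c ^+ 2.
  rewrite nrm_sqrB nrmZ exprMn /t normcM exprMn normc_real real_normK ?num_real//.
  have E : t^* * B x c = ((N c ^+ 2)^-1 * normc (B x c) ^+ 2)%:C%C.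
    by rewrite /t rmorphM /= conj_realc -mulrA (mulrC _ (B x c)) mul_conjE -rmorphM.
  rewrite sipZr E /= -/(N c ^+ 2).
  by field.
rewrite -ler_pdivrMr//; move: h1 h; rewrite h2 -/x.
set q := _ / _; lra.
Qed.

End near_minimizer.

Section projection.
Variables (R : realType) (H : hilbert R) (m : nat).
Implicit Types (u v w : 'I_m -> H).
Local Notation N := (nrm (hsip H)).

Definition tuple_dot u v : R[i] := \sum_i hsip H (u i) (v i).

Let tuple_dotl a u v w :
  tuple_dot (a *: u + v) w = a * tuple_dot u w + tuple_dot v w.
Proof. rewrite mulr_sumr -big_split; apply: eq_bigr => i _; exact: (sipl (hsip H) a (u i)). Qed.
Let tuple_dotC u v : tuple_dot u v = (tuple_dot v u)^*.
Proof. rewrite rmorph_sum; apply: eq_bigr => i _; exact: (sipC (hsip H)). Qed.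
Let tuple_dot_ge0 u : 0 <= tuple_dot u u.
Proof. by apply: sumr_ge0 => i _; exact: sip_ge0. Qed.

Definition tuple_sip : sip ('I_m -> H) := Sip tuple_dotl tuple_dotC tuple_dot_ge0.

Lemma tuple_nrm_sqr u : nrm tuple_sip u ^+ 2 = \sum_i N (u i) ^+ 2.
Proof. by rewrite nrm_sqr Re_sum; apply: eq_bigr => i _; rewrite -nrm_sqr. Qed.

Lemma tuple_nrm_ge u i : N (u i) <= nrm tuple_sip u.
Proof.
rewrite -ler_sqr ?nnegrE ?nrm_ge0// tuple_nrm_sqr (bigD1 i)//= lerDl.
by apply: sumr_ge0 => *; exact: sqr_ge0.
Qed.

(** The vector [l] is the projection of [u] onto the closure of [S], obtained as the limit of almost
    minimizers. Tuples appear because a strong neighbourhood tests finitely many vectors at once;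
    [m = 1] serves for the Riesz representation. *)
Lemma tuple_projection (S : set ('I_m -> H)) u : S 0 ->
    (forall a x y, S x -> S y -> S (a *: x + y)) ->
  exists2 l : 'I_m -> H, (forall c, S c -> tuple_dot (u - l) c = 0) &
    forall e : R, 0 < e -> exists2 b, S b & nrm tuple_sip (l - b) < e.
Proof.
move=> S0 SD.
pose F := filter_from [set e : R | 0 < e] (near_min tuple_sip S u).
have FF : ProperFilter F.
  apply: filter_from_proper; last by move=> e e0; exact: near_min_ex.
  apply: filter_from_filter; first by exists 1; exact: ltr01.
  move=> e e' e0 e0'; exists (Num.min e e'); first by rewrite /= lt_min e0.
  by move=> b hb; split; apply: near_min_le hb; rewrite ge_min lexx ?orbT.
have /choice[l hl] i : exists l, forall e : R, 0 < e ->
    F [set b : 'I_m -> H | N (l - b i) < e].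
  apply: (hilbert_limit (f := fun b : 'I_m -> H => b i)) => e e0.
  have e1 : 0 < (e / 3) ^+ 2 by rewrite exprn_gt0// divr_gt0.
  exists (near_min tuple_sip S u ((e / 3) ^+ 2)); first by exists ((e / 3) ^+ 2).
  move=> b b' hb hb'; have := near_min_close S0 SD hb hb'.
  have := tuple_nrm_ge (b - b') i; set x := nrm _ _ => bx hx.
  apply: le_lt_trans bx _; rewrite -ltr_sqr ?nnegrE ?nrm_ge0 1?ltW//.
  apply: le_lt_trans hx _; have := exprn_gt0 2 e0; rewrite exprMn exprVn; lra.
have Fl (e : R) : 0 < e -> F [set b | nrm tuple_sip (l - b) < e].
  move=> e0; pose e1 := e / m.+1%:R.
  have e10 : 0 < e1 by rewrite divr_gt0.
  have : F (\bigcap_(i in [set` [fset i | i : 'I_m]%fset]) [set b : 'I_m -> H | N (l i - b i) < e1]).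
    by apply: filter_bigI => i _; exact: hl.
  apply: filterS => b hb; rewrite /= -ltr_sqr ?nnegrE ?nrm_ge0 1?ltW// tuple_nrm_sqr.
  apply: (@le_lt_trans _ _ (\sum_(i < m) e1 ^+ 2)).
    apply: ler_sum => i _; rewrite ler_sqr ?nnegrE ?nrm_ge0 1?ltW//.
    by apply: (hb i); rewrite /= in_imfset.
  have eE : e = e1 * m.+1%:R by rewrite divfK.
  clearbody e1; rewrite sumr_const card_ord eE exprMn -[e1 ^+ 2 *+ m]mulr_natr.
  rewrite ltr_pM2l ?exprn_gt0// -natrX ltr_nat.
  by rewrite (leq_trans (ltnSn m))// -mulnn leq_pmulr.
exists l => [c Sc|e e0]; last first.
  have F1 : F (near_min tuple_sip S u 1) by exists 1 => //; exact: ltr01.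
  by have [b [[Sb _] hb]] := filter_ex (filterI F1 (Fl e e0)); exists b.
apply/eq0_normc/le_anti; rewrite normc_ge0 andbT.
set Nc := nrm tuple_sip c.
apply/ler_addgt0Pr => e e0; rewrite add0r.
have c0 : 0 < 2 * (Nc + 1) by rewrite mulr_gt0// ltr_wpDl// nrm_ge0.
pose d := e / (2 * (Nc + 1)); have d0 : 0 < d by rewrite divr_gt0.
have dN : 2 * (d * Nc) <= e.
  have : d * (2 * (Nc + 1)) = e by rewrite divfK// gt_eqF.
  by clearbody d; lra.
have F1 : F (near_min tuple_sip S u (d ^+ 2)) by exists (d ^+ 2) => //; exact: exprn_gt0.
have [b [hb hl']] := filter_ex (filterI F1 (Fl d d0)).
have -> : u - l = (u - b) - (l - b) by rewrite opprB addrA subrK.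
rewrite [tuple_dot _ _](sipBl tuple_sip).
apply: le_trans (normc_le_add _ _) _; rewrite normcN.
have := near_min_orth S0 SD (sqr_ge0 d) hb Sc; rewrite -exprMn ler_sqr ?nnegrE ?normc_ge0//; last first.
  by rewrite mulr_ge0 ?nrm_ge0// ltW.
have := sip_CS tuple_sip (l - b) c; rewrite -/Nc => h1 h2.
have : nrm tuple_sip (l - b) * Nc <= d * Nc by rewrite ler_wpM2r ?nrm_ge0// ltW.
lra.
Qed.

End projection.

Section hilbert_operators.
Variables (R : realType) (H : hilbert R).
Implicit Types (x y : H -> H) (S : set (H -> H)).
Local Notation N := (nrm (hsip H)).

Lemma hdot_eq (u v : H) : (forall w, hdot H w u = hdot H w v) -> u = v.
Proof.
move=> h; apply/eqP; rewrite -subr_eq0; apply/eqP/nrm_hsip_eq0.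
apply/eqP; rewrite -sqrf_eq0 nrm_sqr sipBr -!hsipE h subrr //.
Qed.

Lemma riesz (phi : H -> R[i]^o) (K : R) : linear phi ->
  (forall u, normc (phi u) <= K * N u) -> exists z, forall u, phi u = hdot H u z.
Proof.
move=> phil phiK; have [phi0|] := pselect (forall u, phi u = 0).
  by exists 0 => u; rewrite hdot0r.
move=> /existsNP[u0 /eqP pu0]; pose u := (phi u0)^-1 *: u0.
have pu : phi u = 1 by rewrite (linZ phil); exact: mulVf.
pose S := [set f : 'I_1 -> H | phi (f ord0) = 0].
have [||l lS hl] := @tuple_projection R H 1 S (fun=> u).
- exact: lin0 phil.
- move=> a f g f0 g0; rewrite /S /= [(_ + _) _]/(a *: f ord0 + g ord0).
  by rewrite phil f0 g0 scaler0 addr0.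
have pl : phi (l ord0) = 0.
  apply/eq0_normc/le_anti; rewrite normc_ge0 andbT; apply/ler_addgt0Pr => e e0; rewrite add0r.
  have K0 : 0 < `|K| + 1 by rewrite ltr_wpDl.
  have [|b Sb hb] := hl (e / (`|K| + 1)); first by rewrite divr_gt0.
  have -> : phi (l ord0) = phi (l ord0 - b ord0) by rewrite (linB phil) Sb subr0.
  apply: le_trans (phiK _) _; have := tuple_nrm_ge (l - b) ord0 => h.
  apply: (@le_trans _ _ ((`|K| + 1) * (e / (`|K| + 1)))); last by rewrite mulrC divfK ?gt_eqF.
  apply: (@le_trans _ _ ((`|K| + 1) * N (l ord0 - b ord0))).
    by rewrite ler_wpM2r ?nrm_ge0// (le_trans (ler_norm _))// lerDl.
  by rewrite ler_pM2l// (le_trans h)// ltW.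
pose z := u - l ord0.
have pz : phi z = 1 by rewrite (linB phil) pu pl subr0.
have orth c : phi c = 0 -> hdot H c z = 0.
  move=> pc; rewrite hdotC; have := lS (fun=> c) pc.
  by rewrite /tuple_dot big_ord1 => h; rewrite [hdot H z c]h conjC0.
have zz : hdot H z z != 0.
  apply/eqP => h; have z0 : z = 0.
    by apply: nrm_hsip_eq0; apply/eqP; rewrite -sqrf_eq0 nrm_sqr -hsipE h.
  by move: pz; rewrite z0 (lin0 phil) => /esym/eqP; rewrite oner_eq0.
exists (((hdot H z z)^*)^-1 *: z) => w.
rewrite hdotZr rmorphV ?unitfE ?conjC_eq0//= conjCK.
have : hdot H (w - phi w *: z) z = 0.
  by apply: orth; rewrite (linB phil) (linZ phil) pz [_ *: 1]mulr1 subrr.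
rewrite hsipE sipBl sipZl -!hsipE => /subr0_eq ->.
by rewrite mulrC mulfK.
Qed.

Lemma bounded_op_adjoint x : bounded_op x -> exists2 y, bounded_op y & adjoint x y.
Proof.
move=> /bounded_opP[xl [K K0 xK]].
have /choice[y hy] v : exists z, forall u, hdot H (x u) v = hdot H u z.
  apply: (@riesz (fun u => hdot H (x u) v : R[i]^o) (K * N v)) => [a u w|u].
    by rewrite xl hdot_linl.
  rewrite mulrAC; apply: le_trans (sip_CS (hsip H) _ _) _.
  by rewrite ler_wpM2r ?nrm_ge0.
exists y; last by move=> u v; exact: hy.
apply/bounded_opP; split; last first.
  exists K => // v; have := Re_sip_CS (hsip H) (x (y v)) v.
  rewrite -hsipE hy hsipE -nrm_sqr => h.
  have [->|v0] := eqVneq (N (y v)) 0; first by rewrite mulr_ge0// nrm_ge0.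
  have vp : 0 < N (y v) by rewrite lt_def v0 nrm_ge0.
  rewrite -(ler_pM2l vp) -expr2 (le_trans h)// mulrA (mulrC _ K).
  by rewrite ler_wpM2r ?nrm_ge0.
move=> a u v; apply: hdot_eq => w; rewrite -hy !hsipE !(sipDr, sipZr) -!hsipE.
by rewrite !hy.
Qed.

Lemma adjoint_sym x y : adjoint x y -> adjoint y x.
Proof. by move=> xy u v; rewrite hdotC -xy -hdotC. Qed.

Lemma bounded_op_lin a x y : bounded_op x -> bounded_op y -> bounded_op (a *: x + y).
Proof.
move=> /bounded_opP[xl [K K0 xK]] /bounded_opP[yl [L L0 yL]]; apply/bounded_opP.
split=> [b u v|].
  rewrite ![(_ + _) _]/(a *: x _ + y _) xl yl !scalerDr !scalerA (mulrC a).
  by rewrite addrACA.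
exists (normc a * K + L) => [|v]; first by rewrite addr_ge0// mulr_ge0// normc_ge0.
rewrite [(_ + _) _]/(a *: x v + y v) mulrDl (le_trans (nrmD _ _ _))// nrmZ lerD//.
by rewrite -mulrA ler_wpM2l// normc_ge0.
Qed.

Lemma bounded_op_comp x y : bounded_op x -> bounded_op y -> bounded_op (x \o y).
Proof.
move=> /bounded_opP[xl [K K0 xK]] /bounded_opP[yl [L L0 yL]]; apply/bounded_opP.
split=> [a u v /=|]; first by rewrite yl xl.
exists (K * L) => [|v /=]; first exact: mulr_ge0.
by rewrite (le_trans (xK _))// -mulrA ler_wpM2l.
Qed.

Lemma sot_closureP S x : sot_closure S x <-> bounded_op x /\
  forall (s : seq H) (e : R), 0 < e ->
    exists2 y, S y & forall v, v \in s -> N (x v - y v) < e.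
Proof.
split=> [[bx /ptws_closureP h]|[bx h]]; split=> //.
  by move=> s e e0; have [y Sy xy] := h s e e0; exists y => // v /xy; rewrite hnorm_ltE.
apply/ptws_closureP => s e e0; have [y Sy xy] := h s e e0.
by exists y => // v /xy; rewrite hnorm_ltE.
Qed.

Lemma sot_closure_idem S : sot_closure (sot_closure S) `<=` sot_closure S.
Proof.
move=> x /sot_closureP[bx h]; apply/sot_closureP; split=> // s e e0.
have e2 : 0 < e / 2 by rewrite divr_gt0.
have [y /sot_closureP[_ hy] xy] := h s _ e2; have [z Sz yz] := hy s _ e2.
exists z => // v vs; apply: le_lt_trans (nrm_dist _ (y v) _ _) _.
by have := xy v vs; have := yz v vs; lra.
Qed.

Lemma sot_closure_sub S : S `<=` bounded_op (H := H) -> S `<=` sot_closure S.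
Proof.
move=> Sb x Sx; apply/sot_closureP; split; first exact: Sb.
by move=> s e e0; exists x => // v _; rewrite subrr nrm0.
Qed.

(** Composition is not jointly continuous and the adjoint is not continuous for the strong topology.
    Products are approximated one factor at a time. For adjoints the argument is the one showing
    that a subspace has the same weak and strong closures. *)
Lemma sot_closure_vN S : S `<=` bounded_op (H := H) -> S idfun ->
    (forall a x y, S x -> S y -> S (a *: x + y)) ->
    (forall x y, S x -> S y -> S (x \o y)) ->
    (forall x, S x -> exists2 y, S y & adjoint x y) ->
  vN_algebra (sot_closure S).
Proof.
move=> Sb S1 SD SM SA.
have S0 : S 0 by have := SD (-1) _ _ S1 S1; rewrite scaleN1r addNr.
split; first by move=> x [].
- exact: sot_closure_sub.
- move=> a x y /sot_closureP[bx hx] /sot_closureP[by_ hy].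
  apply/sot_closureP; split=> [|s e e0]; first exact: bounded_op_lin.
  have a0 : 0 < normc a + 1 by rewrite ltr_wpDl// normc_ge0.
  have e1 : 0 < e / 2 / (normc a + 1) by rewrite !divr_gt0.
  have e2 : 0 < e / 2 by rewrite divr_gt0.
  have [x' Sx' xx'] := hx s _ e1; have [y' Sy' yy'] := hy s _ e2.
  exists (a *: x' + y'); first exact: SD.
  move=> v vs; rewrite ![(_ + _) _]/(a *: _ v + _ v) opprD addrACA -scalerBr.
  apply: le_lt_trans (nrmD _ _ _) _; rewrite nrmZ.
  have := xx' v vs; rewrite ltr_pdivlMr//; have := yy' v vs.
  by have := nrm_ge0 (hsip H) (x v - x' v); lra.
- move=> x y /sot_closureP[bx hx] /sot_closureP[by_ hy].
  apply/sot_closureP; split=> [|s e e0]; first exact: bounded_op_comp.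
  have e2 : 0 < e / 2 by rewrite divr_gt0.
  have [x' Sx' xx'] := hx (map y s) _ e2.
  have /bounded_opP[x'l [K K0 x'K]] := Sb _ Sx'.
  have K1 : 0 < K + 1 by rewrite ltr_wpDl.
  (* [y'] is chosen after [x'], because its accuracy depends on the bound [K] of [x']. *)
  have [|y' Sy' yy'] := hy s (e / 2 / (K + 1)); first by rewrite divr_gt0.
  exists (x' \o y'); first exact: SM.
  move=> v vs /=; apply: le_lt_trans (nrm_dist _ (x' (y v)) _ _) _.
  have := xx' _ (map_f y vs); rewrite -(linB x'l).
  have := yy' v vs; rewrite ltr_pdivlMr//.
  by have := x'K (y v - y' v); have := nrm_ge0 (hsip H) (y v - y' v); lra.
split; last exact: sot_closure_idem.
move=> x /sot_closureP[bx hx]; have [y by_ xy] := bounded_op_adjoint bx.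
exists y => //; apply/sot_closureP; split=> // s e e0.
(* The component [z] of [y \o vs] orthogonal to all [a \o vs], [a] in [S], vanishes:
   <y vs, z> = <vs, x z> is a limit of terms <vs, a z> = <a^* vs, z> = 0. *)
pose m := size s; pose vs (i : 'I_m) := nth 0 s i.
pose S' := [set c : 'I_m -> H | exists2 a, S a & c = a \o vs].
have [||l lS hl] := @tuple_projection R H m S' (y \o vs).
- by exists 0.
- by move=> a _ _ [b Sb1 ->] [b' Sb' ->]; exists (a *: b + b') => //; exact: SD.
set z := y \o vs - l in lS.
have lz : tuple_dot l z = 0.
  apply/eq0_normc/le_anti; rewrite normc_ge0 andbT; apply/ler_addgt0Pr => d d0; rewrite add0r.
  have z0 : 0 < nrm (tuple_sip H m) z + 1 by rewrite ltr_wpDl// nrm_ge0.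
  have [|b S'b hb] := hl (d / (nrm (tuple_sip H m) z + 1)); first by rewrite divr_gt0.
  have -> : tuple_dot l z = tuple_dot (l - b) z.
    rewrite [RHS](sipBl (tuple_sip H m)) [X in _ - X](sipC (tuple_sip H m)).
    by rewrite [tuple_sip H m z b](lS _ S'b) conjC0 subr0.
  apply: le_trans (sip_CS (tuple_sip H m) _ _) _.
  move: hb; rewrite ltr_pdivlMr//; have := nrm_ge0 (tuple_sip H m) (l - b).
  by rewrite mulrDr mulr1; lra.
have uz : tuple_dot (y \o vs) z = 0.
  apply/eq0_normc/le_anti; rewrite normc_ge0 andbT; apply/ler_addgt0Pr => d d0; rewrite add0r.
  pose C := \sum_i N (vs i).
  have C0 : 0 <= C by apply: sumr_ge0 => i _; exact: nrm_ge0.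
  have C1 : 0 < C + 1 by rewrite ltr_wpDl.
  have [|a Sa ha] := hx (codom z) (d / (C + 1)); first by rewrite divr_gt0.
  have [a' Sa' aa'] := SA a Sa.
  have h : tuple_dot z (a' \o vs) = 0 by apply: lS; exists a'.
  have -> : tuple_dot (y \o vs) z = \sum_i hdot H (vs i) (x (z i) - a (z i)).
    have {}h : tuple_dot (a' \o vs) z = 0.
      by rewrite [LHS](sipC (tuple_sip H m)) [tuple_sip H m z _]h conjC0.
    rewrite -[LHS]subr0 -[X in _ - X]h /tuple_dot -sumrB.
    apply: eq_bigr => i _; rewrite [RHS](sipBr (hsip H)).
    have e1 : hsip H ((y \o vs) i) (z i) = hsip H (vs i) (x (z i)) by exact: (adjoint_sym xy).
    have e2 : hsip H ((a' \o vs) i) (z i) = hsip H (vs i) (a (z i)) by exact: (adjoint_sym aa').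
    by rewrite e1 e2.
  apply: le_trans (_ : \sum_i N (vs i) * (d / (C + 1)) <= _); last first.
    rewrite -mulr_suml -/C mulrA ler_pdivrMr// mulrC ler_wpM2l ?lerDl//.
    exact: ltW.
  elim/big_ind2 : _ => [|u1 v1 u2 v2 h1 h2|i _].
  - by rewrite (_ : normc 0 = 0)//; exact: normc0.
  - by apply: le_trans (normc_le_add _ _) _; exact: lerD.
  apply: le_trans (sip_CS (hsip H) _ _) _; rewrite ler_wpM2l ?nrm_ge0// ltW//.
  by apply: ha; exact: codom_f.
have z0 i : z i = 0.
  apply: nrm_hsip_eq0; apply/le_anti; rewrite nrm_ge0 andbT.
  apply: le_trans (tuple_nrm_ge _ _) _; rewrite /nrm.
  rewrite [tuple_sip _ _ _ _](sipBl (tuple_sip H m)).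
  by rewrite [X in X - _]uz [X in _ - X]lz subrr sqrtr0.
have [_ [a Sa ->] ha] := hl e e0; exists a => // v /(nthP 0)[i im <-].
have -> : y (nth 0 s i) = l (Ordinal im).
  by apply/eqP; rewrite -subr_eq0; apply/eqP; exact: (z0 (Ordinal im)).
apply: le_lt_trans ha; exact: (tuple_nrm_ge (l - (a \o vs)) (Ordinal im)).
Qed.

End hilbert_operators.

(** * The group von Neumann algebra *)

Section left_regular.
Variables (R : realType) (G : groupType).
Local Notation H := (ell2_hilbert R G).
Local Notation L := (@lreg R G).
Local Notation S := (@lreg_span R G).
Local Notation N := (nrm (hsip H)).

Lemma lreg_coord g (f : ell2 R G) k : (L g f : ell2 R G) k = f (g^-1 * k)%g.
Proof. by []. Qed.

Lemma lreg_linear g : linear (L g).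
Proof. by move=> a u v; apply: ell2_ext. Qed.

Lemma left_regM g k : L (g * k)%g = L g \o L k.
Proof.
apply/funext => f; apply: ell2_ext => h.
by rewrite /comp !lreg_coord invMg mulgA.
Qed.

Lemma left_reg1 : L 1%g = idfun.
Proof. by apply/funext => f; apply: ell2_ext => h; rewrite lreg_coord invg1 mul1g. Qed.

Lemma lreg_nrm g (f : H) : N (L g f) = N f.
Proof.
have E u : hsip H u u = (fine (\esum_(t in [set: G]) (normc ((u : ell2 R G) t) ^+ 2)%:E))%:C%C.
  exact: (@ell2_dotE R G u).
rewrite /nrm !E; congr (Num.sqrt (fine _)).
rewrite (@reindex_esum R G G setT setT (fun k => (g^-1 * k)%g)
  (fun k => (normc ((f : ell2 R G) k) ^+ 2)%:E)) //.
split=> [//|k l _ _ /mulgI //|k _]; exists (g * k)%g => //.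
by rewrite mulKg.
Qed.

Lemma lreg_rep : unitary_rep L.
Proof.
split.
- exact: lreg_linear.
- by move=> g u v; exact: (isometry_dot (@lreg_linear g) (@lreg_nrm g)).
- exact: left_reg1.
- exact: left_regM.
Qed.

Lemma lreg_delta g k : L g (delta R k) = delta R (g * k)%g.
Proof.
apply: ell2_ext => h; rewrite lreg_coord /=.
by congr (_%:R); rewrite -(inj_eq (mulgI g)) mulVKg.
Qed.

Lemma lreg_spanP x : S x <-> exists p : monalg.malg G R[i], x = malg_ext L p.
Proof.
split=> [[s [c ->]]|[p ->]]; last first.
  by exists (monalg.msupp p), (fun g => monalg.mcoeff g p).
exists (\sum_(g <- s) c g *: monalg.mkmalgU g 1).
rewrite (lin_sum (malg_ext_linear L)); apply: eq_bigr => g _.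
by rewrite (linZ (malg_ext_linear L)) malg_extU.
Qed.

Lemma lreg_in_span g : S (L g).
Proof. by apply/lreg_spanP; exists (monalg.mkmalgU g 1); rewrite malg_extU. Qed.

Lemma lreg_span_lin a x y : S x -> S y -> S (a *: x + y).
Proof.
move=> /lreg_spanP[p ->] /lreg_spanP[q ->]; apply/lreg_spanP.
by exists (a *: p + q); rewrite malg_ext_linear.
Qed.

Lemma lreg_span0 : S 0.
Proof. by exists [::], (fun=> 0); rewrite big_nil. Qed.

Lemma lreg_span_sum (I : Type) (s : seq I) (c : I -> R[i]) (x : I -> H -> H) :
  (forall i, S (x i)) -> S (\sum_(i <- s) c i *: x i).
Proof.
move=> Sx; elim: s => [|i s ih]; first by rewrite big_nil; exact: lreg_span0.
by rewrite big_cons; exact: lreg_span_lin.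
Qed.

Lemma lreg_span1 : S idfun.
Proof. by rewrite -left_reg1; exact: lreg_in_span. Qed.

Lemma lreg_span_sumE (I : Type) (s : seq I) (c : I -> R[i]) (x : I -> H -> H) v :
  (\sum_(i <- s) c i *: x i) v = \sum_(i <- s) c i *: x i v.
Proof. by rewrite fct_sumE. Qed.

Lemma lreg_span_comp x y : S x -> S y -> S (x \o y).
Proof.
move=> [s [c ->]] [t [d ->]].
have -> : (\sum_(g <- s) c g *: L g) \o (\sum_(k <- t) d k *: L k) =
    \sum_(g <- s) c g *: (\sum_(k <- t) d k *: L (g * k)%g).
  apply/funext => v; rewrite /comp !lreg_span_sumE; apply: eq_bigr => g _.
  rewrite [RHS]/(c g *: (\sum_(k <- t) d k *: L (g * k)%g) v) lreg_span_sumE.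
  rewrite (lin_sum (@lreg_linear g)); congr (_ *: _); apply: eq_bigr => k _.
  by rewrite (linZ (@lreg_linear g)) left_regM.
apply: lreg_span_sum => g; apply: lreg_span_sum => k; exact: lreg_in_span.
Qed.

Lemma lreg_span_adjoint x : S x -> exists2 y, S y & adjoint x y.
Proof.
move=> [s [c ->]]; exists (\sum_(g <- s) (c g)^* *: L g^-1%g).
  by apply: lreg_span_sum => g; exact: lreg_in_span.
move=> u v; rewrite !lreg_span_sumE !hsipE sip_suml sip_sumr.
apply: eq_bigr => g _; rewrite sipZl sipZr conjCK; congr (_ * _).
have := rep_adj lreg_rep g^-1 u v; rewrite invgK.
exact.
Qed.

Lemma lreg_bounded g : bounded_op (L g).
Proof.
apply/bounded_opP; split; first exact: lreg_linear.
by exists 1 => // v; rewrite lreg_nrm mul1r.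
Qed.

Lemma bounded_op0 : bounded_op (0 : H -> H).
Proof.
apply/bounded_opP; split=> [a u v|]; first by rewrite scaler0 addr0.
by exists 0 => // v; rewrite mul0r nrm0.
Qed.

Lemma lreg_span_bounded : S `<=` bounded_op (H := H).
Proof.
move=> _ [s [c ->]]; elim: s => [|g s ih]; first by rewrite big_nil; exact: bounded_op0.
by rewrite big_cons; apply: bounded_op_lin => //; exact: lreg_bounded.
Qed.

Lemma group_vN : vN_algebra (@group_vN_algebra R G).
Proof.
apply: sot_closure_vN.
- exact: lreg_span_bounded.
- exact: lreg_span1.
- exact: lreg_span_lin.
- exact: lreg_span_comp.
- exact: lreg_span_adjoint.
Qed.

Lemma lreg_group_vN g : group_vN_algebra (L g).
Proof. by apply: sot_closure_sub (lreg_in_span g); exact: lreg_span_bounded. Qed.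

Lemma group_trace_lreg g : group_trace (L g) = (g == 1%g)%:R.
Proof. by rewrite /group_trace lreg_delta mulg1 delta_dot. Qed.

End left_regular.

(** * Positive operators *)

Section positive_operators.
Variables (R : realType) (H : hilbert R) (x : H -> H).
Hypotheses (x_lin : linear x) (x_ge0 : op_le 0 x).
Local Notation N := (nrm (hsip H)).

Let q u v := hdot H (x u) v.

Let ql a u v w : q (a *: u + v) w = a * q u w + q v w.
Proof. by rewrite /q x_lin hdot_linl. Qed.

Let q_ge0 u : 0 <= q u u.
Proof. by have := x_ge0 u; rewrite (_ : hdot H (0 u) u = 0)//; exact: (sip0l (hsip H)). Qed.

(* A form with real diagonal is Hermitian, by polarization over u + v and u + iv. *)
Let qC u v : q u v = (q v u)^*.
Proof.
have real w : Im (q w w) = 0 by have := q_ge0 w; rewrite lecE => /andP[/eqP].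
have qr w a u' v' : q w (a *: u' + v') = a^* * q w u' + q w v'.
  by rewrite /q hsipE sipDr sipZr.
have h a : Im (a^* * q v u + a * q u v) = 0.
  have := real (a *: u + v); have := real u; have := real v.
  rewrite ql !qr; set z := q u u; set w := q v v; set s := q u v; set t := q v u.
  by rewrite !(ImD, ImM, ReD, ReM, ReJ, ImJ) => -> ->; lra.
have h1 := h 1; have hi := h 'i%C.
rewrite conjCE in h1; rewrite conjCE in hi.
move: h1 hi; rewrite !ImD !ImM /= => h1 hi.
by apply: complexP; rewrite ?ReJ ?ImJ; lra.
Qed.

Definition positive_sip : sip H := Sip ql qC q_ge0.

Lemma positive_null u : hdot H (x u) u = 0 -> x u = 0.
Proof.
move=> xu0; have n0 : nrm positive_sip u = 0.
  by rewrite /nrm [positive_sip u u]xu0 sqrtr0.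
apply: nrm_hsip_eq0; apply/eqP; rewrite -sqrf_eq0 nrm_sqr.
by have := sip_null (x u) n0; rewrite [X in X = _]/(q u (x u)) /q hsipE => ->.
Qed.

(** Cauchy-Schwarz for the form defined by [x], at the vectors [u] and [x u]: the pairing is
    [N (x u) ^+ 2], and the hypothesis bounds the form at [x u]. *)
Lemma positive_nrm_le (K : R) u : (forall w, Re (hdot H (x w) w) <= K * N w ^+ 2) ->
  N (x u) ^+ 2 <= K * Re (hdot H (x u) u).
Proof.
move=> xK; have [xu0|xu0] := eqVneq (N (x u)) 0.
  rewrite xu0 expr0n /=.
  have -> : hdot H (x u) u = 0 by exact: (@sip_null _ _ (hsip H)).
  by rewrite mulr0.
have xup : 0 < N (x u) ^+ 2 by rewrite exprn_gt0// lt_def xu0 nrm_ge0.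
have := Re_sip_CS positive_sip u (x u).
have -> : Re (positive_sip u (x u)) = N (x u) ^+ 2 by rewrite nrm_sqr.
rewrite -ler_sqr ?nnegrE ?(mulr_ge0, nrm_ge0) ?(ltW xup)// [X in _ <= X -> _]exprMn.
have -> : nrm positive_sip (x u) ^+ 2 = Re (hdot H (x (x u)) (x u)) by rewrite nrm_sqr.
have -> : nrm positive_sip u ^+ 2 = Re (hdot H (x u) u) by rewrite nrm_sqr.
have := xK (x u); set a := N (x u) ^+ 2 in xup *.
have b0 : 0 <= Re (hdot H (x u) u) by have := Re_sip_ge0 positive_sip u.
move=> h2 h; rewrite -(ler_pM2r xup) -expr2 (le_trans h)//.
by rewrite -mulrA mulrCA ler_wpM2l.
Qed.

End positive_operators.

Section group_trace_state.
Variables (R : realType) (G : groupType).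
Local Notation H := (ell2_hilbert R G).
Local Notation L := (@lreg R G).
Local Notation S := (@lreg_span R G).
Local Notation M := (@group_vN_algebra R G).
Local Notation tau := (@group_trace R G).
Local Notation N := (nrm (hsip H)).
Local Notation de := (delta R (1%g : G)).
Implicit Types x y : H -> H.

Lemma group_trace_lin a x y : tau (a *: x + y) = a * tau x + tau y.
Proof. exact: (@hdot_linl R H a (x de) (y de) de). Qed.

Lemma nrm_delta : N de = 1.
Proof. by rewrite /nrm -hsipE delta_dot eqxx sqrtr1. Qed.

Lemma normc_hdot_delta (v : H) : normc (hdot H v de) <= N v.
Proof. by have := sip_CS (hsip H) v de; rewrite nrm_delta mulr1. Qed.

Lemma group_trace_sum (I : Type) (s : seq I) (c : I -> R[i]) (x : I -> H -> H) :
  tau (\sum_(i <- s) c i *: x i) = \sum_(i <- s) c i * tau (x i).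
Proof.
rewrite /group_trace lreg_span_sumE hsipE sip_suml; apply: eq_bigr => i _.
by rewrite sipZl.
Qed.

Let commutes x y := tau (x \o y) = tau (y \o x).

Let commutes_sum x (s : seq G) (c : G -> R[i]) : bounded_op x ->
  (forall g, commutes x (L g)) -> commutes x (\sum_(g <- s) c g *: L g).
Proof.
move=> /bounded_opP[xl _] h; rewrite /commutes.
have -> : x \o \sum_(g <- s) c g *: L g = \sum_(g <- s) c g *: (x \o L g).
  apply/funext => v; rewrite /comp !lreg_span_sumE (lin_sum xl).
  by apply: eq_bigr => g _; rewrite (linZ xl).
have -> : (\sum_(g <- s) c g *: L g) \o x = \sum_(g <- s) c g *: (L g \o x).
  by apply/funext => v; rewrite /comp !lreg_span_sumE.
by rewrite !group_trace_sum; apply: eq_bigr => g _; rewrite h.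
Qed.

(** For a fixed bounded [x], the two traces depend on [y] only through [y de] and [y (x de)], and
    continuously so; this permits strong limits in [y] for each [x] separately. *)
Let commutes_closure x y : bounded_op x -> M y ->
  (forall a, S a -> commutes x a) -> commutes x y.
Proof.
move=> /bounded_opP[xl [K K0 xK]] /sot_closureP[_ hy] h.
apply/eqP; rewrite -subr_eq0; apply/eqP/eq0_normc/le_anti; rewrite normc_ge0 andbT.
apply/ler_addgt0Pr => e e0; rewrite add0r.
have K1 : 0 < K + 1 by rewrite ltr_wpDl.
have [a Sa ya] := hy [:: de; x de] (e / (K + 1)) (divr_gt0 e0 K1).
have h1 := ya de (mem_head _ _).
have h2 : N (y (x de) - a (x de)) < e / (K + 1) by apply: ya; rewrite !inE eqxx orbT.
have -> : tau (x \o y) - tau (y \o x) =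
    hdot H (x (y de - a de)) de - hdot H (y (x de) - a (x de)) de.
  rewrite (linB xl) [X in _ = X - _](sipBl (hsip H)) [X in _ = _ - X](sipBl (hsip H)).
  have : hsip H (x (a de)) de = hsip H (a (x de)) de by exact: h Sa.
  by rewrite [tau _]/(hsip H _ de) [tau (_ \o x)]/(hsip H _ de) => ->; rewrite opprB addrA subrK.
apply: le_trans (normc_le_add _ _) _; rewrite normcN.
have h3 := normc_hdot_delta (x (y de - a de)).
have h4 := normc_hdot_delta (y (x de) - a (x de)).
have h5 := xK (y de - a de).
have h6 : K * N (y de - a de) <= K * (e / (K + 1)) by rewrite ler_wpM2l// ltW.
have h7 : e / (K + 1) * (K + 1) = e by rewrite divfK// gt_eqF.
by set d := e / (K + 1) in h1 h2 h6 h7; lra.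
Qed.

Let bounded_group x : M x -> bounded_op x. Proof. by case. Qed.

Lemma group_trace_comp x y : M x -> M y -> tau (x \o y) = tau (y \o x).
Proof.
move=> Mx My; apply: commutes_closure (bounded_group Mx) My _ => a Sa.
apply/esym; apply: commutes_closure (lreg_span_bounded Sa) Mx _ => b [s [c ->]].
apply: commutes_sum (lreg_span_bounded Sa) _ => g.
case: Sa => t [d ->]; apply/esym.
apply: (@commutes_sum (L g) t d (lreg_bounded R g)) => k.
have E i j : tau (L i \o L j) = ((i * j)%g == 1%g)%:R by have := group_trace_lreg R (i * j)%g; rewrite left_regM.
rewrite /commutes !E; congr (nat_of_bool _)%:R.
apply/eqP/eqP => h; first by rewrite -(mulgK k (k * g)%g) -(mulgA k g k) h mulg1 mulgV.
by rewrite -(mulgK g (g * k)%g) -(mulgA g k g) h mulg1 mulgV.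
Qed.

(** By traciality, every diagonal coefficient of [x] at [delta R g] equals [tau x], which is 0, and
    positivity then gives [x (delta R g) = 0]. Hermitian symmetry of the form of [x] makes all
    coordinates of every [x v] vanish. *)
Lemma group_trace_faithful x : M x -> op_le 0 x -> tau x = 0 -> x = 0.
Proof.
move=> Mx x0 tx; have xl : linear x by case/bounded_opP: (bounded_group Mx).
have xd g : x (delta R g) = 0.
  apply: (positive_null xl x0); rewrite -[delta R g]/(delta R g) -[g]mulg1 -lreg_delta.
  have -> : hdot H (x (L g de)) (L g de) = tau (L g^-1%g \o (x \o L g)).
    by rewrite /group_trace /= (rep_adj (lreg_rep R G)).
  rewrite group_trace_comp; last 2 first.
  - exact: lreg_group_vN.
  - by case: (group_vN R G) => _ _ _ MM _; apply: MM => //; exact: lreg_group_vN.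
  by rewrite -compA -left_regM mulgV left_reg1.
apply/funext => v; apply: ell2_ext => g.
have h : hdot H (x v) (delta R g) = 0.
  rewrite [LHS](sipC (positive_sip xl x0)).
  have -> : positive_sip xl x0 (delta R g) v = hsip H (x (delta R g)) v by [].
  by rewrite xd sip0l conjC0.
by move: h; rewrite (@dot_coord R G (x v) (delta R g) g).
Qed.

End group_trace_state.

(** * Monotone limits and normality of vector states *)

Section vector_state_normal.
Variables (R : realType) (H : hilbert R) (M : set (H -> H)).
Hypothesis MvN : vN_algebra M.
Local Notation N := (nrm (hsip H)).
Implicit Types x y : H -> H.

Lemma self_adjoint_real x v : self_adjoint x -> Im (hdot H (x v) v) = 0.
Proof.
by move=> sa; have := congr1 (@complex.Im R) (hdotC (x v) v); rewrite -(sa v v) ImJ; lra.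
Qed.

Lemma op_leP x y : self_adjoint x -> self_adjoint y ->
  op_le x y <-> forall v, Re (hdot H (x v) v) <= Re (hdot H (y v) v).
Proof.
move=> sx sy; split=> h v; have := h v; rewrite lecE; first by case/andP.
by rewrite !self_adjoint_real// eqxx.
Qed.

Lemma op_le_refl x : op_le x x. Proof. by move=> v. Qed.
Lemma op_le_trans x y z : op_le x y -> op_le y z -> op_le x z.
Proof. by move=> xy yz v; exact: le_trans (xy v) (yz v). Qed.

Section monotone_limit.
Variables (D : set (H -> H)) (x y0 : H -> H).
Hypotheses (DM : D `<=` M `&` self_adjoint (H := H)) (Dne : directed D) (Dy0 : D y0).
Hypotheses (Mx : M x) (sx : self_adjoint x) (Dx : forall y, D y -> op_le y x).

Let F := filter_from [set y | D y /\ op_le y0 y] (fun y => [set y' | D y' /\ op_le y y']).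

Let FF : ProperFilter F.
Proof.
apply: filter_from_proper; last by move=> y [Dy _]; exists y; split=> //; exact: op_le_refl.
apply: filter_from_filter; first by exists y0; split=> //; exact: op_le_refl.
move=> y y' [Dy hy] [Dy' hy']; have [z [Dz yz y'z]] := Dne.2 _ _ Dy Dy'.
exists z; first by split=> //; exact: op_le_trans yz.
by move=> w [Dw zw]; split; split=> //; [exact: op_le_trans yz zw|exact: op_le_trans y'z zw].
Qed.

Let bM y : M y -> bounded_op y. Proof. by case: MvN => h _ _ _ _ /h. Qed.
Let lM y : M y -> linear y. Proof. by move=> /bM /bounded_opP[]. Qed.

(** The positive operator [y' - y] lies below [x - y0], so one constant works in [positive_nrm_le]
    for all pairs above [y0]. *)
Let diff_bound : exists2 K : R, 0 <= K & forall y y' v, D y -> D y' ->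
  op_le y0 y -> op_le y y' ->
  N (y' v - y v) ^+ 2 <= K * (Re (hdot H (y' v) v) - Re (hdot H (y v) v)).
Proof.
have b0 : bounded_op ((-1) *: y0 + x).
  by apply: bounded_op_lin; apply: bM => //; case: (DM Dy0).
have /bounded_opP[_ [K K0 hK]] := b0; exists K => // y y' v Dy Dy' y0y yy'.
have [My sy] := DM Dy; have [My' sy'] := DM Dy'.
pose t := (-1) *: y + y'.
have tE w : t w = y' w - y w by rewrite [t w]/((-1) *: y w + y' w) scaleN1r addrC.
have dE w : hdot H (t w) w = hdot H (y' w) w - hdot H (y w) w.
  by rewrite tE; exact: (sipBl (hsip H)).
have tl : linear t by case/bounded_opP: (bounded_op_lin (-1) (bM My) (bM My')).
have t0 : op_le 0 t.
  move=> w; rewrite (_ : hdot H _ w = 0); last exact: (sip0l (hsip H)).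
  by rewrite dE subr_ge0.
rewrite -ReB -dE -tE; apply: (positive_nrm_le tl t0) => w.
have h1 : Re (hdot H (t w) w) <= Re (hdot H (((-1) *: y0 + x) w) w).
  have -> : hdot H (((-1) *: y0 + x) w) w = hdot H (x w) w - hdot H (y0 w) w.
    have -> : ((-1) *: y0 + x) w = x w - y0 w.
      by rewrite [LHS]/((-1) *: y0 w + x w) scaleN1r addrC.
    exact: (sipBl (hsip H)).
  rewrite dE !ReB.
  have [_ s0] := DM Dy0.
  have := (op_leP s0 sy).1 y0y w; have := (op_leP sy' sx).1 (Dx Dy') w; lra.
apply: le_trans h1 (le_trans (Re_sip_CS (hsip H) _ _) _).
by rewrite expr2 mulrA ler_wpM2r ?nrm_ge0.
Qed.

Let pointwise_limit v : exists l, forall e : R, 0 < e -> F [set y | N (l - y v) < e].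
Proof.
apply: (@hilbert_limit R H _ F (fun y => y v) FF) => e e0.
have [K K0 hK] := diff_bound.
pose E := [set Re (hdot H (y v) v) | y in D].
have Es : has_sup E.
  split; first by exists (Re (hdot H (y0 v) v)); exists y0.
  exists (Re (hdot H (x v) v)) => _ [y Dy <-].
  by have [_ sy] := DM Dy; exact: (op_leP sy sx).1 (Dx Dy) v.
pose d := (e / 2) ^+ 2 / (K + 1).
have K1 : 0 < K + 1 by rewrite ltr_wpDl.
have d0 : 0 < d by rewrite divr_gt0// exprn_gt0// divr_gt0.
have [_ [y1 Dy1 <-] h1] := sup_adherent d0 Es.
have [y2 [Dy2 y12 y02]] := Dne.2 _ _ Dy1 Dy0.
exists [set y' | D y' /\ op_le y2 y']; first by exists y2.
have close a : D a /\ op_le y2 a -> N (a v - y2 v) < e / 2.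
  move=> [Da y2a]; rewrite -ltr_sqr ?nnegrE ?nrm_ge0 ?divr_ge0 1?ltW//.
  apply: le_lt_trans (hK _ _ v Dy2 Da y02 y2a) _.
  have h2 : Re (hdot H (a v) v) <= sup E by apply: ub_le_sup; [case: Es|exists a].
  have [_ s1] := DM Dy1; have [_ s2] := DM Dy2.
  have h3 := (op_leP s1 s2).1 y12 v.
  apply: (@le_lt_trans _ _ (K * d)); first by rewrite ler_wpM2l//; lra.
  have <- : d * (K + 1) = (e / 2) ^+ 2 by rewrite divfK// gt_eqF.
  by rewrite mulrC ltr_pM2l// ltrDl.
move=> a b ha hb; apply: le_lt_trans (nrm_dist _ (y2 v) _ _) _.
by have := close a ha; have := close b hb; rewrite (nrmBC _ (b v)); lra.
Qed.

(** A bounded increasing net of self-adjoint operators converges strongly: for each [v] the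
    quadratic forms at [v] approach their supremum, and [diff_bound] converts this into the Cauchy
    property of [y v]. The limit is in [M] because [M] is strongly closed. *)
Lemma monotone_limit : exists z, [/\ M z, self_adjoint z,
  (forall y, D y -> op_le y z) &
  forall v (e : R), 0 < e -> exists2 y, D y & N (z v - y v) < e].
Proof.
have [z hz] := choice pointwise_limit; have PF : ProperFilter F := FF.
have Fs (s : seq H) (e : R) : 0 < e -> F [set y | forall v, v \in s -> N (z v - y v) < e].
  move=> e0; elim: s => [|v s ih]; first by apply: filterS filterT => y _ v.
  apply: filterS2 ih (hz v e e0) => y hs hv w.
  by rewrite inE => /orP[/eqP->|/hs].
have FD y1 : D y1 -> F [set y | D y /\ op_le y1 y].
  move=> Dy1; have [y2 [Dy2 y12 y02]] := Dne.2 _ _ Dy1 Dy0.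
  by exists y2 => // y [Dy h]; split=> //; exact: op_le_trans h.
have near (y1 : H -> H) (s : seq H) (e : R) : D y1 -> 0 < e -> exists y, [/\ D y, op_le y1 y &
    forall v, v \in s -> N (z v - y v) < e].
  move=> Dy1 e0; have [y [[Dy yy] hy]] := filter_ex (filterI (FD _ Dy1) (Fs s e e0)).
  by exists y.
have zl : linear z.
  move=> a u v; apply/eqP; rewrite -subr_eq0; apply/eqP/nrm_hsip_eq0.
  apply/le_anti; rewrite nrm_ge0 andbT; apply/ler_addgt0Pr => e e0; rewrite add0r.
  have a0 : 0 < normc a + 2 by rewrite ltr_wpDl// normc_ge0.
  have d0 : 0 < e / (normc a + 2) by rewrite divr_gt0.
  have dE : e / (normc a + 2) * (normc a + 2) = e by rewrite divfK// gt_eqF.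
  have [y [Dy _ hy]] := near _ [:: a *: u + v; u; v] _ Dy0 d0.
  set d := e / _ in d0 dE hy; have [My _] := DM Dy.
  have h1 : N (z (a *: u + v) - y (a *: u + v)) < d by apply: hy; rewrite !inE eqxx.
  have h2 : N (z u - y u) < d by apply: hy; rewrite !inE eqxx orbT.
  have h3 : N (z v - y v) < d by apply: hy; rewrite !inE eqxx !orbT.
  rewrite (lM My) in h1.
  have h4 := nrm_dist (hsip H) (a *: y u + y v) (z (a *: u + v)) (a *: z u + z v).
  apply: le_trans h4 _.
  have h5 : N (a *: y u + y v - (a *: z u + z v)) <=
      normc a * N (z u - y u) + N (z v - y v).
    rewrite opprD addrACA -scalerBr (le_trans (nrmD _ _ _))// nrmZ.
    by rewrite (nrmBC _ (y u)) (nrmBC _ (y v)).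
  have h6 : normc a * N (z u - y u) <= normc a * d by rewrite ler_wpM2l ?normc_ge0// ltW.
  lra.
have zb : bounded_op z.
  apply/bounded_opP; split=> //; have [K K0 hK] := diff_bound.
  have My0 : M y0 by case: (DM Dy0).
  have /bounded_opP[_ [K1 K10 hK1]] := bM My0.
  have /bounded_opP[_ [K2 K20 hK2]] := bM Mx.
  pose C := K1 + (K + K2 + K1); exists C => [|v]; first by rewrite /C; lra.
  apply/ler_addgt0Pr => e e0; have [y [Dy y0y hy]] := near _ [:: v] _ Dy0 e0.
  have [My sy] := DM Dy; have [_ s0] := DM Dy0.
  have h1 := hy v (mem_head _ _).
  have h2 := hK y0 y v Dy0 Dy (op_le_refl _) y0y.
  have h3 := (op_leP sy sx).1 (Dx Dy) v.
  have h4 := le_trans (Re_sip_CS (hsip H) (x v) v) (ler_wpM2r (nrm_ge0 _ v) (hK2 v)).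
  have h5 : - Re (hdot H (y0 v) v) <= K1 * N v * N v.
    rewrite -ReN hsipE -sipNl; apply: le_trans (Re_sip_CS _ _ _) _.
    by rewrite nrmN ler_wpM2r ?nrm_ge0.
  have h6 : N (y v - y0 v) <= (K + K2 + K1) * N v.
    have n0 := nrm_ge0 (hsip H) v.
    rewrite -ler_sqr ?nnegrE ?nrm_ge0//; last by rewrite mulr_ge0//; lra.
    apply: le_trans h2 _.
    apply: (@le_trans _ _ (K * ((K2 + K1) * N v ^+ 2))).
      rewrite ler_wpM2l// expr2; rewrite -hsipE in h4; lra.
    rewrite exprMn mulrA ler_wpM2r ?sqr_ge0//.
    have := mulr_ge0 K0 K0; have := mulr_ge0 K0 K10; have := mulr_ge0 K0 K20.
    have := sqr_ge0 (K2 + K1); rewrite !expr2; lra.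
  have h7 := nrm_dist (hsip H) (y v) (z v) 0.
  have h8 := nrm_dist (hsip H) (y0 v) (y v) 0.
  have := hK1 v; rewrite !subr0 in h7 h8 *; rewrite /C; lra.
have Mz : M z.
  case: MvN => _ _ _ _ [_ h]; apply: h; apply/sot_closureP; split=> // s e e0.
  by have [y [Dy _ hy]] := near _ s _ Dy0 e0; exists y => //; case: (DM Dy).
have dot_le y v w (e : R) : N (z v - y v) < e ->
    normc (hdot H (z v) w - hdot H (y v) w) <= e * N w.
  move=> h; rewrite !hsipE -sipBl; apply: le_trans (sip_CS _ _ _) _.
  by rewrite ler_wpM2r ?nrm_ge0// ltW.
have sz : self_adjoint z.
  move=> u v; apply/eqP; rewrite -subr_eq0; apply/eqP/eq0_normc.
  apply/le_anti; rewrite normc_ge0 andbT; apply/ler_addgt0Pr => e e0; rewrite add0r.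
  have n0 : 0 < N u + N v + 1 by rewrite ltr_wpDl// addr_ge0// nrm_ge0.
  have d0 : 0 < e / (N u + N v + 1) by rewrite divr_gt0.
  have dE : e / (N u + N v + 1) * (N u + N v + 1) = e by rewrite divfK// gt_eqF.
  have [y [Dy _ hy]] := near _ [:: u; v] _ Dy0 d0; set d := e / _ in d0 dE hy.
  have [_ sy] := DM Dy.
  have h1 := @dot_le y u v d (hy u (mem_head _ _)).
  have h2 : normc (hdot H (z v) u - hdot H (y v) u) <= d * N u.
    by apply: dot_le; apply: hy; rewrite !inE eqxx orbT.
  have h3 : normc (hdot H u (y v) - hdot H u (z v)) <= d * N u.
    rewrite -normcN opprB (hdotC u (z v)) (hdotC u (y v)) -rmorphB /= normc_conj.
    exact: h2.
  have -> : hdot H (z u) v - hdot H u (z v) =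
      (hdot H (z u) v - hdot H (y u) v) + (hdot H u (y v) - hdot H u (z v)).
    by rewrite (sy u v) addrA subrK.
  apply: le_trans (normc_le_add _ _) _; lra.
exists z; split=> //; last first.
  move=> v e e0; have [y [Dy _ hy]] := near _ [:: v] _ Dy0 e0.
  by exists y => //; apply: hy; exact: mem_head.
move=> y1 Dy1; have [_ s1] := DM Dy1; apply/op_leP => // v.
apply/ler_addgt0Pr => e e0.
have n0 : 0 < N v + 1 by rewrite ltr_wpDl// nrm_ge0.
have d0 : 0 < e / (N v + 1) by rewrite divr_gt0.
have [y [Dy y1y hy]] := near _ [:: v] _ Dy1 d0.
have [_ sy] := DM Dy.
have h1 := @dot_le y v v _ (hy v (mem_head _ _)).
have h2 := (op_leP s1 sy).1 y1y v.
have h3 := Re_le_normc (- (hdot H (z v) v - hdot H (y v) v)).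
rewrite normcN ReN ReB in h3.
have dE : e / (N v + 1) * (N v + 1) = e by rewrite divfK// gt_eqF.
set d := e / _ in d0 dE h1; lra.
Qed.

End monotone_limit.

(** The strong limit [z] of [D] is an upper bound in [M], so it dominates the least upper bound [x];
    its quadratic form at [xi] is a limit of values bounded by [c]. *)
Lemma vector_state_normal (xi : H) : normal_functional M (fun x => hdot H (x xi) xi).
Proof.
move=> D x DM Ddir Mx sx [Dx lub] c hc.
have [[y0 Dy0] _] := Ddir.
have [z [Mz sz zD hz]] := monotone_limit DM Ddir Dy0 Mx sx Dx.
have xz := lub z Mz sz zD.
apply: le_trans (xz xi) _.
(* In the order of [R[i]], an upper bound of a real number is real. *)
have Ic : Im c = 0.
  have := hc _ Dy0; rewrite lecE => /andP[/eqP h _].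
  by have [_ s0] := DM _ Dy0; rewrite h self_adjoint_real.
rewrite lecE Ic self_adjoint_real// eqxx /=.
apply/ler_addgt0Pr => e e0.
have n0 : 0 < N xi + 1 by rewrite ltr_wpDl// nrm_ge0.
have d0 : 0 < e / (N xi + 1) by rewrite divr_gt0.
have dE : e / (N xi + 1) * (N xi + 1) = e by rewrite divfK// gt_eqF.
have [y Dy hy] := hz xi _ d0.
have := hc _ Dy; rewrite lecE => /andP[_ h1].
have h2 := Re_sip_CS (hsip H) (z xi - y xi) xi.
rewrite sipBl ReB -!hsipE in h2.
have h3 : N (z xi - y xi) * N xi <= e / (N xi + 1) * N xi.
  by rewrite ler_wpM2r ?nrm_ge0// ltW.
set d := e / _ in d0 dE h3; lra.
Qed.

End vector_state_normal.

Section group_tracial.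
Variables (R : realType) (G : groupType).

Lemma group_tracial : tracial_vN_algebra (@group_vN_algebra R G) (@group_trace R G).
Proof.
split; first exact: group_vN.
split.
- by move=> a x y _ _; exact: group_trace_lin.
- by rewrite -left_reg1 group_trace_lreg eqxx.
- move=> x Mx /(_ (delta R 1%g)).
  have -> : hdot (ell2_hilbert R G) ((0 : ell2_hilbert R G -> ell2_hilbert R G)
      (delta R 1%g)) (delta R 1%g) = 0 by exact: (sip0l (hsip (ell2_hilbert R G))).
  exact.
- exact: group_trace_comp.
split; first exact: group_trace_faithful.
exact: (vector_state_normal (group_vN R G)).
Qed.

End group_tracial.

(** * Microstates of the generators *)

Section letters.
Variables (R : realType) (p : nat).

(* The generators lambda(s_j) are recovered from their real and imaginary parts,
   stored at the positions [lshift p j] and [rshift p j]. *)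
Definition letter_coef (l : 'I_p * bool) : R[i] := (if l.2 then 'i else - 'i)%C.

Section eval.
Variables (A : lmodType R[i]) (one : A) (mul : A -> A -> A).
Implicit Types (X : 'I_(p + p) -> A) (w : word p) (m : seq 'I_(p + p)).

Definition letter_ev X l : A := X (lshift p l.1) + letter_coef l *: X (rshift p l.1).
Definition mono_ev X m : A := foldr (fun j a => mul (X j) a) one m.
Definition word_ev X w : A := foldr (fun l a => mul (letter_ev X l) a) one w.

End eval.

(** A law evaluates polynomials in the self-adjoint variables, so a word in the generators is
    multiplied out into monomials in their real and imaginary parts, listed with coefficients. *)
Fixpoint expansion (w : word p) : seq (R[i] * seq 'I_(p + p)) :=
  if w is l :: w' then
    [seq (cm.1, lshift p l.1 :: cm.2) | cm <- expansion w'] ++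
    [seq (letter_coef l * cm.1, rshift p l.1 :: cm.2) | cm <- expansion w']
  else [:: (1, [::])].

(** Linearity of [mul] in its second argument is asked only when the first is some [X j]:
    composition of functions has it when the operators [X j] are linear, so operators and matrices
    are treated together. *)
Lemma word_evE (A : lmodType R[i]) (one : A) (mul : A -> A -> A) X w :
    (forall a x y z, mul (x + a *: y) z = mul x z + a *: mul y z) ->
    (forall j, linear (mul (X j))) ->
  word_ev one mul X w = \sum_(cm <- expansion w) cm.1 *: mono_ev one mul X cm.2.
Proof.
move=> mull mulr; elim: w => [|l w ih]; first by rewrite big_seq1 scale1r.
have -> : word_ev one mul X (l :: w) =
  mul (X (lshift p l.1) + letter_coef l *: X (rshift p l.1)) (word_ev one mul X w) by [].
rewrite mull ih !(lin_sum (mulr _)).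
rewrite big_cat !big_map /= scaler_sumr.
by congr (_ + _); apply: eq_bigr => cm _; rewrite (linZ (mulr _)) ?scalerA.
Qed.

Lemma normc_letter_coef l : normc (letter_coef l) = 1.
Proof.
by rewrite /letter_coef; case: l.2; rewrite /= ?oppr0 ?sqrrN expr0n expr1n add0r sqrtr1.
Qed.

Lemma expansion_norm w : \sum_(cm <- expansion w) normc cm.1 = 2 ^+ size w.
Proof.
elim: w => [|l w ih]; first by rewrite big_seq1 normc1 expr0.
rewrite big_cat !big_map /= ih exprS mulr_natl mulr2n; congr (_ + _).
by rewrite -ih; apply: eq_bigr => cm _; rewrite normcM normc_letter_coef mul1r.
Qed.

Lemma expansion_size w cm : cm \in expansion w -> size cm.2 = size w.
Proof.
elim: w cm => [|l w ih] cm /=; first by rewrite inE => /eqP->.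
by rewrite mem_cat => /orP[] /mapP[cm' /ih h ->] /=; rewrite h.
Qed.

End letters.

Section words_upto.
Variables (T : finType) (n : nat).
Definition words_upto : seq (seq T) :=
  flatten [seq [seq tval t | t <- enum {: k.-tuple T}] | k <- iota 0 n.+1].

Lemma mem_words_upto w : (size w <= n)%N -> w \in words_upto.
Proof.
move=> wn; apply/flatten_mapP; exists (size w); first by rewrite mem_iota.
by apply/mapP; exists (in_tuple w); rewrite ?mem_enum.
Qed.
End words_upto.

Section generators.
Variables (R : realType) (G : groupType) (p : nat) (s : 'I_p -> G).
Hypothesis gen : forall g, exists w, word_val s w = g.
Local Notation H := (ell2_hilbert R G).
Local Notation L := (@lreg R G).
Local Notation N := (nrm (hsip H)).
Local Notation M := (@group_vN_algebra R G).

Definition re_part (g : G) : H -> H := 2^-1 *: (L g + L g^-1%g).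
Definition im_part (g : G) : H -> H := (- 'i * 2^-1)%C *: (L g - L g^-1%g).

Definition generator (j : 'I_(p + p)) : H -> H :=
  match fintype.split j with inl i => re_part (s i) | inr i => im_part (s i) end.

Lemma generator_l i : generator (lshift p i) = re_part (s i).
Proof. by rewrite /generator (unsplitK (inl i)). Qed.
Lemma generator_r i : generator (rshift p i) = im_part (s i).
Proof. by rewrite /generator (unsplitK (inr i)). Qed.

Lemma letter_ev_generator l : letter_ev generator l = L (letter_val s l).
Proof.
rewrite /letter_ev generator_l generator_r /re_part /im_part scalerA.
have h2 : 2^-1 + 2^-1 = 1 :> R[i] by rewrite [RHS]splitr mul1r.
have ii : ('i * (- 'i * 2^-1) = 2^-1 :> R[i])%C.
  by rewrite mulNr mulrN mulrA -expr2 sqr_i mulN1r opprK.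
have main (x y : H -> H) : 2^-1 *: (x + y) + 2^-1 *: (x - y) = x.
  by rewrite -scalerDr addrACA subrr addr0 scalerDr -scalerDl h2 scale1r.
rewrite /letter_coef /letter_val; case: l.2; first by rewrite ii main.
have -> : (- 'i * (- 'i * 2^-1) = - 2^-1 :> R[i])%C by rewrite mulNr ii.
by rewrite scaleNr -scalerN opprB (addrC (L _)) main.
Qed.

Lemma group_vN_lin a x y : M x -> M y -> M (a *: x + y).
Proof. by have [_ _ h _ _] := group_vN R G; exact: h. Qed.

Lemma group_vN_generator j : M (generator j).
Proof.
have M0 : M 0 by rewrite -(addNr idfun) -scaleN1r; apply: group_vN_lin;
  have [_ M1 _ _ _] := group_vN R G.
have MZ a x : M x -> M (a *: x) by move=> Mx; rewrite -[_ *: _]addr0; exact: group_vN_lin.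
have Ml := @lreg_group_vN R G.
rewrite /generator; case: (fintype.split j) => i; apply: MZ.
  by rewrite -[L _]scale1r; exact: group_vN_lin.
by rewrite addrC -scaleN1r; exact: group_vN_lin.
Qed.

Lemma half_conj : (2^-1 : R[i])^* = 2^-1.
Proof. by rewrite fmorphV rmorph_nat. Qed.

Lemma generator_self_adjoint j : self_adjoint (generator j).
Proof.
have adj g u v : hdot H (L g u) v = hdot H u (L g^-1%g v).
  by have := rep_adj (lreg_rep R G) g^-1 u v; rewrite invgK.
have adjV g u v : hdot H (L g^-1%g u) v = hdot H u (L g v).
  exact: (rep_adj (lreg_rep R G)).
rewrite /generator; case: (fintype.split j) => i u v.
  rewrite [re_part _ u]/(2^-1 *: (L (s i) u + L (s i)^-1%g u)).
  rewrite [re_part _ v]/(2^-1 *: (L (s i) v + L (s i)^-1%g v)).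
  rewrite !hsipE !(sipZl, sipDl, sipZr, sipDr) -!hsipE adj adjV addrC.
  by rewrite half_conj.
rewrite [im_part _ u]/((- 'i * 2^-1)%C *: (L (s i) u - L (s i)^-1%g u)).
rewrite [im_part _ v]/((- 'i * 2^-1)%C *: (L (s i) v - L (s i)^-1%g v)).
rewrite !hsipE !(sipZl, sipBl, sipZr, sipBr) -!hsipE adj adjV.
have -> : (- 'i * 2^-1 : R[i])%C^* = - (- 'i * 2^-1 : R[i])%C.
  rewrite rmorphM /= half_conj -mulNr; congr (_ * _).
  by rewrite opprK conjCE; apply: complexP; rewrite /= ?oppr0 ?opprK.
by rewrite [RHS]mulNr -[RHS]mulrN opprB.
Qed.

Lemma generator_opnorm j : (opnorm (generator j) <= 1%:E)%E.
Proof.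
apply: ge_ereal_sup => _ [v v1 <-]; rewrite lee_fin hnormE /=.
have {}v1 : N v <= 1 by rewrite -hnorm_leE; exact: v1.
apply: le_trans (_ : N v <= 1) => //.
have half (a : R[i]) (x y : H) : normc a = 2^-1 -> N x = N v -> N y = N v ->
    N (a *: (x + y)) <= N v.
  move=> ha hx hy; rewrite nrmZ ha; have := nrmD (hsip H) x y; rewrite hx hy; lra.
have n2 : normc (2^-1 : R[i]) = 2^-1.
  by rewrite -[2]/(2%:R) -(rmorph_nat (real_complex R)) -fmorphV normc_real ger0_norm// invr_ge0.
rewrite /generator; case: (fintype.split j) => i.
  exact: (half _ (L (s i) v) (L (s i)^-1%g v) n2 (lreg_nrm _ _) (lreg_nrm _ _)).
apply: (half _ (L (s i) v) (- L (s i)^-1%g v) _ (lreg_nrm _ _)); last by rewrite nrmN lreg_nrm.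
by rewrite normcM n2 normcN /= expr0n expr1n add0r sqrtr1 mul1r.
Qed.

Lemma generatorP : generates generator M.
Proof.
apply/seteqP; split=> [x Mx|x]; last first.
  apply; split; first exact: group_vN.
  by move=> _ [j _ <-]; exact: group_vN_generator.
move=> A [[Ab A1 AD AM [_ Acl]] Agen].
have Ag j : A (generator j) by apply: Agen; exists j.
have Al l : A (L (letter_val s l)).
  by rewrite -letter_ev_generator /letter_ev addrC; exact: AD.
have AL g : A (L g).
  have [w <-] := gen g; elim: w => [|l w ih]; first by rewrite left_reg1.
  by rewrite /= left_regM; exact: AM.
have A0 : A 0 by rewrite -(addNr idfun) -scaleN1r; exact: AD.
have AS : lreg_span (R := R) (G := G) `<=` A.
  move=> _ [t [c ->]]; elim: t => [|g t ih]; first by rewrite big_nil.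
  by rewrite big_cons; exact: AD.
apply: Acl; move/sot_closureP: Mx => [bx hx]; apply/sot_closureP; split=> // t e e0.
by have [y /AS Ay xy] := hx t e e0; exists y.
Qed.

End generators.

Section mono_poly.
Variables (R : realType) (p : nat).

Definition mono_poly (m : seq 'I_(p + p)) : ncpoly R (p + p) :=
  monalg.mkmalgU (monalg.FMonom m) 1.

Lemma nceval_mono (A : lmodType R[i]) (one : A) (mul : A -> A -> A) X m :
  nceval one mul X (mono_poly m) = mono_ev one mul X m.
Proof. exact: malg_extU. Qed.

End mono_poly.

Section law_words.
Variables (R : realType) (G : groupType) (p : nat) (s : 'I_p -> G).
Local Notation x := (@generator R G p s).
Local Notation tau := (@group_trace R G).

Lemma word_ev_generator w : word_ev idfun (fun y z => y \o z) x w = lreg (word_val s w).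
Proof.
elim: w => [|l w ih]; first by rewrite left_reg1.
rewrite [LHS]/(letter_ev x l \o word_ev idfun (fun y z => y \o z) x w).
by rewrite ih letter_ev_generator [RHS]left_regM.
Qed.

Lemma law_word w : \sum_(cm <- expansion R w) cm.1 * law tau x (mono_poly R cm.2) =
  (word_val s w == 1%g)%:R.
Proof.
rewrite -group_trace_lreg -word_ev_generator word_evE //; last first.
  move=> j a y z; apply/funext => v.
  have /bounded_opP[xl _] : bounded_op (x j).
    by have [h _ _ _ _] := group_vN R G; apply: h; exact: group_vN_generator.
  by rewrite /comp xl.
rewrite group_trace_sum; apply: eq_bigr => cm _.
by rewrite /law nceval_mono.
Qed.

Variable n : nat.
Local Notation M := 'M[R[i]]_n.
Implicit Types X : 'I_(p + p) -> M.

Lemma ntr_linear : linear (fun A : M => ntr A : R[i]^o).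
Proof. by move=> a A B; rewrite /ntr mxtraceD mxtraceZ mulrDr mulrCA. Qed.

Definition letters X (i : 'I_p) : M := X (lshift p i) + 'i%C *: X (rshift p i).

Lemma word_mx_ev X w : (forall j, (X j)^H = X j) ->
  word_mx (letters X) w = word_ev 1%:M mulmx X w.
Proof.
move=> Xh; elim: w => [//|l w ih].
rewrite [LHS]/(letter_mx (letters X) l *m word_mx (letters X) w) ih.
rewrite [RHS]/(letter_ev X l *m word_ev 1%:M mulmx X w); congr (_ *m _).
rewrite /letter_mx /letter_ev /letter_coef /letters; case: l.2 => //.
apply/matrixP => i j; rewrite mxadjE !mx_addE !mx_scaleE rmorphD rmorphM /=.
by rewrite -!mxadjE !Xh; congr (_ + _ * _); rewrite conjCE; apply: complexP; rewrite /= ?oppr0.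
Qed.

Lemma ntr_word X w : (forall j, (X j)^H = X j) ->
  ntr (word_mx (letters X) w) =
    \sum_(cm <- expansion R w) cm.1 * mxlaw X (mono_poly R cm.2).
Proof.
move=> Xh; rewrite word_mx_ev // word_evE; last 2 first.
- by move=> a A B C; rewrite mulmxDl -scalemxAl.
- by move=> j a A B; rewrite mulmxDr -scalemxAr.
rewrite [LHS](lin_sum ntr_linear); apply: eq_bigr => cm _.
rewrite [LHS](linZ ntr_linear) /mxlaw nceval_mono //.
Qed.

(** Each monomial errs by at most [d], and the moduli of the coefficients in the expansion of [w]
    sum to [2 ^+ size w]. *)
Lemma ntr_word_near X w L (d : R) : (forall j, (X j)^H = X j) ->
    (forall m, (size m <= L)%N ->
      normc (law tau x (mono_poly R m) - mxlaw X (mono_poly R m)) <= d) ->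
    (size w <= L)%N ->
  normc (ntr (word_mx (letters X) w) - (word_val s w == 1%g)%:R) <= 2 ^+ size w * d.
Proof.
move=> Xh near wL; rewrite ntr_word // -law_word -sumrB -(expansion_norm R w) mulr_suml.
rewrite !big_seq; elim/big_ind2 : _ => [|u1 v1 u2 v2 h1 h2|cm cmw].
- by rewrite (_ : normc 0 = 0)//; exact: normc0.
- by apply: le_trans (normc_le_add _ _) _; exact: lerD.
rewrite -mulrBr normcM ler_wpM2l ?normc_ge0// -normcN opprB; apply: near.
by rewrite (expansion_size cmw).
Qed.

End law_words.

(** * Replacing nearly unitary tuples by unitary ones *)

Section nearby_unitary_tuple.
Variables (R : realType) (G : groupType) (p : nat) (s : 'I_p -> G) (n N : nat).
Local Notation M := 'M[R[i]]_n.
Local Notation m2 := (nrm (mx_sip R n)).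
Variables (Y : 'I_p -> M) (d eta : R).
(** The squared 2-norm of a word of length [N] is a trace of a word of length [2 * N], and the
    unitarity defect of a single letter involves a word of length 4; hence the range [2 * N + 4]. *)
Hypothesis near : forall w : word p, (size w <= 2 * N + 4)%N ->
  normc (ntr (word_mx Y w) - (word_val s w == 1%g)%:R) <= 2 ^+ size w * d.
Hypotheses (eta0 : 0 < eta) (d0 : 0 <= d) (deta : 24 * d <= eta ^+ 2)
  (dN : 2 ^+ (2 * N) * d <= 1) (dN1 : 4 * eta * N%:R + 2 ^+ N * d <= N.+1%:R^-1).

Lemma size_gram (w : word p) : size (word_inv w ++ w) = (2 * size w)%N.
Proof. by rewrite size_cat /word_inv size_rev size_map mul2n addnn. Qed.

Lemma word_gram_val (w : word p) : word_val s (word_inv w ++ w) = 1%g.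
Proof. by rewrite word_val_cat word_val_inv mulVg. Qed.

Lemma word_gram w : m2 (word_mx Y w) ^+ 2 = Re (ntr (word_mx Y (word_inv w ++ w))).
Proof. by rewrite nrm_sqr mx_sipE word_mx_cat word_mx_inv. Qed.

Lemma near_gram w : (2 * size w <= 2 * N + 4)%N ->
  Re (ntr (word_mx Y (word_inv w ++ w))) <= 1 + 2 ^+ (2 * size w) * d.
Proof.
rewrite -size_gram => /near; rewrite word_gram_val eqxx => h.
have := le_trans (Re_le_normc _) h; rewrite ReB /=; lra.
Qed.

Lemma m2_word_le w : (size w <= N)%N -> m2 (word_mx Y w) <= 2.
Proof.
move=> wN; rewrite -ler_sqr ?nnegrE ?nrm_ge0// word_gram.
have /near_gram h : (2 * size w <= 2 * N + 4)%N by lia.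
apply: le_trans h _.
have h2 : 2 ^+ (2 * size w) * d <= 2 ^+ (2 * N) * d.
  by rewrite ler_wpM2r// ler_weXn2l ?ler1n// leq_mul2l wN orbT.
by move: (le_trans h2 dN); set a := _ * d; lra.
Qed.

Lemma near_unitary_defect j : m2 ((Y j)^H *m Y j - 1%:M) <= eta.
Proof.
pose v : word p := [:: (j, false); (j, true)].
have -> : (Y j)^H *m Y j = word_mx Y v by rewrite /word_mx /= /letter_mx /= mx1r.
rewrite -ler_sqr ?nnegrE ?nrm_ge0 ?(ltW eta0)//.
(* In the expansion of the squared norm, the words of length 4 and 2 err by [16 * d] and [4 * d];
   the second counts twice, for a total of [24 * d]. *)
apply: le_trans deta; rewrite nrm_sqrB word_gram mx_sipE trC1 mx1l.
have /near_gram h1 : (2 * size v <= 2 * N + 4)%N by rewrite /=; lia.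
have /near h2 : (size v <= 2 * N + 4)%N by rewrite /=; lia.
have v1 : word_val s v = 1%g by rewrite /word_val /= /letter_val /= mulg1 mulVg.
rewrite v1 eqxx -normcN opprB in h2.
have := le_trans (Re_le_normc _) h2; rewrite ReB [Re 1%:R]/=.
have m1 : m2 1%:M ^+ 2 <= 1 by rewrite expr_le1 ?nrm_ge0// m2_1_le.
have e4 : 2 ^+ (2 * size v) = 16 :> R by rewrite -[(2 * _)%N]/4%N; ring.
have e2 : 2 ^+ size v = 4 :> R by rewrite -[size v]/2%N; ring.
move: h1; rewrite e4 e2; set a := Re _; set b := Re (ntr _); set c := _ ^+ 2 in m1 *.
move=> h1 h2'; lra.
Qed.

(** Letters are exchanged one at a time. The unitary [P] absorbs the letters already exchanged, and
    the remaining word in [Y] has 2-norm at most 2, so by Cauchy-Schwarz each exchange costs at most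
    [2 * eta * 2] in the trace. *)
Lemma telescope (U : 'I_p -> M) (P : M) w : unitary_tuple U -> P \is unitarymx ->
    (forall j, m2 (Y j - U j) <= 2 * eta) -> (size w <= N)%N ->
  normc (ntr (P *m (word_mx U w - word_mx Y w))) <= 4 * eta * (size w)%:R.
Proof.
move=> Uu + YU; elim: w P => [|l w ih] P Pu wN.
  have -> : P *m (word_mx U [::] - word_mx Y [::]) = 0.
    by rewrite mxBr subrr.
  by rewrite /ntr mxtrace0 mulr0 normc0 mulr0.
have -> : P *m (word_mx U (l :: w) - word_mx Y (l :: w)) =
    (P *m letter_mx U l) *m (word_mx U w - word_mx Y w) +
    (P *m (letter_mx U l - letter_mx Y l)) *m word_mx Y w.
  rewrite [word_mx U (l :: w)]/(letter_mx U l *m word_mx U w).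
  rewrite [word_mx Y (l :: w)]/(letter_mx Y l *m word_mx Y w).
  by rewrite !mxBr mxBl !mxA subrKA.
have -> (A B : M) : ntr (A + B) = ntr A + ntr B by rewrite /ntr mxtraceD mulrDr.
apply: le_trans (normc_le_add _ _) _.
have h1 := ih _ (unitM Pu (letter_mx_unitary l Uu)) (ltnW wN).
have h2 : normc (ntr (P *m (letter_mx U l - letter_mx Y l) *m word_mx Y w)) <= 2 * eta * 2.
  rewrite ntrC -[P *m _]trCK ntrC -mx_sipE.
  apply: le_trans (sip_CS _ _ _) _; rewrite m2_trC (m2_mulUl _ Pu) mulrC.
  have h3 : m2 (letter_mx U l - letter_mx Y l) <= 2 * eta.
    rewrite nrmBC /letter_mx; case: l.2; first exact: YU.
    have -> : (Y l.1)^H - (U l.1)^H = (Y l.1 - U l.1)^H.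
      by rewrite trCB.
    by rewrite m2_trC; exact: YU.
  by apply: ler_pM; rewrite ?nrm_ge0//; exact: m2_word_le (ltnW wN).
have -> : (size (l :: w))%:R = (size w)%:R + 1 :> R by rewrite -natr1.
move: h1 h2; set a := normc _; set b := normc _; lra.
Qed.

Lemma nearby_unitary_tuple : exists U : 'I_p -> M,
  good s N U /\ forall j, m2 (Y j - U j) <= 2 * eta.
Proof.
have /choice[U hU] j : exists U : M, U \is unitarymx /\ m2 (Y j - U) <= 2 * eta.
  have [U Uu hU] := near_unitary (Y j) eta0; exists U; split=> //.
  by have := near_unitary_defect j; move: hU; lra.
have Uu : unitary_tuple U by move=> j; case: (hU j).
exists U; split; last by move=> j; case: (hU j).
split=> // w wN w1.
have h1 := telescope Uu (mx1_unitary R n) (fun j => (hU j).2) wN.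
rewrite mx1l in h1.
have /near h2 : (size w <= 2 * N + 4)%N by lia.
rewrite w1 eqxx in h2.
have -> : ntr (word_mx U w) - 1 =
    ntr (word_mx U w - word_mx Y w) + (ntr (word_mx Y w) - 1).
  have -> : ntr (word_mx U w - word_mx Y w) = ntr (word_mx U w) - ntr (word_mx Y w).
    by exact: (linB (@ntr_linear R n)).
  by rewrite addrA subrK.
apply: le_trans (normc_le_add _ _) _; apply: le_trans dN1; apply: lerD.
  by apply: le_trans h1 _; rewrite ler_wpM2l ?ler_nat// mulr_ge0// ltW.
by apply: le_trans h2 _; rewrite ler_wpM2r// ler_weXn2l ?ler1n.
Qed.

End nearby_unitary_tuple.

Section hermitian_parts.
Variables (R : realType) (n p : nat).
Local Notation M := 'M[R[i]]_n.
Local Notation m2 := (nrm (mx_sip R n)).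

(** The inner product of two Hermitian matrices is real, so the factor ['i] makes the cross term
    purely imaginary. *)
Lemma m2_hermitian_parts (A B : M) : A^H = A -> B^H = B ->
  m2 (A + 'i%C *: B) ^+ 2 = m2 A ^+ 2 + m2 B ^+ 2.
Proof.
move=> Ah Bh; rewrite nrm_sqrD nrmZ.
have -> : normc ('i%C : R[i]) = 1 by rewrite /= expr0n expr1n add0r sqrtr1.
have h : Im (mx_sip R n A B) = 0.
  have := congr1 (@complex.Im R) (sipC (mx_sip R n) A B); rewrite ImJ.
  rewrite [mx_sip _ _ B A]mx_sipE Ah ntrC -[X in _ *m X]Ah -[X in ntr (X *m _)]Bh.
  by rewrite Ah -mx_sipE; lra.
by rewrite sipZr ReM h mul1r conjCE /= mulr0 subr0 mul0r mulr0 addr0.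
Qed.

Lemma hermsymmxP (A : M) : A \is hermsymmx -> A^H = A.
Proof. by move=> /is_hermitianmxP; rewrite expr0 scale1r => {2}->. Qed.

Lemma norm2_le (X X' : 'I_(p + p) -> M) (Z : M) (t : R) : 0 <= t ->
    (forall j, (X j)^H = X j) -> (forall j, (X' j)^H = X' j) ->
    (forall i, m2 (letters X i - Z *m letters X' i *m Z^H) <= t) ->
  norm2 (fun j => X j - Z *m X' j *m Z^t*) ^+ 2 <= p%:R * t ^+ 2.
Proof.
move=> t0 Xh X'h hD; pose D j := X j - Z *m X' j *m Z^H.
have Dh j : (D j)^H = D j.
  by rewrite /D trCB !trCM trCK Xh X'h mxA.
have E : Re (\sum_j ntr ((D j)^H *m D j)) = \sum_j m2 (D j) ^+ 2.
  by rewrite Re_sum; apply: eq_bigr => j _; rewrite nrm_sqr mx_sipE.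
rewrite /norm2 sqr_sqrtr; last first.
  by rewrite [X in _ <= Re X](_ : _ = \sum_j ntr ((D j)^H *m D j)) // E sumr_ge0// => j _; exact: sqr_ge0.
rewrite [X in Re X](_ : _ = \sum_j ntr ((D j)^H *m D j)) // E big_split_ord /= -big_split /=.
apply: (@le_trans _ _ (\sum_(i < p) t ^+ 2)); last by rewrite sumr_const card_ord mulr_natl.
apply: ler_sum => i _; rewrite -m2_hermitian_parts //.
rewrite ler_sqr ?nnegrE ?nrm_ge0//; apply: le_trans (hD i).
rewrite le_eqVlt; apply/orP; left; apply/eqP; congr (m2 _).
rewrite /D /letters mxDr mxDl mxZr mxZl scalerBr opprD !addrA; congr (_ - _).
by rewrite -!addrA; congr (_ + _); rewrite addrC.
Qed.

Lemma letters_close (X X' : 'I_(p + p) -> M) (U U' : 'I_p -> M) (Z : M) (e d : R) :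
    Z \is unitarymx ->
    (forall j, m2 (letters X j - U j) <= e) -> (forall j, m2 (letters X' j - U' j) <= e) ->
    (forall j, m2 (U j - Z *m U' j *m Z^H) <= d) ->
  forall j, m2 (letters X j - Z *m letters X' j *m Z^H) <= e + d + e.
Proof.
move=> Zu XU X'U' UU' j.
apply: le_trans (nrm_dist _ (U j) _ _) _; rewrite -(addrA e d e); apply: lerD; first exact: XU.
apply: le_trans (nrm_dist _ (Z *m U' j *m Z^H) _ _) _; apply: lerD; first exact: UU'.
rewrite -mxBl -mxBr (m2_mulUr _ (unitarymx_trC Zu)) (m2_mulUl _ Zu) nrmBC; exact: X'U'.
Qed.

End hermitian_parts.

Section covering.
Variables (R : realType) (d n : nat).
Local Notation T := ('I_d -> 'M[R[i]]_n).

(** One representative per class gives a cover. [Korb] asks for its exact cardinality, which can be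
    smaller than [K], whence the auxiliary [k]. *)
Lemma Korb_le_cells (e : R) (W : set T) (K : nat) :
    cells W (fun A B => exists2 V : 'M[R[i]]_n, V \is unitarymx &
      norm2 (fun j => A j - V *m B j *m V^t*) < e) K ->
  (Korb e W <= K%:R%:E)%E.
Proof.
move=> [c [cK ce]]; pose rep i : T := xget (fun=> 0) [set A | W A /\ c A = i].
pose Xi := rep @` `I_K.
have Xf : finite_set Xi by apply: finite_image; exact: finite_II.
have [k Xk] := Xf.
have kK : (k <= K)%N.
  by rewrite -card_le_II -(card_le_eql Xk) card_image_le.
apply: (@le_trans _ _ k%:R%:E); last by rewrite lee_fin ler_nat.
apply: ereal_inf_lbound; exists k => //; exists Xi => // A WA.
have [WB cB] : W (rep (c A)) /\ c (rep (c A)) = c A.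
  exact: (@xgetPex T (fun=> 0) [set B | W B /\ c B = c A] (ex_intro _ A (conj WA erefl))).
have [V Vu h] := ce _ _ WA WB (esym cB).
by exists (rep (c A)), V; split=> //; exists (c A) => //; exact: cK.
Qed.

Lemma lne_Korb_le (e : R) (W : set T) (E : nat) :
  (Korb e W <= (2 ^ E)%:R%:E)%E -> (lne (Korb e W) <= (E%:R * ln 2)%:E)%E.
Proof.
move=> h; have -> : (E%:R * ln 2)%:E = lne ((2 ^ E)%:R%:E : \bar R).
  rewrite lne_EFin ?ltr0n ?expn_gt0// natrX lnXn ?ltr0n// mulr_natl //.
have K0 : (0 <= Korb e W)%E by apply: le_ereal_inf_tmp => _ [k _ <-]; rewrite lee_fin ler0n.
by rewrite lee_lne // in_itv /= ?K0 ?leey // lee_fin ler0n.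
Qed.

End covering.

Lemma limn_esup_le (R : realType) (u : nat -> \bar R) (C : \bar R) (k : nat) :
  (forall n, (k <= n)%N -> (u n <= C)%E) -> (limn_esup u <= C)%E.
Proof.
move=> h; rewrite limn_esup_lim; apply: lime_le; first exact: is_cvg_esups.
exists k => // m km; apply: ge_ereal_sup => _ [j mj <-]; apply: h.
exact: leq_trans km mj.
Qed.

(** * Bounding the orbital entropy of the law *)

Section entropy_bound.
Variables (R : realType) (G : groupType) (p : nat) (s : 'I_p -> G) (c : R).
Hypothesis entropy : forall k, exists N, forall n, (0 < n)%N ->
  exists2 E : nat, E%:R <= (k * n)%:R + c * n%:R ^+ 2 &
    cells (good (R := R) s N (n := n)) (orb (2 * 2^-1 ^+ k)) (2 ^ E).
Local Notation x := (@generator R G p s).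
Local Notation tau := (@group_trace R G).
Local Notation l := (law tau x).

Lemma law_in_Sigma : Sigma 1 l.
Proof.
exists (ell2_hilbert R G), (@group_vN_algebra R G), tau, x; split=> //.
- exact: group_tracial.
- by move=> j; split; [exact: group_vN_generator|exact: generator_self_adjoint].
- exact: generator_opnorm.
Qed.

(** Taking the interior yields an open set directly; [ptws_nbhs] shows that the law still belongs to
    it. *)
Definition law_nbhd (N : nat) (d : R) : set (functional R (p + p)) :=
  Sigma 1 `&` interior (ptws_ball l
    [seq mono_poly R m | m <- words_upto 'I_(p + p) N] d
    : set (functional R (p + p))).

Lemma law_nbhd_open N d : open_in_Sigma 1 (law_nbhd N d).
Proof. by exists (interior (ptws_ball l [seq mono_poly R m | m <- words_upto _ N] d : set (functional R (p + p)))); [exact: open_interior|]. Qed.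

Lemma law_nbhd_law N d : 0 < d -> law_nbhd N d l.
Proof. by move=> d0; split; [exact: law_in_Sigma|exact: ptws_nbhs]. Qed.

Lemma law_nbhdP N d (f : functional R (p + p)) m : law_nbhd N d f -> (size m <= N)%N ->
  normc (l (mono_poly R m) - f (mono_poly R m)) <= d.
Proof.
move=> [_ /interior_subset h] mN.
have := h (mono_poly R m) (map_f _ (mem_words_upto mN)).
by rewrite normc_def ltcR => /ltW.
Qed.

Lemma small_dyadic (e : R) : 0 < e -> exists k, 2^-1 ^+ k < e.
Proof.
move=> e0; exists (Num.truncn e^-1).+1; set k := _.+1.
rewrite exprVn invf_plt ?posrE ?exprn_gt0// -natrX.
by apply: lt_trans (truncnS_gt _) _; rewrite ltr_nat ltn_expl.
Qed.

Lemma Korb_law_nbhd (e : R) : 0 < e -> exists (k N : nat) (d : R), 0 < d /\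
  forall n, (0 < n)%N -> exists2 E : nat, E%:R <= (k * n)%:R + c * n%:R ^+ 2 &
    (Korb e (@microstates R (p + p) n (law_nbhd N d)) <= (2 ^ E)%:R%:E)%E.
Proof.
move=> e0; have p1 : 0 < p.+1%:R :> R by [].
(* The unitary tuples of one cell are conjugate up to [2 * t], and each replacement by unitaries
   costs [2 * eta <= t], so the letters agree up to [4 * t] after conjugation. By [norm2_le] the
   squared distance is at most [p%:R * (4 * t) ^+ 2], which is below [e ^+ 2]. *)
have [|k hk] := @small_dyadic (e / (4 * p.+1%:R)); first by rewrite divr_gt0// mulr_gt0.
set t := 2^-1 ^+ k in hk; have t0 : 0 < t by rewrite exprn_gt0// invr_gt0.
have [N hN] := entropy k.
have N1 : 0 < N.+1%:R :> R by [].
(* The second bound on [eta] and the third bound on [d] below each contribute half of the tolerance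
   [N.+1%:R^-1]. *)
pose eta : R := Num.min (t / 2) (8 * N.+1%:R ^+ 2)^-1.
have eta0 : 0 < eta by rewrite lt_min divr_gt0// invr_gt0 mulr_gt0// exprn_gt0.
have pow0 m : 0 < 2 ^+ m :> R by rewrite exprn_gt0.
pose d : R := Num.min (eta ^+ 2 / 24) (Num.min (2 ^+ (2 * N))^-1 (2 ^+ N * (2 * N.+1%:R))^-1).
have d0 : 0 < d by rewrite !lt_min divr_gt0 ?exprn_gt0// !invr_gt0 !mulr_gt0 ?exprn_gt0.
exists k, (2 * N + 4)%N, d; split=> // n n0.
have [E hE cellsE] := hN n n0; exists E => //.
have hd1 : 24 * d <= eta ^+ 2.
  by rewrite mulrC -ler_pdivlMr// ge_min lexx.
have hd2 : 2 ^+ (2 * N) * d <= 1.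
  by rewrite -ler_pdivlMl// mulr1 !ge_min lexx orbT.
have hd3 : 4 * eta * N%:R + 2 ^+ N * d <= N.+1%:R^-1.
  have h1 : 2 ^+ N * d <= (2 * N.+1%:R)^-1.
    by rewrite -ler_pdivlMl// -invfM !ge_min lexx !orbT.
  have h2 : eta <= (8 * N.+1%:R ^+ 2)^-1 by rewrite ge_min lexx orbT.
  have h3 : 4 * eta * N%:R <= (2 * N.+1%:R)^-1.
    apply: (@le_trans _ _ (4 * (8 * N.+1%:R ^+ 2)^-1 * N.+1%:R)).
      apply: ler_pM; rewrite ?ler0n ?ler_nat ?ler_pM2l// mulr_ge0// ltW//.
    by rewrite le_eqVlt; apply/orP; left; apply/eqP; field; rewrite gt_eqF.
  have -> : N.+1%:R^-1 = (2 * N.+1%:R)^-1 + (2 * N.+1%:R)^-1 :> R.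
    by field; rewrite gt_eqF.
  exact: lerD.
apply: Korb_le_cells; have [f [fK fr]] := cellsE.
have /choice[u hu] (X : 'I_(p + p) -> 'M[R[i]]_n) : exists U : 'I_p -> 'M[R[i]]_n,
    microstates (law_nbhd (2 * N + 4) d) X -> (forall j, mxadj (X j) = X j) /\
    (good s N U /\ forall j, nrm (mx_sip R n) (letters X j - U j) <= 2 * eta).
  have [[Xh Xl]|nX] := pselect (microstates (law_nbhd (2 * N + 4) d) X); last by exists (fun=> 0).
  have Xh' j : mxadj (X j) = X j by exact: hermsymmxP (Xh j).
  have [|U hU] := @nearby_unitary_tuple R G p s n N (letters X) d eta _ eta0 (ltW d0) hd1 hd2 hd3.
    by move=> w wN; apply: (ntr_word_near Xh' _ wN) => m mN; exact: law_nbhdP Xl mN.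
  by exists U.
exists (f \o u); split=> [X /hu[_ [gX _]]|X X' /hu[Xh [gX hX]] /hu[X'h [gX' hX']] /= ff].
  exact: fK.
have [Z Zu hZ] := fr _ _ gX gX' ff; exists Z => //.
have hD := letters_close Zu hX hX' hZ.
have eta_t : 2 * eta <= t.
  have : eta <= t / 2 by rewrite ge_min lexx.
  lra.
have hD' j : nrm (mx_sip R n) (letters X j - Z *m letters X' j *m mxadj Z) <= 4 * t.
  by apply: le_trans (hD j) _; rewrite -/t; lra.
have t4 : 0 <= 4 * t by rewrite mulr_ge0// ltW.
have := norm2_le t4 Xh X'h hD' => h.
rewrite -ltr_sqr ?nnegrE ?sqrtr_ge0 ?(ltW e0)//; apply: le_lt_trans h _.
move: hk; rewrite ltr_pdivlMr ?mulr_gt0// => hk.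
have : (t * (4 * p.+1%:R)) ^+ 2 < e ^+ 2.
  by rewrite ltr_sqr ?nnegrE ?(ltW e0)// mulr_ge0 ?(ltW t0)// mulr_ge0.
have -> : (t * (4 * p.+1%:R)) ^+ 2 = p.+1%:R ^+ 2 * (4 * t) ^+ 2 by ring.
apply: le_lt_trans; rewrite ler_wpM2r ?sqr_ge0//.
by rewrite -natrX ler_nat (leq_trans (leqnSn p))// -mulnn leq_pmulr.
Qed.

Lemma h_law_le : (h_law 1 l <= ((1 + `|c|) * ln 2)%:E)%E.
Proof.
have l2 : 0 <= ln (2 : R) by rewrite ln_ge0// ler1n.
apply: ge_ereal_sup => _ [e e0 <-].
have [k [N [d [d0 hK]]]] := Korb_law_nbhd e0.
apply: (@le_trans _ _ (h_open e (law_nbhd N d))).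
  apply: ereal_inf_lbound; exists (law_nbhd N d) => //.
  by split; [exact: law_nbhd_open|exact: law_nbhd_law].
(* For [n > k] the term [k * n] is at most [n ^ 2], which accounts for the 1 in the bound; what
   remains does not depend on [e]. *)
apply: (@limn_esup_le _ _ _ k.+1) => n kn.
have n0 : (0 < n)%N by exact: leq_ltn_trans kn.
have nr : 0 < n%:R ^+ 2 :> R by rewrite exprn_gt0// ltr0n.
have [E hE /lne_Korb_le hKE] := hK n n0.
apply: (@le_trans _ _ ((n%:R ^+ 2)^-1%:E * (E%:R * ln 2)%:E)%E).
  by apply: lee_wpmul2l => //; rewrite lee_fin invr_ge0 ltW.
rewrite -EFinM lee_fin mulrA ler_wpM2r// ler_pdivrMl//.
apply: le_trans hE _; rewrite mulrDr mulr1; apply: lerD.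
  by rewrite -natrX ler_nat -mulnn leq_mul2r (ltnW kn) orbT.
by rewrite mulrC ler_wpM2l ?ler_norm// ltW.
Qed.

End entropy_bound.

Theorem corollary4p6 (R : realType) (G : groupType)
    (Gcountable : countable [set: G]) (Ginfinite : infinite_set [set: G])
    (Gsofic : sofic R G) (GT : property_T R G) :
  strongly_1_bounded (@group_vN_algebra R G) (@group_trace R G).
Proof.
have [p [s [q [p0 q01 gen gap]]]] := property_T_gap Gcountable GT.
have [c entropy] := entropy_cells p0 gen Gcountable q01 gap.
exists (p + p)%N, (@generator R G p s), 1; split.
- exact: generatorP gen.
- exact: generator_self_adjoint.
- exact: generator_opnorm.
- exact: le_lt_trans (h_law_le entropy) (ltry _).
Qed.
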